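(* The homogeneous solution map $$\mathrm{W}_{0,\natural}:\mathcal{S}(\mathbb{R}^n)\to C^\infty(\mathbb{R}_+,\mathcal{S}(\mathbb{R}^n))\cap C([0,+\infty),\mathcal{S}(\mathbb{R}^n)),\qquad (\mathrm{W}_{0,\natural}h)(t)=\operatorname{W}_{0,t}h,\quad t\in[0,+\infty),$$ and the inhomogeneous solution map $$\int_0^\natural\mathrm{W}_{\sharp,\natural}:C^\infty(\mathbb{R}_+,\mathcal{S}(\mathbb{R}^n))\cap C([0,+\infty),\mathcal{S}(\mathbb{R}^n))\to C^\infty(\mathbb{R}_+,\mathcal{S}(\mathbb{R}^n))\cap C([0,+\infty),\mathcal{S}(\mathbb{R}^n)),$$ $$\Big(\int_0^\natural\mathrm{W}_{\sharp,\natural}h\Big)(t)=\int_0^t\operatorname{W}_{s,t}h(s)\,ds,\quad t\in[0,+\infty),$$ are continuous and linear.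
   Context: $n\in\mathbb{N}$ (positive), $\mathbb{R}_+=(0,\infty)$, and $\mathcal{S}(\mathbb{R}^n)$ is the Schwartz space with seminorms $\|v\|_{\alpha,\beta}=\sup_x|x^\alpha\partial_x^\beta v(x)|$, $\alpha,\beta\in\mathbb{N}_0^n$. Standing assumption: $a\in C^\infty(\mathbb{R}_+,\mathrm{GL}(n))\cap C([0,\infty),\mathrm{GL}(n))$ is a real matrix-valued function such that $a(t)$ is symmetric positive definite for every $t\in[0,\infty)$. Put $A(t)=\int_0^ta(s)\,ds$ ($A(0)=0$), $\Delta=\{(s,t)\in[0,\infty)\times\mathbb{R}_+: s<t\}$, and for $(s,t)\in\Delta$ $$\mathcal{W}(x;s,t)=\frac{1}{\sqrt{(4\pi)^n\det[A(t)-A(s)]}}\,e^{-\frac14\langle x,[A(t)-A(s)]^{-1}x\rangle},\quad x\in\mathbb{R}^n.$$ The operators are $\operatorname{W}_{s,t}v=\mathcal{W}(\cdot;s,t)\ast v$ (convolution in $x$) for $(s,t)\in\Delta$, and $\operatorname{W}_{t,t}v=v$ for $t\ge0$. Topologies: $C^\infty(\mathbb{R}_+,\mathcal{S}(\mathbb{R}^n))$ carries the seminorms $\|h\|_{\alpha,\beta,\gamma,K}=\sup_{t\in K}\sup_{x\in\mathbb{R}^n}|x^\alpha\partial_x^\beta\partial_t^\gamma h(t,x)|$ for $\alpha,\beta\in\mathbb{N}_0^n$, $\gamma\in\mathbb{N}_0$, $K\subset\mathbb{R}_+$ compact; $C([0,+\infty),\mathcal{S}(\mathbb{R}^n))$ carries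 the seminorms $\|h\|_{\alpha,\beta,b}=\sup_{t\in[0,b]}\|h(t)\|_{\alpha,\beta}$ for $\alpha,\beta\in\mathbb{N}_0^n$, $b\in\mathbb{N}$; the intersection carries the topology generated by both families of seminorms. *)

(* Defs.v *)
From HB Require Import structures.
From mathcomp Require Import all_boot all_order all_algebra.
From mathcomp Require Import finmap complex.
From mathcomp Require Import all_classical all_reals all_analysis.

Set Implicit Arguments.
Unset Strict Implicit.
Unset Printing Implicit Defensive.

Import Order.TTheory GRing.Theory Num.Theory.
Import numFieldNormedType.Exports.
Import ComplexField.Normc.

Local Open Scope classical_set_scope.
Local Open Scope ring_scope.

(* The library equips a product measure with a sigma-finite structure only for
   subprobabilities, hence this restatement for sigma-finite factors. *)
Lemma sigma_finite_prod d1 d2 (T1 : measurableType d1)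
    (T2 : measurableType d2) (R : realType)
    (m1 : {sigma_finite_measure set T1 -> \bar R})
    (m2 : {sigma_finite_measure set T2 -> \bar R}) :
  sigma_finite setT (m1 \x m2)%E.
Proof.
have /sigma_finiteP[F [TF ndF Foo]] := sigma_finiteT m1.
have /sigma_finiteP[G [TG ndG Goo]] := sigma_finiteT m2.
exists (fun n => F n `*` G n).
 rewrite -setXTT TF TG predeqE => -[x y]; split.
    move=> [/= [n _ Fnx] [k _ Gky]]; exists (maxn n k) => //; split.
    - by move: x Fnx; exact/subsetPset/ndF/leq_maxl.
    - by move: y Gky; exact/subsetPset/ndG/leq_maxr.
  by move=> [n _ []/= ? ?]; split; exists n.
move=> k; have [? ?] := Foo k; have [? ?] := Goo k.
split; first exact: measurableX.
by rewrite product_measure1E// lte_mul_pinfty// ge0_fin_numE.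
Qed.

Section LebesgueRn.
Context {R : realType}.
Local Notation RR := (measurableTypeR R).

Definition tcons n (p : RR * n.-tuple RR) : n.+1.-tuple RR :=
  [tuple of p.1 :: p.2].

Lemma measurable_tcons n : measurable_fun setT (@tcons n).
Proof. exact: measurable_cons. Qed.

Section step.
Variables (n : nat) (mu : {sigma_finite_measure set (n.-tuple RR) -> \bar R}).

Definition leb_step : set (n.+1.-tuple RR) -> \bar R :=
  pushforward (@lebesgue_measure R \x mu)%E (@tcons n).

Let preim A : measurable A -> measurable (@tcons n @^-1` A).
Proof.
by move=> mA; rewrite -[X in measurable X]setTI; exact: measurable_tcons.
Qed.

Let leb_step0 : leb_step set0 = 0%E.
Proof. by rewrite /leb_step /pushforward preimage_set0 measure0. Qed.

Let leb_step_ge0 A : (0 <= leb_step A)%E.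
Proof. by apply: integral_ge0 => x _; exact: measure_ge0. Qed.

Let leb_step_sigma_additive : semi_sigma_additive leb_step.
Proof.
move=> F mF tF mUF; rewrite /leb_step /pushforward preimage_bigcup.
apply: measure_semi_sigma_additive.
- by move=> k; exact: preim.
- apply/trivIsetP => /= i j _ _ ij; rewrite -preimage_setI.
  by move/trivIsetP : tF => /(_ _ _ _ _ ij) ->//; rewrite preimage_set0.
- by rewrite -preimage_bigcup; exact: preim.
Qed.

HB.instance Definition _ := isMeasure.Build _ _ _ leb_step
  leb_step0 leb_step_ge0 leb_step_sigma_additive.

Lemma sigma_finite_leb_step : sigma_finite setT leb_step.
Proof.
have [F FT mF] : sigma_finite setT (@lebesgue_measure R \x mu)%E.
  exact: sigma_finite_prod.
pose g (t : n.+1.-tuple RR) : RR * n.-tuple RR := (thead t, [tuple of behead t]).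
have gK p : g (tcons p) = p.
  by case: p => x t; rewrite /g /tcons theadE; congr pair; exact/val_inj.
have mg : measurable_fun setT g.
  apply/measurable_fun_pair; first exact: measurable_tnth.
  exact: measurable_behead.
exists (fun k => g @^-1` (F k)).
  by rewrite -preimage_bigcup -FT preimage_setT.
move=> k; have [mFk Fk] := mF k; split.
  by rewrite -[X in measurable X]setTI; exact: mg.
rewrite /leb_step /pushforward -comp_preimage.
by rewrite (_ : g \o _ = id)//; apply/funext => p; exact: gK.
Qed.

HB.instance Definition _ := Measure_isSigmaFinite.Build _ _ _ leb_step
  sigma_finite_leb_step.
End step.

(* Lebesgue measure on the Borel sets of R^n: the iterated product of the
   one-dimensional Lebesgue measure, transported to n.-tuple. *)
Fixpoint lebesgue_tuple (n : nat) :
    {sigma_finite_measure set (n.-tuple RR) -> \bar R} :=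
  match n with
  | 0 => [the {sigma_finite_measure set (0.-tuple RR) -> \bar R}
            of dirac [tuple]]
  | m.+1 => [the {sigma_finite_measure set (m.+1.-tuple RR) -> \bar R}
            of leb_step (lebesgue_tuple m)]
  end.

End LebesgueRn.

(* Subbase of the topology generated by the seminorms p i, i in D: all the open
   semiballs, whatever their center v and radius e. *)
Definition seminorm_subbase (R : realType) (V : zmodType) (I : Type)
    (D : set I) (p : I -> V -> R) : set (set V) :=
  [set B | exists i v e, [/\ D i, 0 < e & B = [set w | p i (w - v) < e]]].

Section RnCalculus.
Variables (R : realType) (n : nat).
Local Notation E := 'rV[R]_n.
Local Notation C := R[i].
Implicit Types (f g : E -> C) (x : E) (i : 'I_n) (w : seq 'I_n).

Lemma normc_ge0 (z : C) : 0 <= normc z.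
Proof. by case: z => a b; exact: sqrtr_ge0. Qed.

Definition integral_Rn (f : E -> R) : R :=
  \int[@lebesgue_tuple R n]_t f (\row_i tnth t i).

Definition cintegral_Rn f : C :=
  (integral_Rn (fun y => complex.Re (f y)) +i*
   integral_Rn (fun y => complex.Im (f y)))%C.

Definition convolution f g x : C := cintegral_Rn (fun y => f (x - y) * g y).

Definition cReal f : E -> R := fun x => complex.Re (f x).
Definition cImag f : E -> R := fun x => complex.Im (f x).

(* Partial derivatives of complex-valued functions of a real vector are taken on
   the real and imaginary parts: the library has no normed-module structure on
   R[i] over R. *)
Definition pderiv i f : E -> C := fun x =>
  ('D_(delta_mx 0 i) (cReal f) x +i* 'D_(delta_mx 0 i) (cImag f) x)%C.

Definition pderivs w f : E -> C := foldr pderiv f w.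

(* C^oo: the iterated partial derivatives, in every order (w is a word of
   directions), exist and are continuous. *)
Definition smooth_Rn f : Prop := forall w x,
  [/\ {for x, continuous (cReal (pderivs w f))},
      {for x, continuous (cImag (pderivs w f))} &
      forall i, derivable (cReal (pderivs w f)) x (delta_mx 0 i) /\
                derivable (cImag (pderivs w f)) x (delta_mx 0 i)].

Definition xmonom (al : {ffun 'I_n -> nat}) x : R :=
  \prod_(i < n) x 0 i ^+ al i.

Definition mderiv (be : {ffun 'I_n -> nat}) f : E -> C :=
  pderivs (flatten [seq nseq (be i) i | i <- enum 'I_n]) f.

Definition schwartz_val (al be : {ffun 'I_n -> nat}) f x : R :=
  normc ((xmonom al x)%:C%C * mderiv be f x).

Definition is_schwartz f : Prop := smooth_Rn f /\
  forall al be, exists M : R, forall x, schwartz_val al be f x <= M.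

Definition schwartz_pred : {pred (E -> C)} := fun f => `[< is_schwartz f >].

Lemma schwartz_predP f : reflect (is_schwartz f) (f \in schwartz_pred).
Proof. exact: asboolP. Qed.

Record schwartz := Schwartz {
  schwartz_fun :> E -> C;
  schwartz_funP : schwartz_fun \in schwartz_pred }.

HB.instance Definition _ := [isSub for schwartz_fun].
HB.instance Definition _ := [Choice of schwartz by <:].

Lemma cReal_lin (c : C) f g :
  cReal (c *: f + g) = complex.Re c *: cReal f + (- complex.Im c) *: cImag f + cReal g.
Proof.
apply/funext => x.
transitivity (complex.Re (c * f x + g x)) => //.
transitivity (complex.Re c * complex.Re (f x) + (- complex.Im c) * complex.Im (f x)
  + complex.Re (g x)) => //.
by case: c (f x) (g x) => a b [? ?] [? ?] /=; rewrite mulNr.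
Qed.

Lemma cImag_lin (c : C) f g :
  cImag (c *: f + g) = complex.Re c *: cImag f + complex.Im c *: cReal f + cImag g.
Proof.
apply/funext => x.
transitivity (complex.Im (c * f x + g x)) => //.
transitivity (complex.Re c * complex.Im (f x) + complex.Im c * complex.Re (f x)
  + complex.Im (g x)) => //.
by case: c (f x) (g x) => a b [? ?] [? ?].
Qed.

Lemma derivable_comb (k l : R) (p q r : E -> R) x v :
  derivable p x v -> derivable q x v -> derivable r x v ->
  derivable (k *: p + l *: q + r) x v.
Proof.
move=> dp dq dr.
exact: (derivableD (derivableD (derivableZ dp) (derivableZ dq)) dr).
Qed.

Lemma derive_comb (k l : R) (p q r : E -> R) x v :
  derivable p x v -> derivable q x v -> derivable r x v ->
  'D_v (k *: p + l *: q + r) x = k * 'D_v p x + l * 'D_v q x + 'D_v r x.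
Proof.
move=> dp dq dr.
rewrite (deriveD (derivableD (derivableZ dp) (derivableZ dq)) dr).
by rewrite (deriveD (derivableZ dp) (derivableZ dq)) (deriveZ _ dp) (deriveZ _ dq).
Qed.

Lemma continuous_comb (k l : R) (p q r : E -> R) x :
  {for x, continuous p} -> {for x, continuous q} -> {for x, continuous r} ->
  {for x, continuous (k *: p + l *: q + r)}.
Proof.
move=> cp cq cr.
exact: (cvgD (cvgD (cvgZl_tmp (k := k) cp) (cvgZl_tmp (k := l) cq)) cr).
Qed.

Lemma pderiv_lin i (c : C) f g :
  (forall x, derivable (cReal f) x (delta_mx 0 i) /\
             derivable (cImag f) x (delta_mx 0 i)) ->
  (forall x, derivable (cReal g) x (delta_mx 0 i) /\
             derivable (cImag g) x (delta_mx 0 i)) ->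
  pderiv i (c *: f + g) = c *: pderiv i f + pderiv i g.
Proof.
move=> df dg; apply/funext => x; rewrite /pderiv cReal_lin cImag_lin.
have [df1 df2] := df x; have [dg1 dg2] := dg x.
rewrite !derive_comb//.
transitivity (c * pderiv i f x + pderiv i g x) => //; rewrite /pderiv.
by case: c => a b; apply/eqP; rewrite eq_complex /= mulNr !eqxx.
Qed.

Lemma pderivs_lin w (c : C) f g : smooth_Rn f -> smooth_Rn g ->
  pderivs w (c *: f + g) = c *: pderivs w f + pderivs w g.
Proof.
move=> sf sg; elim: w => [//|i w IH] /=.
rewrite IH pderiv_lin// => x.
  by have [_ _ /(_ i)] := sf w x.
by have [_ _ /(_ i)] := sg w x.
Qed.

Lemma smooth_lin (c : C) f g : smooth_Rn f -> smooth_Rn g -> smooth_Rn (c *: f + g).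
Proof.
move=> sf sg w x; rewrite pderivs_lin// cReal_lin cImag_lin.
have [f1 f2 f3] := sf w x; have [g1 g2 g3] := sg w x.
split; [exact: continuous_comb..|].
by move=> i; have [? ?] := f3 i; have [? ?] := g3 i; split; exact: derivable_comb.
Qed.

Lemma schwartz_val_lin al be (c : C) f g x : smooth_Rn f -> smooth_Rn g ->
  schwartz_val al be (c *: f + g) x <=
  normc c * schwartz_val al be f x + schwartz_val al be g x.
Proof.
move=> sf sg; rewrite /schwartz_val /mderiv pderivs_lin// -normcM.
rewrite [X in normc X <= _](_ : _ = c * ((xmonom al x)%:C%C * mderiv be f x) +
   (xmonom al x)%:C%C * mderiv be g x); first exact: le_normcD.
by rewrite mulrDr mulrCA.
Qed.

Lemma pderivs0 w : pderivs w 0 = 0.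
Proof.
elim: w => //= i w ->; apply/funext => x; rewrite /pderiv.
by rewrite [cReal 0](_ : _ = cst 0)// [cImag 0](_ : _ = cst 0)// derive_cst.
Qed.

Lemma is_schwartz0 : is_schwartz 0.
Proof.
split=> [w x|al be].
  rewrite pderivs0 [cReal 0](_ : _ = cst 0)// [cImag 0](_ : _ = cst 0)//.
  by split; [exact: cst_continuous..|]; move=> i; split; exact: derivable_cst.
by exists 0 => x; rewrite /schwartz_val /mderiv pderivs0 mulr0 normc0.
Qed.

Lemma schwartz_submod_closed : submod_closed schwartz_pred.
Proof.
split; first exact/schwartz_predP/is_schwartz0.
move=> c f g /schwartz_predP[sf bf] /schwartz_predP[sg bg].
apply/schwartz_predP; split; first exact: smooth_lin.
move=> al be; have [M fM] := bf al be; have [N gN] := bg al be.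
exists (normc c * M + N) => x; apply: (le_trans (schwartz_val_lin _ _ _ _ sf sg)).
by apply: lerD => //; apply: ler_wpM2l => //; case: c => ? ?; rewrite sqrtr_ge0.
Qed.

HB.instance Definition _ := GRing.isSubmodClosed.Build _ _ schwartz_pred
  schwartz_submod_closed.
HB.instance Definition _ := [SubChoice_isSubLmodule of schwartz by <:].
HB.instance Definition _ := isPointed.Build schwartz 0.

Definition schwartz_seminorm (al be : {ffun 'I_n -> nat}) (v : schwartz) : R :=
  sup [set schwartz_val al be v x | x in [set: E]].

HB.instance Definition _ := isSubBaseTopological.Build schwartz
  (seminorm_subbase [set: {ffun 'I_n -> nat} * {ffun 'I_n -> nat}]
     (fun ab => schwartz_seminorm ab.1 ab.2)) id.

Lemma schwartz_val_le_seminorm al be (v : schwartz) x :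
  schwartz_val al be v x <= schwartz_seminorm al be v.
Proof.
have /schwartz_predP[_ /(_ al be)[M vM]] := schwartz_funP v.
by apply: ub_le_sup; [exists M => _ [y _ <-]|exists x].
Qed.

Lemma schwartz_seminorm_ge0 al be (v : schwartz) :
  0 <= schwartz_seminorm al be v.
Proof.
by apply: le_trans (schwartz_val_le_seminorm _ _ _ 0); exact: normc_ge0.
Qed.

Lemma schwartz_seminorm_lin al be (c : C) (v w : schwartz) :
  schwartz_seminorm al be (c *: v + w) <=
  normc c * schwartz_seminorm al be v + schwartz_seminorm al be w.
Proof.
apply: ge_sup; first by exists (schwartz_val al be (c *: v + w : schwartz) 0), 0.
move=> _ [x _ <-].
have /schwartz_predP[sv _] := schwartz_funP v.
have /schwartz_predP[sw _] := schwartz_funP w.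
apply: (le_trans (schwartz_val_lin _ _ _ _ sv sw)).
apply: lerD; last exact: schwartz_val_le_seminorm.
apply: ler_wpM2l; last exact: schwartz_val_le_seminorm.
exact: normc_ge0.
Qed.

Lemma schwartz_seminorm0 al be : schwartz_seminorm al be 0 = 0.
Proof.
rewrite /schwartz_seminorm [X in sup X](_ : _ = [set 0]) ?sup1//.
have e x : schwartz_val al be (0 : schwartz) x = 0.
  by rewrite /schwartz_val /mderiv pderivs0 mulr0 normc0.
by apply/seteqP; split => [_ [x _ <-]|_ ->] /=; [|exists 0].
Qed.

Lemma schwartz_cvgP (F : set_system schwartz) (v : schwartz) : Filter F ->
  (F --> v) <-> forall al be (e : R), 0 < e ->
    \forall w \near F, schwartz_seminorm al be (w - v) < e.
Proof.
move=> FF; split => [Fv al be e e0|Fv].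
  apply: Fv; rewrite /= nbhsE.
  pose B := [set w : schwartz | schwartz_seminorm al be (w - v) < e].
  exists B => //; split; last by rewrite /B /= subrr schwartz_seminorm0.
  exists [set B]; last by rewrite bigcup_set1.
  move=> _ ->; exists [fset B]%fset; last by rewrite set_fset1 bigcap_set1.
  by move=> A /fset1P ->; apply/mem_set; exists (al, be), v, e; split.
move=> A; rewrite /= nbhsE => -[_ [[B sB <-] [D BD Dv]] sA].
apply: filterS sA _; apply: (@filterS _ _ _ D); first by move=> w Dw; exists D.
have [K sK KD] := sB _ BD; rewrite -KD; apply: filter_bigI => U KU.
have /set_mem[[al be] [u [e /= [_ e0 UE]]]] := sK _ KU.
have : U v by move: Dv; rewrite -KD; exact.
rewrite UE /= -subr_gt0 => ve.
apply: filterS (Fv al be _ ve) => w /=.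
rewrite ltrBrDr; apply: le_lt_trans.
rewrite (_ : w - u = 1 *: (w - v) + (v - u)); last by rewrite scale1r addrA subrK.
by apply: (le_trans (schwartz_seminorm_lin _ _ _ _ _)); rewrite normc1 mul1r.
Qed.

Lemma schwartz_cvg_lin (T : Type) (F : set_system T) (p q : T -> schwartz)
    (c : C) (a b : schwartz) : Filter F -> p @ F --> a -> q @ F --> b ->
  (fun t => c *: p t + q t) @ F --> c *: a + b.
Proof.
move=> FF /schwartz_cvgP pa /schwartz_cvgP qb.
apply/schwartz_cvgP => al be e e0.
have c1 : 0 < normc c + 1 by rewrite ltr_wpDl// normc_ge0.
have c2 : 0 < normc c + 1 + 1 by rewrite ltr_wpDl// ltW.
pose d := e / (normc c + 1 + 1).
have d0 : 0 < d by rewrite divr_gt0.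
have qd : \forall t \near F, schwartz_seminorm al be (q t - b) < d := qb al be _ d0.
have pd : \forall t \near F, schwartz_seminorm al be (p t - a) < d := pa al be _ d0.
change (\forall t \near F,
  schwartz_seminorm al be (c *: p t + q t - (c *: a + b)) < e); near=> t.
have qt : schwartz_seminorm al be (q t - b) < d by near: t.
have pt : schwartz_seminorm al be (p t - a) < d by near: t.
rewrite (_ : _ - _ = c *: (p t - a) + (q t - b)); last first.
  by rewrite scalerBr opprD addrACA.
apply: (le_lt_trans (schwartz_seminorm_lin _ _ _ _ _)).
rewrite (_ : e = (normc c + 1) * d + d); last first.
  by rewrite -[X in _ + X]mul1r -mulrDl /d mulrCA divff ?mulr1// gt_eqF.
apply: ler_ltD => //; apply: ler_pM; [exact: normc_ge0| |by rewrite lerDl|exact: ltW].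
exact: schwartz_seminorm_ge0.
Unshelve. all: by end_near. Qed.

Lemma schwartz_seminorm_eq0 (v : schwartz) :
  schwartz_seminorm [ffun=> 0%N] [ffun=> 0%N] v <= 0 -> v = 0.
Proof.
move=> v0; apply/val_inj/funext => x /=.
have := le_trans (schwartz_val_le_seminorm _ _ v x) v0.
rewrite /schwartz_val /xmonom big1; last by move=> i _; rewrite ffunE.
rewrite /mderiv (_ : flatten _ = [::]) ?mul1r /=; last first.
  by elim: (enum _) => //= i l ->; rewrite ffunE.
move=> vx; apply: eq0_normc; apply/eqP.
by rewrite eq_le vx normc_ge0.
Qed.

Lemma schwartz_hausdorff : hausdorff_space schwartz.
Proof.
move=> a b ab; apply/eqP; rewrite -subr_eq0; apply/eqP/schwartz_seminorm_eq0.
apply/ler_addgt0Pr => e e0; rewrite add0r.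
have e20 : 0 < e / 2 by rewrite divr_gt0.
have near_ball (v : schwartz) : nbhs v
    [set w | schwartz_seminorm [ffun=> 0%N] [ffun=> 0%N] (w - v) < e / 2].
  have [/(_ (@cvg_id _ (nbhs v)))] := @schwartz_cvgP (nbhs v) v _.
  by move=> /(_ [ffun=> 0%N] [ffun=> 0%N] _ e20).
have [c [/= ca cb]] := ab _ _ (near_ball a) (near_ball b).
rewrite (_ : a - b = (-1) *: (c - a) + (c - b)); last first.
  by rewrite scaleN1r opprB addrA subrK.
apply: (le_trans (schwartz_seminorm_lin _ _ _ _ _)).
rewrite normcN normc1 mul1r [e]splitr; apply: lerD; exact: ltW.
Qed.

(* A curve [0, +oo) -> S(R^n) is encoded as a total function R -> S(R^n) that
   vanishes on the negative reals, so that equality of curves is equality of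
   functions.  curve_deriv is the derivative in the topology of S(R^n); its
   values at t <= 0 are never used. *)
Definition diff_quotient (h : R -> schwartz) (t : R) : R -> schwartz :=
  fun e => (e^-1)%:C%C *: (h (e + t) - h t).

Definition curve_deriv (h : R -> schwartz) : R -> schwartz :=
  fun t => lim (diff_quotient h t @ 0^').

Definition curve_derivn (k : nat) (h : R -> schwartz) : R -> schwartz :=
  iter k curve_deriv h.

Definition is_solution_curve (h : R -> schwartz) : Prop :=
  [/\ forall t, t < 0 -> h t = 0,
      forall k t, 0 < t -> cvg (diff_quotient (curve_derivn k h) t @ 0^') &
      {within `[0, +oo[, continuous h}].

Definition solution_pred : {pred (R -> schwartz)} :=
  fun h => `[< is_solution_curve h >].

Lemma solution_predP h : reflect (is_solution_curve h) (h \in solution_pred).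
Proof. exact: asboolP. Qed.

Record solution_space := SolutionSpace {
  solution_fun :> R -> schwartz;
  solution_funP : solution_fun \in solution_pred }.

HB.instance Definition _ := [isSub for solution_fun].
HB.instance Definition _ := [Choice of solution_space by <:].

Lemma diff_quotient_lin (c : C) (g h : R -> schwartz) t e :
  diff_quotient (c *: g + h) t e = c *: diff_quotient g t e + diff_quotient h t e.
Proof.
rewrite /diff_quotient (_ : _ - _ = c *: (g (e + t) - g t) + (h (e + t) - h t)).
  by rewrite scalerDr !scalerA mulrC.
by rewrite scalerBr opprD addrACA.
Qed.

Lemma diff_quotient_eq (g h : R -> schwartz) t :
  (forall s, 0 < s -> g s = h s) -> 0 < t ->
  \forall e \near (0 : R)^', diff_quotient g t e = diff_quotient h t e.
Proof.
move=> gh t0; have : \forall e \near (0 : R)^', - t < e.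
  apply: nbhs_dnbhs; apply: lt_nbhsr; by rewrite oppr_lt0.
apply: filterS => e te; rewrite /diff_quotient !gh//.
by rewrite -ltrBlDr sub0r.
Qed.

Lemma diff_quotient_eq_cvg (g h : R -> schwartz) t (l : schwartz) :
  (forall s, 0 < s -> g s = h s) -> 0 < t ->
  diff_quotient g t @ 0^' --> l -> diff_quotient h t @ 0^' --> l.
Proof.
move=> gh t0; apply: cvg_trans; apply: near_eq_cvg.
by apply: diff_quotient_eq => // s s0; rewrite gh.
Qed.

Lemma curve_derivn_lin (c : C) (g h : R -> schwartz) k t :
  is_solution_curve g -> is_solution_curve h -> 0 < t ->
  curve_derivn k (c *: g + h) t = c *: curve_derivn k g t + curve_derivn k h t.
Proof.
move=> [_ sg _] [_ sh _]; elim: k t => [//|k IH] t t0.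
rewrite /curve_derivn /= -![iter k _ _]/(curve_derivn k _) {1}/curve_deriv.
apply: cvg_lim; first exact: schwartz_hausdorff.
apply: (@diff_quotient_eq_cvg (c *: curve_derivn k g + curve_derivn k h)) => //.
  by move=> s s0; rewrite IH.
rewrite [X in X @ _ --> _](_ : _ = fun e =>
  c *: diff_quotient (curve_derivn k g) t e + diff_quotient (curve_derivn k h) t e).
  by apply: schwartz_cvg_lin; [exact: sg|exact: sh].
by apply/funext => e; exact: diff_quotient_lin.
Qed.

Lemma diff_quotient0 t : diff_quotient 0 t = cst 0.
Proof. by apply/funext => e; rewrite /diff_quotient subrr scaler0. Qed.

Lemma curve_derivn0 k : curve_derivn k 0 = 0.
Proof.
elim: k => [//|k IH]; rewrite /curve_derivn /= -[iter k _ _]/(curve_derivn k _) IH.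
apply/funext => t; rewrite /curve_deriv diff_quotient0.
by apply: lim_cst; exact: schwartz_hausdorff.
Qed.

Lemma solution_submod_closed : submod_closed solution_pred.
Proof.
split.
  apply/solution_predP; split => //.
    by move=> k t t0; rewrite curve_derivn0 diff_quotient0; exact: is_cvg_cst.
  by move=> x; exact: cvg_cst.
move=> c g h /solution_predP sg /solution_predP sh; apply/solution_predP.
have [g0 dg cg] := sg; have [h0 dh ch] := sh; split.
- move=> t t0.
  by transitivity (c *: g t + h t) => //; rewrite g0// h0// scaler0 addr0.
- move=> k t t0; apply/cvg_ex.
  exists (c *: curve_derivn k.+1 g t + curve_derivn k.+1 h t).
  apply: (@diff_quotient_eq_cvg (c *: curve_derivn k g + curve_derivn k h)) => //.
    by move=> s s0; rewrite curve_derivn_lin.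
  rewrite [X in X @ _ --> _](_ : _ = fun e =>
    c *: diff_quotient (curve_derivn k g) t e + diff_quotient (curve_derivn k h) t e).
    by apply: schwartz_cvg_lin; [exact: dg|exact: dh].
  by apply/funext => e; exact: diff_quotient_lin.
- by move=> x; apply: schwartz_cvg_lin; [exact: cg|exact: ch].
Qed.

HB.instance Definition _ := GRing.isSubmodClosed.Build _ _ solution_pred
  solution_submod_closed.
HB.instance Definition _ := [SubChoice_isSubLmodule of solution_space by <:].

(* Evaluation at x and its derivatives are continuous on S(R^n), so that
   curve_derivn ga h t, as a function of x, is the ga-th time derivative of
   h(t, x), and the supremum over t and x is taken in two steps. *)
Definition solution_seminorm_smooth (al be : {ffun 'I_n -> nat}) (ga : nat)
    (K : set R) (h : solution_space) : R :=
  sup [set schwartz_seminorm al be (curve_derivn ga h t) | t in K].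

Definition solution_seminorm_cont (al be : {ffun 'I_n -> nat}) (b : nat)
    (h : solution_space) : R :=
  sup [set schwartz_seminorm al be (h t) | t in `[0, b%:R]].

Definition solution_subbase : set (set solution_space) :=
  seminorm_subbase
    [set j : {ffun 'I_n -> nat} * {ffun 'I_n -> nat} * nat * set R |
       compact j.2 /\ j.2 `<=` `]0, +oo[]
    (fun j => solution_seminorm_smooth j.1.1.1 j.1.1.2 j.1.2 j.2) `|`
  seminorm_subbase
    [set j : {ffun 'I_n -> nat} * {ffun 'I_n -> nat} * nat | (0 < j.2)%N]
    (fun j => solution_seminorm_cont j.1.1 j.1.2 j.2).

HB.instance Definition _ := isSubBaseTopological.Build solution_space
  solution_subbase id.

(* For a partition a = s_(-1) < s_0 < ... < s_(m-1) = b (with s = [:: s_0; ...])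
   and tags xi k in [s_(k-1), s_k]; nth a (a :: s) k is s_(k-1). *)
Definition riemann_sum (f : R -> schwartz) (a : R) (s : seq R)
    (xi : nat -> R) : schwartz :=
  \sum_(k < size s) (nth a s k - nth a (a :: s) k)%:C%C *: f (xi k).

(* v is the S(R^n)-valued integral of f over [a, b]: the limit of the Riemann
   sums, for the topology of S(R^n), as the mesh tends to 0. *)
Definition is_riemann_integral (f : R -> schwartz) (a b : R)
    (v : schwartz) : Prop :=
  forall U, nbhs v U -> exists2 d : R, 0 < d &
    forall s xi, itv_partition a b s ->
      (forall k, (k < size s)%N ->
        nth a s k - nth a (a :: s) k < d /\
        nth a (a :: s) k <= xi k <= nth a s k) ->
      U (riemann_sum f a s xi).

Definition spd_mx (M : 'M[R]_n) : Prop :=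
  M^T = M /\ forall x : E, x != 0 -> 0 < (x *m M *m x^T) 0 0.

Definition heat_coefficient (a : R -> 'M[R]_n) : Prop :=
  [/\ forall k t, 0 < t -> derivable (derive1n k a) t 1,
      {within `[0, +oo[, continuous a},
      forall t, 0 <= t -> a t \in unitmx &
      forall t, 0 <= t -> spd_mx (a t)].

Definition primitive_mx (a : R -> 'M[R]_n) (t : R) : 'M[R]_n :=
  \matrix_(i, j) \int[@lebesgue_measure R]_(s in `[0, t]) a s i j.

Definition heat_kernel (a : R -> 'M[R]_n) (s t : R) (x : E) : R :=
  let M := primitive_mx a t - primitive_mx a s in
  (Num.sqrt ((4 * pi) ^+ n * \det M))^-1 *
  expR (- (4^-1 * (x *m invmx M *m x^T) 0 0)).

(* Meant for 0 <= s <= t. *)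
Definition heat_operator (a : R -> 'M[R]_n) (s t : R) (v : E -> C) : E -> C :=
  if s == t then v else convolution (fun x => (heat_kernel a s t x)%:C%C) v.

End RnCalculus.

(* Main.v *)
From HB Require Import structures.
Require Import Defs.
From mathcomp Require Import all_boot all_order all_algebra.
From mathcomp Require Import finmap complex.
From mathcomp Require Import all_classical all_reals all_analysis.
From mathcomp Require Import measurable_realfun ring lra.

(* A positive definite M is a sum of n rank one matrices b^T b (Schur
   complements), and correspondingly the convolution with the heat kernel of
   matrix M is a product of n one-dimensional Gaussian averages along the
   vectors b.  One such average differs from v + kappa (b.grad)^2 v by
   O(|b|^4), uniformly in each Schwartz norm of v.  Hence the product depends
   only on M, which gives the evolution law W(s,t) W(r,s) = W(r,t), and
   W(s,t) v = v + kappa sum_ij (A(t) - A(s))_ij d_i d_j v + O((t - s)^2).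
   A curve u with u(t) = W(s,t) u(s) + (t - s) h(s) + o(t - s) locally uniformly
   therefore satisfies u' = h + kappa sum_ij a_ij d_i d_j u; both solution maps
   produce such curves.  All higher derivatives and their bounds follow by
   induction from this equation. *)

Set Implicit Arguments.
Unset Strict Implicit.
Unset Printing Implicit Defensive.

Import Order.TTheory GRing.Theory Num.Theory.
Import numFieldNormedType.Exports.
Import ComplexField.Normc.

Local Open Scope classical_set_scope.
Local Open Scope ring_scope.

(** * One-variable calculus and partial derivatives *)

Section OneVariable.
Variable R : realType.
Implicit Types (g dg : R -> R) (G : nat -> R -> R) (s K : R).

(** The vectors found for A(t) - A(s) are the rows of a Cholesky factor, and this factor is not
    additive in time: joining the lists for [r, s] and [s, t] gives up to 2n vectors, against n for
    [r, t]. Comparing the two is the crux. It rests on three facts about averages along vectors: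
    they commute, averaging along p b and then q b is averaging along r b when r^2 = p^2 + q^2, and
    two lists with the same matrix have the same expansion up to second order. The second obstacle
    is time 0, where a is only continuous. Estimates are therefore made on increments over [s, t]
    with 0 <= s, uniformly on [0, b], and A is reached through mean values of a. The step error is
    quadratic in time because the sum of the |b|^2 is at most the trace of A(t) - A(s), which is O(t
    - s), so that fourth powers of the vectors are O((t - s)^2). Each such estimate loses up to six
    orders of the norm, which is harmless for a topology given by all of them. The constant kappa is
    half the second moment of a normal density of variance 2, that is 1; it is kept as a symbol. *)

Lemma MVT0 g dg s : (forall t : R, is_derive t (1 : R) g (dg t)) ->
  exists2 c, `|c| <= `|s| & g s - g 0 = dg c * s.
Proof.
move=> dgg.
have cg (i : interval R) : {within [set` i], continuous g}.
  by apply: derivable_within_continuous => x _; have [] := dgg x.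
have [s0|s0|->] := ltgtP s 0.
- have [c cs e] := MVT s0 (fun x _ => dgg x) (cg _).
  exists c; last by rewrite -opprB e sub0r mulrN opprK.
  move: cs; rewrite in_itv /= => /andP[sc c0].
  by rewrite (ltr0_norm c0) (ltr0_norm s0) lerN2 ltW.
- have [c cs e] := MVT s0 (fun x _ => dgg x) (cg _).
  exists c; last by rewrite e subr0.
  move: cs; rewrite in_itv /= => /andP[c0 cs].
  by rewrite (gtr0_norm c0) (gtr0_norm s0) ltW.
- by exists 0; rewrite // subrr mulr0.
Qed.

Lemma is_derive_expf (m : nat) (t : R) :
  is_derive t (1:R) (fun t => t ^+ m.+1 / (m.+1)`!%:R) (t ^+ m / m`!%:R).
Proof.
have h := is_deriveX m.+1 (is_derive_id t (1 : R)).
have := is_deriveZ ((m.+1)`!%:R^-1) h.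
set f := (X in is_derive _ _ X _) => hf.
have -> : (fun t : R => t ^+ m.+1 / (m.+1)`!%:R) = f.
  apply/funext => u; rewrite /f /= mulrC; congr (_ * _).
  by elim: (m.+1) => // k IH; rewrite !exprS IH.
apply: is_derive_eq hf _.
rewrite /= /GRing.scale /= mulr1 factS natrM invfM mulrC.
by rewrite mulrACA divff ?mul1r // pnatr_eq0.
Qed.

(** Induction on m with the mean value theorem: the derivative of the remainder of [G 0] is the
    remainder of [G 1], one order lower. The constant is not divided by m!, since only the order of
    the remainder matters. *)
Lemma taylor_bound m G K s : (forall k (t : R), is_derive t (1 : R) (G k) (G k.+1 t)) ->
  (forall c, `|c| <= `|s| -> `|G m c| <= K) ->
  `|G 0%N s - \sum_(j < m) G j 0 * (s ^+ j / j`!%:R)| <= K * `|s| ^+ m.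
Proof.
elim: m G s => [|m IH] G s dG bG.
  by rewrite big_ord0 subr0 expr0 mulr1; exact: bG.
pose T t := \sum_(j < m.+1) G j 0 * (t ^+ j / j`!%:R).
pose T' t := \sum_(j < m) G j.+1 0 * (t ^+ j / j`!%:R).
have dT t : is_derive t (1:R) (fun t => G 0%N t - T t) (G 1%N t - T' t).
  apply: (is_deriveB (dG 0%N t)).
  have -> : T = (fun=> G 0%N 0) + \sum_(j < m) (fun t => G j.+1 0 * (t ^+ j.+1 / j.+1`!%:R)).
    apply/funext => u; rewrite /T big_ord_recl expr0 fact0 divr1 mulr1.
    by rewrite [RHS]/GRing.add /= fct_sumE.
  apply: (is_derive_eq (is_deriveD (is_derive_cst _ _ _)
    (is_derive_sum (fun j => is_deriveZ (G j.+1 0) (is_derive_expf j t))))).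
  by rewrite add0r; apply: eq_bigr.
have [c cs e] := MVT0 s dT.
have T0 : T 0 = G 0%N 0.
  rewrite /T big_ord_recl expr0 fact0 divr1 mulr1 big1 ?addr0 // => j _.
  by rewrite expr0n mul0r mulr0.
have -> : G 0%N s - \sum_(j < m.+1) G j 0 * (s ^+ j / j`!%:R) = (G 1%N c - T' c) * s.
  by rewrite -e T0 subrr subr0.
rewrite normrM exprSr mulrA; apply: ler_wpM2r => //.
have K0 : 0 <= K by apply: le_trans (bG 0 _); rewrite ?normr0.
apply: (@le_trans _ _ (K * `|c| ^+ m)).
  apply: (IH (fun k => G k.+1)) => [d dc].
  by apply: bG; exact: le_trans cs.
by apply: ler_wpM2l => //; apply: lerXn2r; rewrite ?nnegrE.
Qed.

End OneVariable.

Section Partial.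
Variables (R : realType) (n : nat).
Local Notation E := 'rV[R]_n.
Implicit Types (f : E -> R) (x y u v : E) (i j : 'I_n) (w : seq 'I_n).

(** Real-valued counterpart of [pderivs]. The analysis is done on real and imaginary parts and
    reassembled by [smooth_RnP]. *)
Definition rderivs w f : E -> R :=
  foldr (fun i (g : E -> R) => 'D_(delta_mx 0 i) g) f w.

Definition rsmooth f := forall w x, {for x, continuous (rderivs w f)} /\
  forall i, derivable (rderivs w f) x (delta_mx 0 i).

Lemma cReal_pderivs w (f : E -> R[i]) :
  cReal (pderivs w f) = rderivs w (cReal f).
Proof. by elim: w => //= i w <-. Qed.

Lemma cImag_pderivs w (f : E -> R[i]) :
  cImag (pderivs w f) = rderivs w (cImag f).
Proof. by elim: w => //= i w <-. Qed.

Lemma smooth_RnP (f : E -> R[i]) :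
  smooth_Rn f <-> rsmooth (cReal f) /\ rsmooth (cImag f).
Proof.
split=> [sf|[s1 s2] w x].
  split=> w x; have [c1 c2 d] := sf w x.
    by rewrite -cReal_pderivs; split => // i; have [] := d i.
  by rewrite -cImag_pderivs; split => // i; have [] := d i.
rewrite cReal_pderivs cImag_pderivs.
have [? d1] := s1 w x; have [? d2] := s2 w x.
by split => // i; split.
Qed.

Lemma rderivs_cat w w' f : rderivs (w ++ w') f = rderivs w (rderivs w' f).
Proof. by rewrite /rderivs foldr_cat. Qed.

Lemma rsmooth_rderivs w f : rsmooth f -> rsmooth (rderivs w f).
Proof. by move=> sf w' x; rewrite -rderivs_cat. Qed.

Lemma is_derive_line f x v s : derivable f (x + s *: v) v ->
  is_derive s (1 : R) (fun t : R => f (x + t *: v)) ('D_v f (x + s *: v)).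
Proof.
move=> df.
have e : (fun h : R => h^-1 *: (((fun t : R => f (x + t *: v)) \o shift s) (h *: (1 : R))
            - f (x + s *: v))) =
         (fun h : R => h^-1 *: ((f \o shift (x + s *: v)) (h *: v) - f (x + s *: v))).
  apply/funext => h /=; congr (_ *: (f _ - _)).
  have -> : h *: (1 : R) = h by rewrite /GRing.scale /= mulr1.
  by rewrite scalerDl addrCA.
split.
  by rewrite /derivable e.
by rewrite /derive e.
Qed.

Lemma MVT_line f v x (s : R) : (forall y, derivable f y v) ->
  exists2 c : R, `|c| <= `|s| & f (x + s *: v) - f x = 'D_v f (x + c *: v) * s.
Proof.
move=> df.
have [c cs] := MVT0 s (fun t => is_derive_line (df (x + t *: v))).
by rewrite scale0r addr0; exists c.
Qed.

(** A step along u + v is a step along u followed by one along v from the moving base point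
    [h *: u + x]. The mean value theorem on the second leg and continuity of ['D_v f] at x give the
    limit. Coordinate directions can thus be added one at a time. *)
Lemma is_derive_addv f x u v l : is_derive x u f l ->
  (forall y, derivable f y v) -> {for x, continuous ('D_v f)} ->
  is_derive x (u + v) f (l + 'D_v f x).
Proof.
move=> [du el] dv cv.
have lim : (fun h : R => h^-1 *: ((f \o shift x) (h *: (u + v)) - f x)) @ 0^'
    --> l + 'D_v f x.
  have -> : (fun h : R => h^-1 *: ((f \o shift x) (h *: (u + v)) - f x)) =
    (fun h : R => h^-1 *: ((f \o shift x) (h *: u) - f x)
      + h^-1 * (f (h *: u + x + h *: v) - f (h *: u + x))).
    apply/funext => h.
    transitivity (h^-1 * (f (h *: (u + v) + x) - f x)) => //.
    transitivity (h^-1 * (f (h *: u + x) - f x) + h^-1 * (f (h *: u + x + h *: v) - f (h *: u + x))) => //.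
    by rewrite scalerDr -mulrDr (addrAC (h *: u)); congr (_ * _); lra.
  apply: cvgD; first by rewrite -el; exact: du.
  apply/cvgrPdist_lt => e e0.
  have /cvgrPdist_lt/(_ _ e0) := cv.
  move=> /nbhs_normP[d /= d0 dD].
  have : \forall h \near (0 : R)^', `|h| * (`|u| + `|v| + 1) < d.
    have p0 : 0 < `|u| + `|v| + 1 by rewrite ltr_wpDl // addr_ge0.
    apply: nbhs_dnbhs; apply/nbhs_normP; exists (d / (`|u| + `|v| + 1)) => /=.
      by rewrite divr_gt0.
    by move=> h /=; rewrite sub0r normrN ltr_pdivlMr.
  have nz : \forall h \near (0 : R)^', h != 0 by exact: nbhs_dnbhs_neq.
  move=> hd; near=> h.
  have h0 : h != 0 by near: h.
  have [c ch ->] := MVT_line (h *: u + x) h dv.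
  rewrite mulrCA mulVf // mulr1; apply: dD => /=.
  rewrite opprD opprD addrA addrA (addrAC x) subrr sub0r -opprD normrN.
  apply: (@le_lt_trans _ _ (`|h| * (`|u| + `|v| + 1))); last by near: h.
  apply: (le_trans (ler_normD _ _)); rewrite !normrZ !mulrDr mulr1 -[leLHS]addr0.
  by apply: lerD => //; rewrite lerD2l ler_wpM2r.
split; last exact: (cvg_lim _ lim).
by apply/cvg_ex; exists (l + 'D_v f x).
Unshelve. all: by end_near. Qed.

Lemma is_derive_scalev f x v l (c : R) :
  is_derive x v f l -> is_derive x (c *: v) f (c * l).
Proof.
move=> [dv el].
have lim : (fun h : R => h^-1 *: ((f \o shift x) (h *: (c *: v)) - f x)) @ 0^'
    --> c * l.
  have [->|c0] := eqVneq c 0.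
    rewrite mul0r (_ : (fun _ => _) = cst 0); first exact: cvg_cst.
    by apply/funext => h /=; rewrite scale0r scaler0 add0r subrr scaler0.
  have -> : (fun h : R => h^-1 *: ((f \o shift x) (h *: (c *: v)) - f x)) =
    (fun h : R => c * ((fun h : R => h^-1 *: ((f \o shift x) (h *: v) - f x)) (c * h))).
    apply/funext => h.
    transitivity (h^-1 * (f (h *: (c *: v) + x) - f x)) => //.
    transitivity (c * ((c * h)^-1 * (f ((c * h) *: v + x) - f x))) => //.
    by rewrite scalerA (mulrC h) invfM !mulrA divff // mul1r.
  apply: cvgMr; rewrite -el.
  have : (fun h : R => c * h) @ 0^' --> 0^'.
    move=> A /nbhs_normP[d /= d0 dA]; apply/nbhs_normP.
    exists (d / `|c|) => /=; first by rewrite divr_gt0 // normr_gt0.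
    move=> h /=; rewrite sub0r normrN ltr_pdivlMr ?normr_gt0 // => hd h0.
    by apply: dA; rewrite /= ?mulf_neq0 // sub0r normrN normrM mulrC.
  by move=> hc; exact: (cvg_comp _ _ hc dv).
split; last exact: (cvg_lim _ lim).
by apply/cvg_ex; exists (c * l). Qed.

Lemma rsmooth_is_derive f x v : rsmooth f ->
  is_derive x v f (\sum_i v 0 i * 'D_(delta_mx 0 i) f x).
Proof.
move=> sf; rewrite {1}(row_sum_delta v).
elim/big_rec2: _ => [|i l u _ IH].
  by split; [exact: derivable0|rewrite derive0].
have di y : derivable f y (delta_mx 0 i) by have [_] := sf [::] y; exact.
have dvi y : is_derive y (v 0 i *: delta_mx 0 i) f (v 0 i * 'D_(delta_mx 0 i) f y).
  by apply: is_derive_scalev; exact: derivableP.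
rewrite addrC [X in is_derive _ _ _ X]addrC -(@derive_val _ _ _ _ _ _ _ (dvi x)).
apply: (is_derive_addv IH) => [y|]; first by have [] := dvi y.
rewrite (_ : 'D_(v 0 i *: delta_mx 0 i) f = (fun y => v 0 i * 'D_(delta_mx 0 i) f y)).
  by have [ci _] := sf [:: i] x; exact: cvgMr ci.
by apply/funext => y; rewrite (@derive_val _ _ _ _ _ _ _ (dvi y)).
Qed.

Lemma coord_le_norm x i : `|x 0 i| <= `|x|.
Proof. by rewrite [leRHS]mx_normrE; exact: (le_bigmax _ _ (0, i)). Qed.

Lemma rsmooth_lipschitz f (K : R) : rsmooth f ->
  (forall i y, `|'D_(delta_mx 0 i) f y| <= K) ->
  forall x y, `|f y - f x| <= n%:R * K * `|y - x|.
Proof.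
move=> sf bf x y.
have dl z : derivable f z (y - x) by have [] := rsmooth_is_derive z (y - x) sf.
have [c _] := MVT_line x 1 dl.
rewrite scale1r (addrC x) subrK mulr1 => ->.
rewrite (@derive_val _ _ _ _ _ _ _ (rsmooth_is_derive _ (y - x) sf)).
apply: (le_trans (ler_norm_sum _ _ _)).
have -> : n%:R * K * `|y - x| = \sum_(i < n) `|y - x| * K.
  by rewrite sumr_const card_ord -mulr_natl; ring.
by apply: ler_sum => i _; rewrite normrM; apply: ler_pM => //; exact: coord_le_norm.
Qed.

(** Two mean value theorems: the left side is an increment along u of the difference g, whose
    derivative is in turn an increment of ['D_u f] along v. *)
Lemma second_difference f i j x (h : R) : rsmooth f ->
  exists2 y, `|x - y| <= `|h| * (`|delta_mx 0 i : E| + `|delta_mx 0 j : E|) &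
   f (x + h *: delta_mx 0 i + h *: delta_mx 0 j) - f (x + h *: delta_mx 0 i)
   - f (x + h *: delta_mx 0 j) + f x =
   h ^+ 2 * rderivs [:: j; i] f y.
Proof.
move=> sf; set u := delta_mx 0 i : E; set v := delta_mx 0 j : E.
have du y : is_derive y u f ('D_u f y).
  by apply: derivableP; have [_] := sf [::] y; exact.
pose g t := f (x + h *: v + t *: u) - f (x + t *: u).
have dg t : is_derive t (1 : R) g ('D_u f (x + h *: v + t *: u) - 'D_u f (x + t *: u)).
  by apply: is_deriveB; apply: is_derive_line; have [] := du (x + t *: u); have [] := du (x + h *: v + t *: u).
have [c ch eg] := MVT0 h dg.
have dv y : derivable ('D_u f) y v by have [_] := sf [:: i] y; exact.
have [d dh ed] := MVT_line (x + c *: u) h dv.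
exists (x + c *: u + d *: v).
  rewrite opprD opprD addrA addrA subrr sub0r -opprD normrN.
  apply: (le_trans (ler_normD _ _)); rewrite !normrZ mulrDr.
  by apply: lerD; apply: ler_wpM2r.
move: eg; rewrite /g !scale0r !addr0 (addrAC x (h *: v)) (addrAC x (h *: v)) ed => eg.
rewrite -[rderivs _ _ _]/('D_v ('D_u f) _).
transitivity (('D_v ('D_u f) (x + c *: u + d *: v) * h) * h); last by ring.
by rewrite -eg; lra.
Qed.

Lemma second_difference_sym f i j x (h : R) : rsmooth f -> h != 0 ->
  let S := `|h| * (`|delta_mx 0 i : E| + `|delta_mx 0 j : E|) in
  exists y1 y2, [/\ `|x - y1| <= S, `|x - y2| <= S &
    rderivs [:: j; i] f y1 = rderivs [:: i; j] f y2].
Proof.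
move=> sf h0 S; have [y1 y1h e1] := second_difference i j x h sf.
have [y2 y2h e2] := second_difference j i x h sf.
rewrite [X in _ <= _ * X]addrC in y2h.
exists y1, y2; split; [exact: y1h|exact: y2h|].
apply: (@mulfI _ (h ^+ 2)); first by rewrite expf_neq0.
have swap (a b c d : R) : a - b - c + d = a - c - b + d by ring.
refine (etrans (esym e1) (etrans (etrans (swap _ _ _ _) _) e2)).
by rewrite (addrAC x (h *: delta_mx 0 i)).
Qed.

(** The second difference is symmetric in i and j, so the two mixed derivatives take a common value
    at points within O(h) of x; both are continuous at x. *)
Lemma clairaut f i j : rsmooth f -> rderivs [:: i; j] f = rderivs [:: j; i] f.
Proof.
move=> sf; apply/funext => x; apply/eqP; rewrite -subr_eq0 -normr_le0.
apply/ler_addgt0Pr => e e0; rewrite add0r.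
have e20 : 0 < e / 2 by rewrite divr_gt0.
have /cvgrPdist_lt/(_ _ e20) := (sf [:: i; j] x).1.
have /cvgrPdist_lt/(_ _ e20) := (sf [:: j; i] x).1.
move=> /nbhs_normP[d1 /= d10 D1] /nbhs_normP[d2 /= d20 D2].
pose d := Num.min d1 d2.
have d0 : 0 < d by rewrite /d lt_min d10 d20.
set S := `|delta_mx 0 i : E| + `|delta_mx 0 j : E|.
have S1 : 0 < S + 1 by rewrite ltr_wpDl // addr_ge0.
(* Any h > 0 with h S < d would do; S + 1 keeps the denominator positive. *)
pose h := d / (S + 1) / 2.
have h0 : 0 < h by rewrite !divr_gt0.
have hS : `|h| * S < d.
  rewrite gtr0_norm // /h; apply: (@le_lt_trans _ _ (2^-1 * d)).
    rewrite (_ : _ * S = 2^-1 * d * (S / (S + 1))); last by field; rewrite gt_eqF.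
    rewrite ler_piMr // ?mulr_ge0 ?invr_ge0 // ?ltW //.
    by rewrite ltr_pdivrMr // mul1r ltrDl.
  by rewrite mulrC ltr_pdivrMr // ltr_pMr // ltr1n.
have [|y1 [y2 [y1h y2h e12]]] := @second_difference_sym f i j x h sf.
  by rewrite gt_eqF.
have hS1 : `|h| * S < d1 by apply: lt_le_trans hS _; rewrite /d ge_min lexx.
have hS2 : `|h| * S < d2 by apply: lt_le_trans hS _; rewrite /d ge_min lexx orbT.
have a1 := D1 y1 (le_lt_trans y1h hS1).
have a2 := D2 y2 (le_lt_trans y2h hS2).
rewrite /= -[X in `|_ - X|]/(rderivs [:: i; j] f y2) -e12 in a2.
apply: ltW; rewrite [e]splitr.
set A := rderivs [:: i; j] f x; set B := rderivs [:: j; i] f x.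
set C := rderivs [:: j; i] f y1.
have -> : A - B = (A - C) - (B - C) by ring.
exact: (le_lt_trans (ler_normB _ _) (ltrD a2 a1)).
Qed.

Lemma rderivs_perm w w' f : rsmooth f -> perm_eq w w' ->
  rderivs w f = rderivs w' f.
Proof.
move=> sf.
have swap i w1 w2 : rderivs (w1 ++ i :: w2) f = rderivs (i :: w1 ++ w2) f.
  elim: w1 => //= j w1; rewrite -/(rderivs _ f) => ->.
  rewrite -[LHS]/(rderivs [:: j; i] (rderivs (w1 ++ w2) f)).
  by rewrite (clairaut _ _ (rsmooth_rderivs _ sf)).
elim: w w' => [|i w IH] w'; first by rewrite perm_sym => /perm_nilP ->.
move=> p; have iw' : i \in w' by rewrite -(perm_mem p) mem_head.
case/splitPr: iw' p => p1 p2 p; rewrite swap /= -/(rderivs _ f).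
rewrite (IH (p1 ++ p2)) //.
by move: p; rewrite -(cat1s i p2) perm_sym perm_catCA /= perm_cons perm_sym.
Qed.

(** The word along which [mderiv] differentiates. Estimates run over arbitrary words, which behave
    well under concatenation; symmetry of derivatives and [perm_mword] bring them back to
    multi-indices. *)
Definition mword (be : {ffun 'I_n -> nat}) : seq 'I_n :=
  flatten [seq nseq (be i) i | i <- enum 'I_n].

Lemma perm_mword w : perm_eq (mword [ffun i => count_mem i w]) w.
Proof.
apply/permP => a; rewrite count_flatten -map_comp sumnE big_map big_enum /=.
elim: w => [|j w IH] /=.
  by rewrite big1 // => i _; rewrite ffunE count_nseq muln0.
rewrite -IH (bigD1 j) //= [in RHS](bigD1 j) //= addnA !count_nseq !ffunE /= eqxx.
rewrite mulnDr muln1; congr (_ + _)%N; apply: eq_bigr => i ij.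
by rewrite !count_nseq !ffunE /= eq_sym (negbTE ij).
Qed.

End Partial.

(** * Weighted norms on the Schwartz space *)

Section Weighted.
Variables (R : realType) (n : nat).
Local Notation E := 'rV[R]_n.
Implicit Types (f g : E -> R) (x y : E) (i : 'I_n) (w : seq 'I_n) (v : schwartz R n).

(** Submultiplicative under addition ([omegaD]), so a weight can be moved from x to a translate of x
    at the price of a factor depending on the shift alone. *)
Definition omega x : R := 1 + `|x|.

Lemma omega_ge1 x : 1 <= omega x. Proof. by rewrite lerDl. Qed.
Lemma omega_ge0 x : 0 <= omega x. Proof. by rewrite (le_trans _ (omega_ge1 x)). Qed.
Lemma omega_gt0 x : 0 < omega x. Proof. exact: lt_le_trans (omega_ge1 x). Qed.
Hint Resolve omega_ge0 omega_gt0 omega_ge1 : core.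

Lemma omegaD x y : omega (x + y) <= omega x * omega y.
Proof.
rewrite /omega mulrDl mul1r mulrDr mulr1 -addrA lerD2l.
apply: (le_trans (ler_normD _ _)); rewrite addrCA lerD2l lerDl.
by rewrite mulr_ge0.
Qed.

(** Weight and order have separate indices: differentiating lowers the order m that remains and
    keeps the weight k. *)
Definition rsb (k m : nat) (N : R) f :=
  forall w x, (size w <= m)%N -> omega x ^+ k * `|rderivs w f x| <= N.

Definition rschwartz f := rsmooth f /\ forall m, exists N, rsb m m N f.

Lemma omegaX_le k m x : (k <= m)%N -> omega x ^+ k <= omega x ^+ m.
Proof. by move=> km; apply: ler_weXn2l. Qed.

Lemma rsb_le k m k' m' N N' f : (k' <= k)%N -> (m' <= m)%N -> N <= N' ->
  rsb k m N f -> rsb k' m' N' f.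
Proof.
move=> kk mm NN b w x wm; apply: le_trans NN; apply: le_trans (b w x (leq_trans wm mm)).
by apply: ler_wpM2r => //; exact: omegaX_le.
Qed.

Lemma rsb_abs k m N f w x : rsb k m N f -> (size w <= m)%N -> `|rderivs w f x| <= N.
Proof.
move=> b wm; apply: le_trans (b w x wm); rewrite ler_peMl //.
exact: exprn_ege1.
Qed.

Lemma norm_xmonom (al : {ffun 'I_n -> nat}) x :
  `|xmonom al x| <= omega x ^+ (\sum_i al i).
Proof.
rewrite /xmonom normr_prod.
rewrite (big_morph _ (exprD (omega x)) (expr0 _)).
apply: ler_prod => i _; rewrite normr_ge0 normrX /=.
apply: lerXn2r; rewrite ?nnegrE //.
by apply: le_trans (coord_le_norm x i) _; rewrite lerDr.
Qed.

Definition mono1 (m : nat) i : {ffun 'I_n -> nat} := [ffun j => if j == i then m else 0%N].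

Lemma xmonom_mono1 m i x : xmonom (mono1 m i) x = x 0 i ^+ m.
Proof.
rewrite /xmonom (bigD1 i) //= ffunE eqxx big1 ?mulr1 // => j ji.
by rewrite ffunE (negbTE ji).
Qed.

Lemma xmonom0 x : xmonom [ffun=> 0%N] x = 1.
Proof. by rewrite /xmonom big1 // => i _; rewrite ffunE. Qed.

(** For the maximum norm some coordinate has |x_i| = |x|. If |x| > 1 then [omega x] is at most 2
    |x_i|, otherwise it is at most 2. Hence the monomials 1 and x_i^m control the weight. *)
Lemma omegaX_monom m x :
  omega x ^+ m <= 2 ^+ m * (1 + \sum_i `|x 0 i| ^+ m).
Proof.
have [x1|x1] := leP `|x| 1.
  apply: (@le_trans _ _ (2 ^+ m)).
    by apply: lerXn2r; rewrite ?nnegrE // /omega -[leRHS]/(1 + 1) lerD2l.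
  by rewrite ler_peMr // lerDl sumr_ge0.
have [[i0 i] /= xi] : exists i : 'I_1 * 'I_n, `|x| = `|x i.1 i.2|.
  apply: mx_norm_neq0; rewrite -[mx_norm x]/(`|x|) gt_eqF //.
  exact: lt_trans x1.
rewrite ord1 in xi.
apply: (@le_trans _ _ ((2 * `|x|) ^+ m)).
  apply: lerXn2r; rewrite ?nnegrE ?mulr_ge0 // /omega mulr_natl mulr2n lerD2r.
  exact: ltW.
rewrite exprMn ler_wpM2l // xi (bigD1 i) //= addrCA lerDl.
by rewrite addr_ge0 // sumr_ge0.
Qed.

Lemma normc_le (a b : R) : normc (a +i* b)%C <= `|a| + `|b|.
Proof.
rewrite /= -(@ler_sqr _ _ (`|a| + `|b|)) ?nnegrE ?sqrtr_ge0 ?addr_ge0 //.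
rewrite sqr_sqrtr ?addr_ge0 ?sqr_ge0 // sqrrD !real_normK ?num_real //.
by rewrite -addrA lerD2l lerDr mulrn_wge0 // mulr_ge0.
Qed.

Lemma normRe_le (z : R[i]) : `|complex.Re z| <= normc z.
Proof.
case: z => a b /=; rewrite -(sqrtr_sqr a).
by rewrite ler_wsqrtr // lerDl sqr_ge0.
Qed.

Lemma normIm_le (z : R[i]) : `|complex.Im z| <= normc z.
Proof.
case: z => a b /=; rewrite -(sqrtr_sqr b).
by rewrite ler_wsqrtr // lerDr sqr_ge0.
Qed.

Lemma normc_real (r : R) : normc r%:C%C = `|r|.
Proof. by rewrite /= expr0n /= addr0 sqrtr_sqr. Qed.

Lemma pderivsE w (f : E -> R[i]) x :
  pderivs w f x = (rderivs w (cReal f) x +i* rderivs w (cImag f) x)%C.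
Proof.
rewrite -cReal_pderivs -cImag_pderivs /cReal /cImag.
by case: (pderivs w f x).
Qed.

Lemma schwartz_smooth v : smooth_Rn v.
Proof. by have /schwartz_predP[] := schwartz_funP v. Qed.

Lemma pderivs_perm w w' (f : E -> R[i]) : smooth_Rn f -> perm_eq w w' ->
  pderivs w f = pderivs w' f.
Proof.
move=> /smooth_RnP[s1 s2] p; apply/funext => x.
by rewrite !pderivsE !(rderivs_perm _ p).
Qed.

Definition snorm_set m v : set R := [set r | exists w x,
  (size w <= m)%N /\ r = omega x ^+ m * normc (pderivs w v x)].

(** An increasing sequence of norms, with one index for both weight and order, that has the same
    convergent filters as the seminorms ([schwartz_cvg_snormP]). Operator estimates are stated with
    it. *)
Definition snorm m v : R := sup (snorm_set m v).

(** An explicit finite combination of seminorms. It makes the supremum in [snorm] finite, and the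
    same combination is formed later with seminorms of the solution space. *)
Definition snorm_dom m v : R := 2 ^+ m *
  \sum_(k < m.+1) \sum_(w : k.-tuple 'I_n)
    (schwartz_seminorm [ffun=> 0%N] [ffun i => count_mem i w] v +
     \sum_i schwartz_seminorm (mono1 m i) [ffun i => count_mem i w] v).

Lemma snorm_dom_ge m v w x : (size w <= m)%N ->
  omega x ^+ m * normc (pderivs w v x) <= snorm_dom m v.
Proof.
move=> wm; set be := [ffun i => count_mem i w].
have -> : pderivs w v x = mderiv be v x.
  by rewrite /mderiv (pderivs_perm (schwartz_smooth v) (perm_mword w)).
have vE al : `|xmonom al x| * normc (mderiv be v x) <= schwartz_seminorm al be v.
  apply: le_trans (schwartz_val_le_seminorm al be v x).
  by rewrite /schwartz_val normcM normc_real.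
apply: (le_trans (ler_wpM2r (normc_ge0 _) (omegaX_monom m x))).
rewrite -mulrA /snorm_dom ler_wpM2l //.
have P0 (k : 'I_m.+1) (t : k.-tuple 'I_n) : 0 <=
  schwartz_seminorm [ffun=> 0%N] [ffun i => count_mem i t] v +
     \sum_i schwartz_seminorm (mono1 m i) [ffun i => count_mem i t] v.
  by rewrite addr_ge0 ?sumr_ge0 // => *; exact: schwartz_seminorm_ge0.
have wm' : (size w < m.+1)%N by [].
rewrite (bigD1 (Ordinal wm')) //= (bigD1 (in_tuple w)) //=.
rewrite -addrA -[leLHS]addr0; apply: lerD; last first.
  apply: addr_ge0; apply: sumr_ge0 => k _; first exact: (P0 (Ordinal wm')).
  by apply: sumr_ge0 => t _; exact: P0.
rewrite mulrDl mul1r mulr_suml; apply: lerD.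
  by have := vE [ffun=> 0%N]; rewrite xmonom0 normr1 mul1r.
by apply: ler_sum => i _; have := vE (mono1 m i); rewrite xmonom_mono1 normrX.
Qed.

Lemma snorm_ge m v w x : (size w <= m)%N ->
  omega x ^+ m * normc (pderivs w v x) <= snorm m v.
Proof.
move=> wm; apply: ub_le_sup; last by exists w, x.
by exists (snorm_dom m v) => _ [w' [y [wm' ->]]]; exact: snorm_dom_ge.
Qed.

Lemma snorm_le m v C : (forall w x, (size w <= m)%N ->
  omega x ^+ m * normc (pderivs w v x) <= C) -> snorm m v <= C.
Proof.
move=> h; apply: ge_sup; last by move=> _ [w [x [wm ->]]]; exact: h.
by exists (omega 0 ^+ m * normc (pderivs [::] v 0)), [::], 0.
Qed.

Lemma snorm_ge0 m v : 0 <= snorm m v.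
Proof.
apply: le_trans (@snorm_ge m v [::] 0 isT).
by rewrite mulr_ge0 ?exprn_ge0 //; exact: normc_ge0.
Qed.

Lemma snorm_le_dom m v : snorm m v <= snorm_dom m v.
Proof. by apply: snorm_le => w x; exact: snorm_dom_ge. Qed.

Lemma snorm_lin m (c : R[i]) (u v : schwartz R n) :
  snorm m (c *: u + v) <= normc c * snorm m u + snorm m v.
Proof.
apply: snorm_le => w x wm.
rewrite -[schwartz_fun (c *: u + v)]/(c *: (u : E -> R[i]) + v).
rewrite pderivs_lin; [|exact: schwartz_smooth..].
apply: (@le_trans _ _ (omega x ^+ m *
  (normc c * normc (pderivs w u x) + normc (pderivs w v x)))).
  apply: ler_wpM2l; first exact: exprn_ge0.
  rewrite -normcM; exact: le_normcD.
rewrite mulrDr mulrCA; apply: lerD; last exact: snorm_ge.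
by apply: ler_wpM2l; [exact: normc_ge0|exact: snorm_ge].
Qed.

Lemma snorm0 m : snorm m 0 = 0.
Proof.
apply/eqP; rewrite eq_le snorm_ge0 andbT; apply: snorm_le => w x _.
by rewrite -[schwartz_fun 0]/(0 : E -> R[i]) pderivs0 normc0 mulr0.
Qed.

Lemma snormD m u v : snorm m (u + v) <= snorm m u + snorm m v.
Proof. by have := snorm_lin m (1 : R[i]) u v; rewrite scale1r normc1 mul1r. Qed.

Lemma snormZ m (c : R[i]) v : snorm m (c *: v) <= normc c * snorm m v.
Proof. by have := snorm_lin m c v 0; rewrite !addr0 snorm0 addr0. Qed.

Lemma snormZr m (r : R) v : snorm m (r%:C%C *: v) <= `|r| * snorm m v.
Proof. by rewrite -normc_real; exact: snormZ. Qed.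

Lemma snormN m v : snorm m (- v) = snorm m v.
Proof.
have le u : snorm m (- u) <= snorm m u.
  by have := snormZ m (-1) u; rewrite scaleN1r normcN normc1 mul1r.
by apply/eqP; rewrite eq_le le -{1}(opprK v) le.
Qed.

Lemma snormB m u v : snorm m (u - v) <= snorm m u + snorm m v.
Proof. by rewrite -(snormN m v); exact: snormD. Qed.

Lemma snorm_distC m u v : snorm m (u - v) = snorm m (v - u).
Proof. by rewrite -snormN opprB. Qed.

Lemma snorm_sum m (I : Type) (r : seq I) (P : pred I) (F : I -> schwartz R n) :
  snorm m (\sum_(i <- r | P i) F i) <= \sum_(i <- r | P i) snorm m (F i).
Proof.
elim/big_ind2: _ => [|a b c d ab cd|//]; first by rewrite snorm0.
exact: le_trans (snormD _ _ _) (lerD ab cd).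
Qed.

Lemma snorm_mono m m' v : (m <= m')%N -> snorm m v <= snorm m' v.
Proof.
move=> mm; apply: snorm_le => w x wm.
apply: le_trans (snorm_ge v x (leq_trans wm mm)).
by apply: ler_wpM2r; [exact: normc_ge0|exact: omegaX_le].
Qed.

Lemma seminorm_le_snorm (al be : {ffun 'I_n -> nat}) m v : (\sum_i al i <= m)%N ->
  (size (mword be) <= m)%N -> schwartz_seminorm al be v <= snorm m v.
Proof.
move=> am bm; apply: ge_sup; first by exists (schwartz_val al be v 0), 0.
move=> _ [x _ <-]; rewrite /schwartz_val normcM normc_real.
apply: le_trans (snorm_ge v x bm); apply: ler_wpM2r; first exact: normc_ge0.
exact: le_trans (norm_xmonom al x) (omegaX_le _ am).
Qed.

Lemma snorm_eq0 v : snorm 0 v <= 0 -> v = 0.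
Proof.
move=> v0; apply/val_inj/funext => x /=; apply: eq0_normc; apply/eqP.
rewrite eq_le normc_ge0 andbT; apply: le_trans v0.
by have := @snorm_ge 0 v [::] x isT; rewrite expr0 mul1r.
Qed.

Lemma schwartz_cvg_snormP (F : set_system (schwartz R n)) v : Filter F ->
  (F --> v) <-> forall m (e : R), 0 < e -> \forall w \near F, snorm m (w - v) < e.
Proof.
move=> FF; split => [/schwartz_cvgP Fv m e e0|Fv]; last first.
  apply/schwartz_cvgP => al be e e0.
  pose m := maxn (\sum_i al i) (size (mword be)).
  apply: filterS (Fv m e e0) => w; apply: le_lt_trans.
  by apply: seminorm_le_snorm; rewrite /m ?leq_maxl // leq_maxr.
pose c : R := 2 ^+ m * \sum_(k < m.+1) \sum_(w : k.-tuple 'I_n) (1 + n%:R).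
have c0 : 0 <= c.
  by rewrite mulr_ge0 // sumr_ge0 // => k _; rewrite sumr_ge0 // => t _; rewrite addr_ge0.
pose d := e / (c + 1).
have c1 : 0 < c + 1 by rewrite ltr_wpDl.
have d0 : 0 < d by rewrite divr_gt0.
have near1 (k : 'I_m.+1) (t : k.-tuple 'I_n) : \forall w \near F,
    schwartz_seminorm [ffun=> 0%N] [ffun i => count_mem i t] (w - v) < d /\
    forall i, schwartz_seminorm (mono1 m i) [ffun i => count_mem i t] (w - v) < d.
  apply: filterI; first exact: Fv.
  by apply: filter_forall => i; exact: Fv.
have near2 : \forall w \near F, forall (k : 'I_m.+1) (t : k.-tuple 'I_n),
    schwartz_seminorm [ffun=> 0%N] [ffun i => count_mem i t] (w - v) < d /\
    forall i, schwartz_seminorm (mono1 m i) [ffun i => count_mem i t] (w - v) < d.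
  by apply: filter_forall => k; apply: filter_forall => t; exact: near1.
apply: filterS near2 => w hw; apply: (le_lt_trans (snorm_le_dom _ _)).
apply: (@le_lt_trans _ _ (c * d)).
  rewrite /snorm_dom /c -mulrA ler_wpM2l // mulr_suml; apply: ler_sum => k _.
  rewrite mulr_suml; apply: ler_sum => t _; have [h1 h2] := hw k t.
  rewrite mulrDl mul1r; apply: lerD; first exact: ltW.
  rewrite -[n in n%:R]card_ord -sumr_const mulr_suml mul1r; apply: ler_sum => i _.
  exact/ltW/h2.
rewrite /d mulrA ltr_pdivrMr // mulrC ltr_pM2l //.
by rewrite ltrDl.
Qed.

Lemma rsb_cReal m v : rsb m m (snorm m v) (cReal v).
Proof.
move=> w x wm; apply: le_trans (snorm_ge v x wm).
rewrite pderivsE; apply: ler_wpM2l; first exact: exprn_ge0.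
exact: (normRe_le (_ +i* _)%C).
Qed.

Lemma rsb_cImag m v : rsb m m (snorm m v) (cImag v).
Proof.
move=> w x wm; apply: le_trans (snorm_ge v x wm).
rewrite pderivsE; apply: ler_wpM2l; first exact: exprn_ge0.
exact: (normIm_le (_ +i* _)%C).
Qed.

Lemma rschwartz_cReal v : rschwartz (cReal v).
Proof.
have /smooth_RnP[s _] := schwartz_smooth v; split => // m.
by exists (snorm m v); exact: rsb_cReal.
Qed.

Lemma rschwartz_cImag v : rschwartz (cImag v).
Proof.
have /smooth_RnP[_ s] := schwartz_smooth v; split => // m.
by exists (snorm m v); exact: rsb_cImag.
Qed.

Lemma snorm_le_rsb m v N N' : rsb m m N (cReal v) -> rsb m m N' (cImag v) ->
  snorm m v <= N + N'.
Proof.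
move=> b1 b2; apply: snorm_le => w x wm; rewrite pderivsE.
apply: (@le_trans _ _ (omega x ^+ m * (`|rderivs w (cReal v) x| + `|rderivs w (cImag v) x|))).
  by apply: ler_wpM2l; [exact: exprn_ge0|exact: normc_le].
by rewrite mulrDr; apply: lerD; [exact: b1|exact: b2].
Qed.

Lemma is_schwartz_pair f g : rschwartz f -> rschwartz g ->
  (fun x => f x +i* g x)%C \in @schwartz_pred R n.
Proof.
move=> [sf bf] [sg bg]; apply/schwartz_predP; split; first exact/smooth_RnP.
move=> al be; pose m := maxn (\sum_i al i) (size (mword be)).
have [N fN] := bf m; have [N' gN] := bg m; exists (N + N') => x.
have bm : (size (mword be) <= m)%N by rewrite /m leq_maxr.
rewrite /schwartz_val normcM normc_real /mderiv pderivsE.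
apply: (@le_trans _ _ (omega x ^+ m * (`|rderivs (mword be) f x| + `|rderivs (mword be) g x|))).
  apply: ler_pM => //; [exact: normc_ge0| |exact: normc_le].
  by apply: le_trans (norm_xmonom al x) (omegaX_le _ _); rewrite /m leq_maxl.
by rewrite mulrDr; apply: lerD; [exact: fN|exact: gN].
Qed.

Definition schwartz_pair f g (hf : rschwartz f) (hg : rschwartz g) : schwartz R n :=
  Schwartz (is_schwartz_pair hf hg).

Lemma schwartz_eqP (u v : schwartz R n) : (forall x, cReal u x = cReal v x) ->
  (forall x, cImag u x = cImag v x) -> u = v.
Proof.
move=> er ei; apply/val_inj/funext => x /=.
move: (er x) (ei x); rewrite /cReal /cImag.
by case: (schwartz_fun u x) (schwartz_fun v x) => ? ? [? ?] /= -> ->.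
Qed.

End Weighted.

(** * Averages of families of Schwartz functions *)

Section RintegralExtra.
Context d (T : measurableType d) (R : realType) (mu : {measure set T -> \bar R}).
Variables (D : set T) (mD : measurable D).
Implicit Types f g h : T -> R.

Lemma integrable_subr f g : mu.-integrable D (EFin \o f) ->
  mu.-integrable D (EFin \o g) -> mu.-integrable D (EFin \o (fun z => f z - g z)).
Proof. by move=> If Ig; have := integrableB mD If Ig. Qed.

Lemma integrable_addr f g : mu.-integrable D (EFin \o f) ->
  mu.-integrable D (EFin \o g) -> mu.-integrable D (EFin \o (fun z => f z + g z)).
Proof. by move=> If Ig; have := integrableD mD If Ig. Qed.

Lemma integrable_mulrl (k : R) f : mu.-integrable D (EFin \o f) ->
  mu.-integrable D (EFin \o (fun z => k * f z)).
Proof. by move=> If; have := integrableZl mD k If. Qed.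

Lemma Rintegral_dist_le f g h :
  mu.-integrable D (EFin \o f) -> mu.-integrable D (EFin \o g) ->
  mu.-integrable D (EFin \o h) -> (forall z, D z -> `|f z - g z| <= h z) ->
  `|\int[mu]_(z in D) f z - \int[mu]_(z in D) g z| <= \int[mu]_(z in D) h z.
Proof.
move=> If Ig Ih fgh; rewrite -RintegralB //.
have Ifg : mu.-integrable D (EFin \o (fun z => f z - g z)) by exact: integrable_subr.
apply: (le_trans (le_normr_Rintegral mD Ifg)).
apply: le_Rintegral => //; exact: (integrable_abse Ifg).
Qed.

Lemma integrable_dominated f h : measurable_fun D f ->
  mu.-integrable D (EFin \o h) -> (forall z, D z -> `|f z| <= h z) ->
  mu.-integrable D (EFin \o f).
Proof.
move=> mf Ih fh; apply: (le_integrable mD _ _ Ih).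
  exact/measurable_EFinP.
by move=> z Dz /=; rewrite lee_fin; apply: le_trans (fh z Dz) (ler_norm _).
Qed.

End RintegralExtra.

Section LineTaylor.
Variables (R : realType) (n : nat).
Local Notation E := 'rV[R]_n.

Lemma partial_taylor2 (f : E -> R) (i : 'I_n) (x : E) (h K : R) : rsmooth f ->
  (forall y, `|rderivs [:: i; i] f y| <= K) ->
  `|f (h *: delta_mx 0 i + x) - f x - h * 'D_(delta_mx 0 i) f x| <= K * `|h| ^+ 2.
Proof.
move=> sf bK.
pose G k (s : R) := rderivs (nseq k i) f (x + s *: delta_mx 0 i).
have dG k (t : R) : is_derive t (1 : R) (G k) (G k.+1 t).
  by apply: is_derive_line; have [_] := sf (nseq k i) (x + t *: delta_mx 0 i); exact.
have := @taylor_bound R 2 G K h dG (fun c _ => bK _).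
rewrite !big_ord_recl big_ord0 /= /bump /= addr0 expr0 expr1 !divr1 mulr1 /G /= scale0r.
by rewrite addr0 opprD addrA (addrC x) (mulrC h).
Qed.

Lemma lipschitz_continuous_at (F : E -> R) (x : E) (K : R) :
  (forall y, `|F y - F x| <= K * `|y - x|) -> {for x, continuous F}.
Proof.
move=> FK; have K1 : 0 < `|K| + 1 by rewrite ltr_wpDl.
apply/(@cvgrPdist_lt _ _ _ (nbhs x)) => e e0.
have nb : nbhs x (fun y => `|x - y| < e / (`|K| + 1)).
  have e1 : 0 < e / (`|K| + 1) by rewrite divr_gt0.
  exact: (@cvgr_dist_lt _ _ _ (nbhs x) _ id x (@cvg_id _ _) _ e1).
apply: filterS nb => y xy; rewrite distrC; apply: (le_lt_trans (FK y)).
apply: (@le_lt_trans _ _ ((`|K| + 1) * `|y - x|)).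
  by apply: ler_wpM2r => //; apply: (le_trans (ler_norm K)); rewrite lerDl.
by rewrite mulrC -ltr_pdivlMr // distrC.
Qed.

End LineTaylor.

(** * Differentiation under the integral sign *)

Section Averaging.
Context d (T : measurableType d) (R : realType) (mu : {measure set T -> \bar R}).
Variables (n : nat) (D : set T) (F : T -> 'rV[R]_n -> R) (g : nat -> T -> R).
Hypotheses (mD : measurable D) (sF : forall z, D z -> rsmooth (F z))
  (mF : forall w x, measurable_fun D (fun z => rderivs w (F z) x))
  (bF : forall m z, D z -> rsb m m (g m z) (F z))
  (ig : forall m, mu.-integrable D (EFin \o g m)).
Local Notation E := 'rV[R]_n.
Implicit Types (x : E) (w : seq 'I_n).

Definition average x := \int[mu]_(z in D) F z x.

Lemma integrable_rderivs w x :
  mu.-integrable D (EFin \o (fun z => rderivs w (F z) x)).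
Proof.
apply: (integrable_dominated mD (mF w x) (ig (size w))) => z Dz.
exact: rsb_abs (bF (m := size w) Dz) (leqnn _).
Qed.

(* Kept in the context for the integrability side conditions closed by //. *)
Let iD w x := integrable_rderivs w x.

(** Integrating the second-order Taylor bound of every member gives an increment error K h^2, where
    K is the integral of the dominating function two orders higher. The derivative can be read off
    from it. *)
Lemma is_derive_average w i x :
  is_derive x (delta_mx 0 i) (fun y : E => \int[mu]_(z in D) rderivs w (F z) y)
    (\int[mu]_(z in D) rderivs (i :: w) (F z) x).
Proof.
set J := \int[mu]_(z in D) _; pose I y := \int[mu]_(z in D) rderivs w (F z) y.
pose K := \int[mu]_(z in D) g (size w).+2 z.
have bnd (h : R) : `|I (h *: delta_mx 0 i + x) - I x - h * J| <= K * `|h| ^+ 2.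
  rewrite /I -RintegralB // -RintegralZl //.
  rewrite (mulrC K) -RintegralZl //.
  apply: Rintegral_dist_le => //; first exact: integrable_subr.
  - exact: integrable_mulrl.
  - exact: integrable_mulrl.
  - move=> z Dz; rewrite (mulrC (_ ^+ 2)).
    apply: (partial_taylor2 x h (rsmooth_rderivs w (sF Dz))) => y.
    by rewrite -rderivs_cat; exact: rsb_abs (bF (m := (size w).+2) Dz) _.
have lim : (fun h : R => h^-1 *: ((I \o shift x) (h *: delta_mx 0 i) - I x)) @ 0^' --> J.
  apply/cvgrPdist_lt => e e0.
  have K1 : 0 < `|K| + 1 by rewrite ltr_wpDl.
  have : \forall h \near (0 : R)^', `|h| < e / (`|K| + 1).
    apply: nbhs_dnbhs; apply/nbhs_normP; exists (e / (`|K| + 1)) => /=.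
      by rewrite divr_gt0.
    by move=> h /=; rewrite sub0r normrN.
  have nz : \forall h \near (0 : R)^', h != 0 by exact: nbhs_dnbhs_neq.
  move=> hd; near=> h.
  have h0 : h != 0 by near: h.
  have he : `|h| < e / (`|K| + 1) by near: h.
  have -> : J - h^-1 *: ((I \o shift x) (h *: delta_mx 0 i) - I x) =
     - (h^-1 * (I (h *: delta_mx 0 i + x) - I x - h * J)).
    rewrite mulrBr mulrA mulVf // mul1r opprB; congr (_ - _).
  rewrite normrN normrM normfV.
  have hp : 0 < `|h| by rewrite normr_gt0.
  rewrite mulrC ltr_pdivrMr //; apply: (le_lt_trans (bnd h)).
  rewrite expr2 mulrA ltr_pM2r //.
  apply: (@le_lt_trans _ _ ((`|K| + 1) * `|h|)).
    by apply: ler_wpM2r => //; apply: (le_trans (ler_norm K)); rewrite lerDl.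
  by rewrite mulrC -ltr_pdivlMr.
split; last exact: (cvg_lim _ lim).
by apply/cvg_ex; exists J.
Unshelve. all: by end_near. Qed.

Lemma rderivs_average w :
  rderivs w average = fun x => \int[mu]_(z in D) rderivs w (F z) x.
Proof.
elim: w => [//|i w IH]; apply/funext => x.
rewrite [LHS]/= -/(rderivs w average) IH.
exact: (@derive_val _ _ _ _ _ _ _ (is_derive_average w i x)).
Qed.

(** Continuity of each derivative comes from a Lipschitz bound, the integral of those of the
    members. *)
Lemma rsmooth_average : rsmooth average.
Proof.
move=> w x; rewrite rderivs_average; split; last first.
  by move=> i; have [] := is_derive_average w i x.
pose K := \int[mu]_(z in D) (n%:R * g (size w).+1 z).
apply: (@lipschitz_continuous_at _ _ _ _ K) => y.
rewrite /K (mulrC (Rintegral _ _ _)) -RintegralZl //; last exact: integrable_mulrl.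
apply: Rintegral_dist_le => //.
  by apply: integrable_mulrl => //; exact: integrable_mulrl.
move=> z Dz; rewrite mulrC.
apply: rsmooth_lipschitz; first exact: rsmooth_rderivs (sF Dz).
move=> i u; exact: (rsb_abs (w := i :: w) u (bF (m := (size w).+1) Dz) (leqnn _)).
Qed.

Lemma rsb_average m : rsb m m (\int[mu]_(z in D) g m z) average.
Proof.
move=> w x wm; rewrite rderivs_average.
have o0 : 0 <= omega x ^+ m by exact/exprn_ge0/omega_ge0.
rewrite -[X in X * _](ger0_norm o0) -normrM -RintegralZl //.
have I1 : mu.-integrable D (EFin \o (fun z => omega x ^+ m * rderivs w (F z) x)).
  exact: integrable_mulrl.
apply: (le_trans (le_normr_Rintegral mD I1)).
apply: le_Rintegral => //; first exact: (integrable_abse I1).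
by move=> z Dz; rewrite normrM (ger0_norm o0); exact: bF.
Qed.

Lemma rschwartz_average : rschwartz average.
Proof. by split; [exact: rsmooth_average|move=> m; eexists; exact: rsb_average]. Qed.

End Averaging.

(** * Partial derivatives as operators on Schwartz functions *)

Section Partials.
Variables (R : realType) (n : nat).
Local Notation E := 'rV[R]_n.
Implicit Types (f : E -> R) (v : schwartz R n) (i : 'I_n).

Lemma rsb_rderivs k m N f w : rsb k (m + size w) N f -> rsb k m N (rderivs w f).
Proof.
by move=> b w' x wm; rewrite -rderivs_cat; apply: b; rewrite size_cat leq_add2r.
Qed.

Lemma rschwartz_rderivs w f : rschwartz f -> rschwartz (rderivs w f).
Proof.
move=> [sf bf]; split; first exact: rsmooth_rderivs.
move=> m; have [N b] := bf (m + size w)%N; exists N; apply: rsb_rderivs.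
by apply: rsb_le b; rewrite ?leq_addr.
Qed.

Definition spartial w v : schwartz R n :=
  schwartz_pair (rschwartz_rderivs w (rschwartz_cReal v))
    (rschwartz_rderivs w (rschwartz_cImag v)).

Lemma spartialE w v : spartial w v = pderivs w v :> (E -> R[i]).
Proof. by apply/funext => x; rewrite pderivsE. Qed.

Lemma spartial_lin w (c : R[i]) (u v : schwartz R n) :
  spartial w (c *: u + v) = c *: spartial w u + spartial w v.
Proof.
apply/val_inj => /=.
rewrite -[LHS]/(schwartz_fun (spartial w (c *: u + v))) spartialE.
rewrite -[schwartz_fun (c *: u + v)]/(c *: (u : E -> R[i]) + v).
rewrite pderivs_lin; [|exact: schwartz_smooth..].
by rewrite -!spartialE.
Qed.

Lemma snorm_spartial m w v : snorm m (spartial w v) <= snorm (m + size w) v.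
Proof.
apply: snorm_le => w' x wm; rewrite spartialE /pderivs -foldr_cat -/(pderivs _ _).
apply: le_trans (snorm_ge v x (_ : (size (w' ++ w) <= m + size w)%N)).
  by apply: ler_wpM2r; [exact: normc_ge0|apply: omegaX_le; exact: leq_addr].
by rewrite size_cat leq_add2r.
Qed.

End Partials.

(** * The heat density on the line *)

Section Affine.
Variable R : realType.
Local Notation leb := (@lebesgue_measure R).
Local Notation RR := (measurableTypeR R).
Implicit Types (H : R -> R) (c d : R).

Lemma measurable_affine d c : measurable_fun [set: RR] (fun z : RR => d * z + c : RR).
Proof.
apply: measurable_funD => //; exact: measurable_funM.
Qed.

Lemma lebesgue_affine_itv d c (x y : R) : d != 0 ->
  (`|d|%:E * leb ((fun z : R => d * z + c)%R @^-1` `]x, y]) = leb `]x, y])%E.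
Proof.
move=> d0; have [d_gt0|d_lt0|d00] := ltgtP 0 d; last by rewrite d00 eqxx in d0.
- rewrite (_ : _ @^-1` _ = `](x - c) / d, (y - c) / d]%classic); last first.
    apply/seteqP; split => z /=; rewrite !in_itv /=.
      by rewrite ltr_pdivrMr // ler_pdivlMr // !(mulrC z) ltrBlDr lerBrDr.
    by rewrite ltr_pdivrMr // ler_pdivlMr // !(mulrC z) ltrBlDr lerBrDr.
  rewrite !lebesgue_measure_itv /= !lte_fin ltr_pM2r ?invr_gt0 // ltrD2r.
  case: ifP => _; last by rewrite mule0.
  rewrite -!EFinD -EFinM gtr0_norm //; congr EFin.
  by rewrite -mulrBl mulrC divfK // opprD opprK addrACA addNr addr0.
- rewrite (_ : _ @^-1` _ = `[(y - c) / d, (x - c) / d[%classic); last first.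
    apply/seteqP; split => z /=; rewrite !in_itv /=.
      by rewrite ler_ndivrMr // ltr_ndivlMr // !(mulrC z) ltrBlDr lerBrDr andbC.
    by rewrite ler_ndivrMr // ltr_ndivlMr // !(mulrC z) ltrBlDr lerBrDr andbC.
  rewrite !lebesgue_measure_itv /= !lte_fin ltr_nM2r ?invr_lt0 // ltrD2r.
  case: ifP => _; last by rewrite mule0.
  rewrite -!EFinD -EFinM ltr0_norm //; congr EFin.
  by rewrite -mulrBl mulrC mulrN divfK // -opprB opprK opprB; lra.
Qed.

(** The image measure, multiplied by |d|, agrees with Lebesgue measure on half-open intervals, hence
    everywhere by uniqueness. *)
Lemma lebesgue_affine d c (A : set RR) : d != 0 -> measurable A ->
  (`|d|%:E * leb ((fun z : R => d * z + c)%R @^-1` A) = leb A)%E.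
Proof.
move=> d0 mA.
pose mu := mscale (NngNum (normr_ge0 d))
  (measure_function_pushforward__canonical__measure_function_Measure leb (measurable_affine d c)).
rewrite [RHS](@lebesgue_measure_unique R mu) // => _ [[x y] _ <-] /=.
by rewrite -(lebesgue_affine_itv c x y d0).
Qed.

Lemma ge0_integral_affine H d c : d != 0 -> measurable_fun [set: RR] H ->
  (forall x, 0 <= H x) ->
  (\int[leb]_y (H y)%:E = `|d|%:E * \int[leb]_z (H (d * z + c)%R)%:E)%E.
Proof.
move=> d0 mH H0.
have mEH : measurable_fun [set: RR] (EFin \o H) by exact/measurable_EFinP.
have EH0 (x : RR) : (0 <= (EFin \o H) x)%E by rewrite /= lee_fin.
rewrite -[X in X%:E](_ : (NngNum (normr_ge0 d))%:num = _) //.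
have := ge0_integral_pushforward (measurable_affine d c) leb (measurableT : measurable [set: RR]) mEH (fun x _ => EH0 x).
rewrite preimage_setT => e.
rewrite -[X in (_ = _ * X)%E]e -ge0_integral_mscale //.
exact: measurable_affine.
move=> mp; apply: eq_measure_integral => A mA _.
by rewrite /= -(lebesgue_affine c d0 mA).
Qed.

Lemma Rintegral_odd (f : R -> R) : measurable_fun [set: RR] f ->
  (forall x, f (- x) = - f x) -> \int[leb]_x f x = 0.
Proof.
move=> mf fo; rewrite /Rintegral integralE.
have mfp := measurable_funrpos mf; have mfn := measurable_funrneg mf.
rewrite (_ : \int[leb]_x ((EFin \o f)^\- x) = \int[leb]_x ((EFin \o f)^\+ x))%E.
  (* The two parts have the same integral. If it is infinite, the difference is -oo by convention
     and its [fine] value is 0, so the identity holds in that case too. *)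
  by case: (\int[leb]_x ((EFin \o f)^\+ x))%E => [r| |] //=; rewrite subrr.
transitivity (\int[leb]_x (f^\- x)%R%:E)%E.
  by apply: eq_integral => x _; rewrite funenegE /funrneg /= -EFin_max.
rewrite (@ge0_integral_affine _ (-1) 0) ?oppr_eq0 ?oner_eq0 //.
rewrite normrN1 mul1e; apply: eq_integral => x _.
by rewrite funeposE /funrneg /= mulN1r addr0 fo opprK -EFin_max.
Qed.

End Affine.

(** * The Gaussian density of variance 2 *)

Section Gauss.
Variable R : realType.
Local Notation leb := (@lebesgue_measure R).
Local Notation RR := (measurableTypeR R).
Implicit Types (z : R).

(** The heat kernel on the line at time 1. *)
Definition gpdf z : R := (Num.sqrt (4 * pi))^-1 * expR (- (z ^+ 2 / 4)).

Lemma gpdfE z : gpdf z = normal_pdf 0 (Num.sqrt 2) z.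
Proof.
have s0 : Num.sqrt 2 != 0 :> R by rewrite gt_eqF // sqrtr_gt0.
rewrite (normal_pdfE _ s0) /normal_peak /normal_fun sqr_sqrtr // subr0 /gpdf.
congr (_^-1 * expR _); last by rewrite mulNr -(mulr_natl 2) ; congr (- (_ / _)); ring.
by congr Num.sqrt; rewrite -mulr_natl; ring.
Qed.

Lemma gpdf_ge0 z : 0 <= gpdf z.
Proof. by rewrite gpdfE normal_pdf_ge0. Qed.

Lemma gpdfN z : gpdf (- z) = gpdf z.
Proof. by rewrite /gpdf sqrrN. Qed.

Lemma measurable_gpdf : measurable_fun [set: RR] gpdf.
Proof.
rewrite (_ : gpdf = normal_pdf 0 (Num.sqrt 2)); first exact: measurable_normal_pdf.
by apply/funext => z; exact: gpdfE.
Qed.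

Lemma integral_gpdf : (\int[leb]_z (gpdf z)%:E = 1)%E.
Proof.
by under eq_integral do rewrite gpdfE; exact: integral_normal_pdf.
Qed.

Lemma pow_le_expR (m : nat) (y : R) : 0 <= y -> y ^+ m <= m`!%:R * expR y.
Proof.
move=> y0; case: m => [|m]; first by rewrite expr0 fact0 mul1r -[leLHS]expR0 ler_expR.
rewrite -ler_pdivrMl ?ltr0n ?fact_gt0 // mulrC.
by apply: le_trans (expR_ge1Dxn m y0); rewrite lerDr.
Qed.

(** Half of the exponent -z^2 / 4 absorbs any power of 1 + |z|; the other half is the exponent of
    the normal density of standard deviation 2. *)
Lemma gpdf_moment_bound (m : nat) : exists C : R, forall z,
  gpdf z * (1 + `|z|) ^+ m <= C * normal_pdf 0 2 z.
Proof.
pose C1 := 16 ^+ m * m`!%:R * expR (8^-1) * (Num.sqrt (4 * pi))^-1 : R.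
exists (C1 * (normal_peak 2)^-1) => z.
have n2 : (2 : R) != 0 by [].
rewrite (normal_pdfE _ n2) mulrA mulfVK ?gt_eqF ?normal_peak_gt0 //.
have tm : (1 + `|z|) ^+ m <= 16 ^+ m * m`!%:R * expR (8^-1 + z ^+ 2 / 8).
  set t := 1 + `|z|; have t1 : 1 <= t by rewrite /t lerDl.
  apply: (@le_trans _ _ ((t ^+ 2) ^+ m)).
    by rewrite -exprM; apply: ler_weXn2l => //; rewrite mul2n -addnn leq_addr.
  (* Since t^2 <= 2 + 2 z^2, division by 16 gives y <= 1/8 + z^2 / 8, exactly the part of the
     exponent that may be spent. *)
  pose y := t ^+ 2 / 16; have -> : t ^+ 2 = 16 * y by rewrite mulrC divfK.
  rewrite exprMn -mulrA ler_wpM2l ?exprn_ge0 //.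
  have y0 : 0 <= y by rewrite divr_ge0 // sqr_ge0.
  apply: (le_trans (pow_le_expR m y0)); rewrite ler_wpM2l // ler_expR.
  rewrite /y /t -(real_normK (num_real z)); have := sqr_ge0 (1 - `|z|); lra.
apply: (le_trans (ler_wpM2l (gpdf_ge0 z) tm)).
rewrite /gpdf /normal_fun subr0 /C1.
rewrite [leLHS](_ : _ = 16 ^+ m * m`!%:R * (Num.sqrt (4 * pi))^-1 *
  expR (- (z ^+ 2 / 4) + (8^-1 + z ^+ 2 / 8))); last by rewrite (expRD (- _)); ring.
rewrite [leRHS](_ : _ = 16 ^+ m * m`!%:R * (Num.sqrt (4 * pi))^-1 *
  expR (8^-1 + - z ^+ 2 / (2 ^+ 2 *+ 2))); last by rewrite expRD; ring.
rewrite ler_wpM2l ?mulr_ge0 ?exprn_ge0 ?invr_ge0 ?sqrtr_ge0 // ler_expR.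
have -> : (2 : R) ^+ 2 *+ 2 = 8 by ring.
by rewrite le_eqVlt; apply/orP; left; apply/eqP; field.
Qed.

Lemma integrable_gpdf_moment (m : nat) :
  leb.-integrable [set: RR] (EFin \o (fun z : RR => gpdf z * (1 + `|z|) ^+ m)).
Proof.
have [C hC] := gpdf_moment_bound m.
apply: (@integrable_dominated _ RR R leb setT measurableT _ (fun z : RR => C * normal_pdf 0 2 z)).
- apply: measurable_funM; first exact: measurable_gpdf.
  apply: measurable_funX; apply: measurable_funD => //.
  
- apply: integrable_mulrl => //; exact: integrable_normal_pdf.
- move=> z _; rewrite ger0_norm; first exact: hC.
  by rewrite mulr_ge0 ?gpdf_ge0 // exprn_ge0 // addr_ge0.
Qed.

Lemma integrable_gpdf_poly (m : nat) (C : R) (f : R -> R) :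
  measurable_fun [set: RR] f -> (forall z, `|f z| <= C * (1 + `|z|) ^+ m) ->
  leb.-integrable [set: RR] (EFin \o (fun z : RR => gpdf z * f z)).
Proof.
move=> mf fC.
apply: (@integrable_dominated _ RR R leb setT measurableT _ (fun z : RR => C * (gpdf z * (1 + `|z|) ^+ m))).
- apply: measurable_funM => //; exact: measurable_gpdf.
- apply: integrable_mulrl => //; exact: integrable_gpdf_moment.
- move=> z _; rewrite normrM (ger0_norm (gpdf_ge0 z)) mulrCA.
  by apply: ler_wpM2l => //; exact: gpdf_ge0.
Qed.

Lemma Rintegral_gpdf : \int[leb]_z gpdf z = 1.
Proof. by rewrite /Rintegral integral_gpdf. Qed.

Lemma gpdf_odd_moment (k : nat) : odd k -> \int[leb]_z (gpdf z * z ^+ k) = 0.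
Proof.
move=> ok; apply: Rintegral_odd.
  apply: measurable_funM; first exact: measurable_gpdf.
  exact: measurable_funX.
by move=> z; rewrite gpdfN exprNn -signr_odd ok expr1 mulN1r mulrN.
Qed.

(** Completing the square. For independent z and w of density [gpdf] and y = p z + q w, the left
    side is, up to a Jacobian factor, the joint density of z and y; the right side is the marginal
    of y times the conditional density of z. *)
Lemma gpdf_mul_shift (p q r y z : R) : q != 0 -> r != 0 -> r ^+ 2 = p ^+ 2 + q ^+ 2 ->
  gpdf z * gpdf ((y - p * z) / q) = gpdf (y / r) * gpdf (r / q * z + - (p * y / (r * q))).
Proof.
move=> q0 r0 rpq.
have gM (a b : R) : gpdf a * gpdf b =
    (Num.sqrt (4 * pi))^-1 ^+ 2 * expR (- ((a ^+ 2 + b ^+ 2) / 4)).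
  by rewrite /gpdf (mulrDl (a ^+ 2)) (opprD (a ^+ 2 / 4)) expRD; ring.
rewrite !gM; congr (_ * expR (- (_ / 4))).
have r2 : r ^+ 2 != 0 by rewrite expf_neq0.
apply: (@mulfI _ (r ^+ 2 * q ^+ 2)); first by rewrite mulf_neq0 ?expf_neq0.
rewrite [LHS](_ : _ = r ^+ 2 * (q ^+ 2 * z ^+ 2 + (y - p * z) ^+ 2)); last by field.
rewrite [RHS](_ : _ = q ^+ 2 * y ^+ 2 + (r ^+ 2 * z - p * y) ^+ 2); last by field; rewrite q0 r0.
rewrite rpq; ring.
Qed.

(** The sum of two independent centred Gaussians is a centred Gaussian whose variance is the sum.
    Extended integrals of nonnegative functions let Tonelli's theorem apply directly. *)
Lemma gauss_parallel (H : R -> R) (p q r : R) : 0 < q -> 0 < r ->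
  r ^+ 2 = p ^+ 2 + q ^+ 2 -> measurable_fun [set: RR] H -> (forall x, 0 <= H x) ->
  (\int[leb]_z \int[leb]_w (gpdf z * (gpdf w * H (p * z + q * w)))%:E =
   \int[leb]_u (gpdf u * H (r * u))%:E)%E.
Proof.
move=> q0 r0 rpq mH H0.
have q0' : q != 0 by rewrite gt_eqF.
have r0' : r != 0 by rewrite gt_eqF.
have mHa (a b : R) : measurable_fun [set: RR] (fun z : RR => H (a * z + b)).
  by apply: (measurableT_comp mH); exact: measurable_affine.
have mga (a b : R) : measurable_fun [set: RR] (fun z : RR => gpdf (a * z + b)).
  by apply: (measurableT_comp measurable_gpdf); exact: measurable_affine.
have inner (z : R) : (\int[leb]_w (gpdf z * (gpdf w * H (p * z + q * w)))%:E =
    \int[leb]_y (q^-1 * H y * (gpdf z * gpdf ((y - p * z) / q)))%:E)%E.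
  rewrite (@ge0_integral_affine R (fun y => q^-1 * H y * (gpdf z * gpdf ((y - p * z) / q))) q (p * z)) //.
  - rewrite (ger0_norm (ltW q0)) -ge0_integralZl_EFin //; first last.
    + exact: ltW.
    + apply/measurable_EFinP; apply: measurable_funM; first exact: measurable_funM.
      apply: measurable_funM => //.
      under eq_fun do rewrite addrK mulrC mulKf //.
      exact: measurable_gpdf.
    + move=> x _; rewrite lee_fin !mulr_ge0 ?gpdf_ge0 // invr_ge0 ltW //.
    apply: eq_integral => w _; rewrite -EFinM; congr EFin.
    rewrite addrK [q * w / q]mulrC mulKf // (addrC (q * w)); field.
    by [].
  - apply: measurable_funM; first exact: measurable_funM.
    apply: measurable_funM => //.
    rewrite (_ : (fun x => _) = fun x => gpdf (q^-1 * x + - (p * z / q))); first exact: mga.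
    by apply/funext => y; congr gpdf; field.
  - by move=> y; rewrite !mulr_ge0 ?gpdf_ge0 // invr_ge0 ltW.
(* After the substitution y = p z + q w the order of integration is exchanged, and the integral over
   z becomes that of a shifted and rescaled [gpdf]. *)
under eq_integral do rewrite inner.
have mj : measurable_fun [set: RR * RR] (fun t : RR * RR =>
    (q^-1 * H t.2 * (gpdf t.1 * gpdf ((t.2 - p * t.1) / q)))%:E).
  apply/measurable_EFinP; apply: measurable_funM.
    by apply: measurable_funM => //; exact: (measurableT_comp mH).
  apply: measurable_funM; first exact: (measurableT_comp measurable_gpdf).
  apply: (measurableT_comp measurable_gpdf); apply: measurable_funM => //.
  by apply: measurable_funB => //; apply: measurable_funM.
rewrite (@fubini_tonelli _ _ _ _ R leb leb (fun t : RR * RR =>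
    (q^-1 * H t.2 * (gpdf t.1 * gpdf ((t.2 - p * t.1) / q)))%:E)) //=; last first.
  by move=> t; rewrite lee_fin !mulr_ge0 ?gpdf_ge0 // invr_ge0 ltW.
have rq0 : r / q != 0 by rewrite mulf_neq0 // invr_neq0.
have outer (y : R) : (\int[leb]_z (q^-1 * H y * (gpdf z * gpdf ((y - p * z) / q)))%:E =
    (r^-1 * H y * gpdf (y / r))%:E)%E.
  under eq_integral do rewrite (gpdf_mul_shift y _ q0' r0' rpq) mulrA EFinM.
  rewrite ge0_integralZl_EFin //; first last.
  - by rewrite !mulr_ge0 ?gpdf_ge0 // invr_ge0 ltW.
  - exact/measurable_EFinP.
  - by move=> z _; rewrite lee_fin gpdf_ge0.
  have := @ge0_integral_affine R gpdf (r / q) (- (p * y / (r * q))) rq0 measurable_gpdf gpdf_ge0.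
  rewrite integral_gpdf gtr0_norm ?divr_gt0 // => e.
  have -> : (\int[leb]_z (gpdf (r / q * z - p * y / (r * q)))%:E = (q / r)%:E)%E.
    rewrite -[LHS]mul1e (_ : 1%E = (q / r * (r / q))%:E); last first.
      by congr EFin; field; rewrite q0' r0'.
    by rewrite EFinM -muleA -e mule1.
  by rewrite -EFinM; congr EFin; field; rewrite q0' r0'.
under eq_integral do rewrite outer.
rewrite (@ge0_integral_affine R (fun y => r^-1 * H y * gpdf (y / r)) r 0) //.
- rewrite (ger0_norm (ltW r0)) -ge0_integralZl_EFin //; first last.
  + exact: ltW.
  + apply/measurable_EFinP; apply: measurable_funM; first exact: measurable_funM.
    under eq_fun do rewrite addr0 mulrC mulKf //.
    exact: measurable_gpdf.
  + by move=> x _; rewrite lee_fin !mulr_ge0 ?gpdf_ge0 // invr_ge0 ltW.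
  apply: eq_integral => w _; rewrite -EFinM; congr EFin.
  by rewrite addr0 [r * w / r]mulrC mulKf //; field.
- apply: measurable_funM; first exact: measurable_funM.
  under eq_fun do rewrite mulrC -[X in gpdf X]addr0.
  exact: mga.
- by move=> y; rewrite !mulr_ge0 ?gpdf_ge0 // invr_ge0 ltW.
Qed.

End Gauss.

(** * Gaussian averages of bounded Borel functions *)

Section Borel.
Variables (R : realType) (n : nat).
Local Notation leb := (@lebesgue_measure R).
Local Notation RR := (measurableTypeR R).
Local Notation E := 'rV[R]_n.
Implicit Types (F : E -> R) (b c x : E) (C : R).

Lemma norm_rV_le x C : 0 <= C -> (forall i, `|x 0 i| <= C) -> `|x| <= C.
Proof.
move=> C0 xC; rewrite [leLHS]mx_normrE; apply: bigmax_le => //= -[i j] _ /=.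
by rewrite ord1.
Qed.

(** Measurability is tested by composition with measurable coordinates from an arbitrary space. The
    same F is integrated over tuples, lines and products, and each use is an instance. *)
Definition borel_fun F := forall d (T : measurableType d) (g : 'I_n -> T -> RR),
  (forall i, measurable_fun [set: T] (g i)) ->
  measurable_fun [set: T] (fun t => F (\row_i g i t) : RR).

Definition grid (m : nat) (y : R) : R := (Num.floor (m.+1%:R * y))%:~R / m.+1%:R.

Lemma grid_dist m y : `|y - grid m y| <= m.+1%:R^-1.
Proof.
have m0 : (0 : R) < m.+1%:R by [].
have /andP[l1 l2] := floor_itv (m.+1%:R * y).
rewrite -(ler_pM2l m0) divff ?gt_eqF // -[X in X * `|_|](gtr0_norm m0) -normrM mulrBr /grid.
rewrite mulrCA divff ?gt_eqF // mulr1 ger0_norm ?subr_ge0 //.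
by move: l2; rewrite rmorphD rmorph1 => /ltW l2; rewrite lerBlDl.
Qed.

(** The composite takes countably many values, and the set where all integer parts are prescribed is
    a finite intersection of preimages of half-open intervals. *)
Lemma borel_fun_grid F m : borel_fun (fun x => F (\row_i grid m (x 0 i))).
Proof.
move=> d T g mg.
pose k t : {ffun 'I_n -> int} := [ffun i => Num.floor (m.+1%:R * g i t)].
pose G (K : {ffun 'I_n -> int}) : R := F (\row_i ((K i)%:~R / m.+1%:R)).
rewrite (_ : (fun t => _) = G \o k); last first.
  apply/funext => t /=; rewrite /G; congr F; apply/rowP => i.
  by rewrite !mxE /k ffunE.
move=> _ Y mY; rewrite setTI.
have -> : (G \o k) @^-1` Y = \bigcup_K ([set t | k t = K] `&` [set t | Y (G K)]).
  apply/seteqP; split => [t Yt|t [K _ [<- //]]].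
  by exists (k t).
apply: countable_bigcupT_measurable; first exact: countableP.
move=> K; apply: measurableI; last first.
  have [YK|YK] := pselect (Y (G K)).
    by rewrite (_ : [set t | _] = setT) //; apply/seteqP; split.
  by rewrite (_ : [set t | _] = set0) //; apply/seteqP; split.
have -> : [set t | k t = K] = \bigcap_(i in [set: 'I_n])
    ((fun t => m.+1%:R * g i t) @^-1` `[(K i)%:~R, (K i + 1)%:~R[).
  apply/seteqP; split => [t <- i _ /=|t kt /=].
    by rewrite in_itv /= /k ffunE floor_itv.
  apply/ffunP => i; rewrite /k ffunE; apply: floor_def.
  by have := kt i I; rewrite /= in_itv.
apply: fin_bigcap_measurable; first exact: finite_finset.
move=> i _; rewrite -[X in measurable X]setTI.
have mgi : measurable_fun [set: T] (fun t => m.+1%:R * g i t : RR).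
  by apply: measurable_funM => //; exact: mg.
exact: mgi.
Qed.

(** F is the pointwise limit of its values at grid points of mesh 1 / (m + 1). *)
Lemma continuous_borel_fun F : continuous F -> borel_fun F.
Proof.
move=> cF d T g mg.
pose h (m : nat) (t : T) : R := F (\row_i grid m ((\row_j g j t) 0 i)).
apply: (@measurable_fun_cvg _ _ _ _ h).
  by move=> m; exact: (@borel_fun_grid F m).
move=> t _; set x := \row_j g j t; rewrite /h -/x.
apply: (@cvg_comp _ _ _ (fun m : nat => \row_i grid m (x 0 i) : E) F \oo (nbhs x)); last exact: cF.
apply/(@cvgrPdist_le R E) => e e0.
near=> m.
apply: (@le_trans _ _ m.+1%:R^-1).
  apply: norm_rV_le; first by rewrite invr_ge0.
  by move=> i; rewrite !mxE; exact: grid_dist.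
near: m; apply: filterS (near_infty_natSinv_lt (PosNum e0)) => m /ltW.
exact.
Unshelve. all: by end_near. Qed.

Lemma borel_fun_comp F d (T : measurableType d) (h : T -> E) : borel_fun F ->
  (forall i, measurable_fun [set: T] (fun t => h t 0 i : RR)) ->
  measurable_fun [set: T] (fun t => F (h t) : RR).
Proof.
move=> bF mh; have := bF _ _ (fun i t => h t 0 i : RR) mh.
rewrite (_ : (fun t => F (\row_i _)) = (fun t => F (h t))) //.
by apply/funext => t; congr F; apply/rowP => i; rewrite mxE.
Qed.

(** Heat flow for unit time in the direction b: convolution with the Gaussian measure of the rank
    one matrix b^T b, carried by a line. *)
Definition gavg b F x : R := \int[leb]_z (gpdf z * F (x + z *: b)).

Definition bborel F C := borel_fun F /\ forall x, `|F x| <= C.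

Lemma measurable_line F b x : borel_fun F ->
  measurable_fun [set: RR] (fun z : RR => F (x + z *: b) : RR).
Proof.
move=> bF; apply: borel_fun_comp => // i.
under eq_fun do rewrite !mxE addrC mulrC.
exact: measurable_affine.
Qed.

Lemma integrable_gavg F C b x : bborel F C ->
  leb.-integrable [set: RR] (EFin \o (fun z : RR => gpdf z * F (x + z *: b))).
Proof.
move=> [bF FC]; apply: (@integrable_gpdf_poly _ 0 C); first exact: measurable_line.
by move=> z; rewrite expr0 mulr1.
Qed.

Lemma gavgE F C b x : bborel F C ->
  (\int[leb]_z (gpdf z * F (x + z *: b))%:E = (gavg b F x)%:E)%E.
Proof.
move=> bF; rewrite /gavg /Rintegral fineK //.
exact: (integrable_fin_num _ (integrable_gavg b x bF)).
Qed.

Lemma gavg_cst (C : R) b x : gavg b (fun=> C) x = C.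
Proof.
rewrite /gavg; under eq_Rintegral do rewrite mulrC.
have ig := @integrable_gpdf_moment R 0.
rewrite RintegralZl //.
  by rewrite Rintegral_gpdf mulr1.
by move: ig; under eq_fun do rewrite expr0 mulr1.
Qed.

Lemma bborel_cst C : bborel (fun=> C) `|C|.
Proof. by split => // d T g _; exact: measurable_cst. Qed.

Lemma bborelD F G C C' : bborel F C -> bborel G C' ->
  bborel (fun x => F x + G x) (C + C').
Proof.
move=> [bF FC] [bG GC]; split.
  by move=> d T g mg; apply: measurable_funD; [exact: bF|exact: bG].
by move=> x; apply: (le_trans (ler_normD _ _)); exact: lerD.
Qed.

Lemma gavgD F G C C' b x : bborel F C -> bborel G C' ->
  gavg b (fun x => F x + G x) x = gavg b F x + gavg b G x.
Proof.
move=> bF bG; rewrite /gavg; under eq_Rintegral do rewrite mulrDr.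
by rewrite RintegralD //; [exact: integrable_gavg bF|exact: integrable_gavg bG].
Qed.

Lemma gavg_bounded F C b x : bborel F C -> `|gavg b F x| <= C.
Proof.
move=> bF; have I1 := integrable_gavg b x bF.
apply: (le_trans (le_normr_Rintegral measurableT I1)).
rewrite -[leRHS](gavg_cst C b x) /gavg; apply: le_Rintegral => //.
- exact: (integrable_abse I1).
- exact: (integrable_gavg b x (bborel_cst C)).
- move=> z _; rewrite normrM (ger0_norm (gpdf_ge0 z)).
  by apply: ler_wpM2l; [exact: gpdf_ge0|exact: bF.2].
Qed.

Lemma gavg_ge0 F b x : (forall x, 0 <= F x) -> 0 <= gavg b F x.
Proof. by move=> F0; apply: Rintegral_ge0 => z _; rewrite mulr_ge0 ?gpdf_ge0. Qed.

Lemma measurable_gavg_joint F d (T : measurableType d) (g : 'I_n -> T -> RR) b :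
  borel_fun F -> (forall i, measurable_fun [set: T] (g i)) ->
  measurable_fun [set: T * RR]
    (fun p : T * RR => gpdf p.2 * F ((\row_i g i p.1) + p.2 *: b) : RR).
Proof.
move=> bF mg; apply: measurable_funM.
  exact: (measurableT_comp (@measurable_gpdf R)).
apply: borel_fun_comp => // i; under eq_fun do rewrite !mxE.
apply: measurable_funD; first exact: (measurableT_comp (mg i)).
exact: measurable_funM.
Qed.

Lemma ge0_bborel_gavg F C b : (forall x, 0 <= F x) -> bborel F C -> bborel (gavg b F) C.
Proof.
move=> F0 bF; split; last by move=> x; exact: gavg_bounded.
move=> d T g mg; apply/measurable_EFinP.
rewrite (_ : EFin \o _ = fun t => (\int[leb]_z (gpdf z * F ((\row_i g i t) + z *: b))%:E)%E); last first.
  by apply/funext => t; rewrite (gavgE _ _ bF).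
have mj := measurable_gavg_joint b bF.1 mg.
apply: (@measurable_fun_fubini_tonelli_F _ _ T RR R leb
  (fun p => (gpdf p.2 * F ((\row_i g i p.1) + p.2 *: b))%:E)).
  exact/measurable_EFinP.
by move=> p; rewrite lee_fin mulr_ge0 ?gpdf_ge0.
Qed.

(** Averages fix constants, and adding the bound C makes F nonnegative. Measurability of the
    average, commutation and the parallel rule are reduced in this way to the nonnegative case,
    where Tonelli's theorem applies. *)
Lemma gavg_shift F C b : bborel F C ->
  gavg b F = fun x => gavg b (fun x => F x + C) x + (- C).
Proof.
move=> bF; apply/funext => x.
by rewrite (gavgD _ _ bF (bborel_cst C)) gavg_cst addrK.
Qed.

Lemma bborel_shift F C : bborel F C ->
  bborel (fun x => F x + C) (C + `|C|) /\ forall x, 0 <= F x + C.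
Proof.
move=> bF; split; first exact: bborelD (bborel_cst C).
by move=> x; have := bF.2 x; rewrite ler_norml => /andP[h _]; lra.
Qed.

Lemma bborel_gavg F C b : bborel F C -> bborel (gavg b F) C.
Proof.
move=> bF; split; last by move=> x; exact: gavg_bounded.
have [bFC FC0] := bborel_shift bF.
rewrite (gavg_shift b bF).
exact: (bborelD (ge0_bborel_gavg b FC0 bFC) (bborel_cst (- C))).1.
Qed.

Lemma gavg_gavgE F C b c x : (forall x, 0 <= F x) -> bborel F C ->
  ((gavg b (gavg c F) x)%:E = \int[leb]_z \int[leb]_w
    (gpdf z * (gpdf w * F (x + z *: b + w *: c)))%:E)%E.
Proof.
move=> F0 bF; rewrite -(gavgE _ _ (bborel_gavg c bF)).
apply: eq_integral => z _; rewrite EFinM -(gavgE _ _ bF).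
rewrite -ge0_integralZl_EFin //.
- by move=> w _; rewrite lee_fin mulr_ge0 ?gpdf_ge0.
- apply/measurable_EFinP; apply: measurable_funM; first exact: measurable_gpdf.
  exact: measurable_line bF.1.
- exact: gpdf_ge0.
Qed.

Lemma ge0_gavg_comm F C b c x : (forall x, 0 <= F x) -> bborel F C ->
  gavg b (gavg c F) x = gavg c (gavg b F) x.
Proof.
move=> F0 bF; apply: EFin_inj.
refine (etrans (gavg_gavgE b c x F0 bF) (etrans _ (esym (gavg_gavgE c b x F0 bF)))).
rewrite (@fubini_tonelli _ _ RR RR R leb leb (fun t : RR * RR =>
    (gpdf t.1 * (gpdf t.2 * F (x + t.1 *: b + t.2 *: c)))%:E)) /=.
- apply: eq_integral => w _; apply: eq_integral => z _; congr EFin.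
  by rewrite mulrCA addrAC.
- apply/measurable_EFinP; apply: measurable_funM.
    exact: (measurableT_comp (@measurable_gpdf R)).
  apply: measurable_funM; first exact: (measurableT_comp (@measurable_gpdf R)).
  apply: borel_fun_comp bF.1 _ => i; under eq_fun do rewrite !mxE.
  by apply: measurable_funD; [apply: measurable_funD => //|]; exact: measurable_funM.
- by move=> t; rewrite lee_fin !mulr_ge0 ?gpdf_ge0.
Qed.

Lemma gavg_comm F C b c x : bborel F C -> gavg b (gavg c F) x = gavg c (gavg b F) x.
Proof.
move=> bF0; have [bF F0] := bborel_shift bF0.
have two u v : gavg u (gavg v F) x = gavg u (gavg v (fun x => F x + C)) x - C.
  rewrite (gavg_shift v bF0).
  rewrite (gavgD _ _ (bborel_gavg v bF) (bborel_cst (- C))).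
  by rewrite gavg_cst.
exact: (etrans (two b c) (etrans
  (congr1 (fun r => r - C) (ge0_gavg_comm b c x F0 bF)) (esym (two c b)))).
Qed.

Lemma gavg0 F x : gavg 0 F x = F x.
Proof.
rewrite /gavg; under eq_Rintegral do rewrite scaler0 addr0.
exact: (gavg_cst (F x) 0 x).
Qed.

Lemma gavg_parallel F C b (p q r : R) x : bborel F C -> 0 <= p -> 0 <= q -> 0 <= r ->
  r ^+ 2 = p ^+ 2 + q ^+ 2 ->
  gavg (p *: b) (gavg (q *: b) F) x = gavg (r *: b) F x.
Proof.
move=> bF0 p0 q0 r0 rpq.
(* [gauss_parallel] divides by q and r. If q = 0, then r = p and the inner average is trivial; if q
   > 0, then r > 0 as well. *)
have [q00|qn0] := eqVneq q 0.
  have -> : r = p.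
    by apply/eqP; rewrite -(eqrXn2 (n := 2)) // rpq q00 expr0n addr0.
  rewrite q00 scale0r; congr (gavg _ _ x); apply/funext => y; exact: gavg0.
have q_gt0 : 0 < q by rewrite lt_neqAle eq_sym qn0.
have r_gt0 : 0 < r.
  rewrite lt_neqAle r0 andbT eq_sym; apply/eqP => r00; move/eqP: rpq.
  by rewrite r00 expr0n /= eq_sym paddr_eq0 ?sqr_ge0 // !expf_eq0 /= (negbTE qn0) andbF.
have [bF F0] := bborel_shift bF0.
rewrite (gavg_shift (q *: b) bF0) (gavg_shift (r *: b) bF0).
rewrite (gavgD _ _ (bborel_gavg _ bF) (bborel_cst (- C))) gavg_cst.
congr (_ - C); apply: EFin_inj.
set G := (fun x => F x + C) in bF F0 *.
rewrite (gavg_gavgE _ _ _ F0 bF) -(gavgE _ _ bF).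
pose H s := G (x + s *: b).
transitivity (\int[leb]_z \int[leb]_w (gpdf z * (gpdf w * H (p * z + q * w)))%:E)%E.
  apply: eq_integral => z _; apply: eq_integral => w _; rewrite /H.
  by rewrite !scalerA scalerDl addrA (mulrC z) (mulrC w).
rewrite (@gauss_parallel R H p q r) //.
- by apply: eq_integral => z _; rewrite /H scalerA (mulrC r).
- exact: measurable_line bF.1.
- by move=> s; exact: F0.
Qed.

End Borel.

(** * Gaussian averages and partial derivatives *)

Section RealLinear.
Variables (R : realType) (n : nat).
Local Notation E := 'rV[R]_n.
Implicit Types (f g : E -> R) (x v b : E) (i : 'I_n) (w : seq 'I_n).

Lemma rsmooth_derivable f x i w : rsmooth f -> derivable (rderivs w f) x (delta_mx 0 i).
Proof. by move=> sf; have [_] := sf w x; exact. Qed.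
Arguments rsmooth_derivable [f] x i w _.

Lemma rsmooth_continuous f : rsmooth f -> continuous f.
Proof. by move=> sf x; have [] := sf [::] x. Qed.

Lemma rderivs_lin w (k : R) f g : rsmooth f -> rsmooth g ->
  rderivs w (fun x => k * f x + g x) = (fun x => k * rderivs w f x + rderivs w g x).
Proof.
move=> sf sg; elim: w => //= i w; rewrite -/(rderivs w _) => ->.
apply/funext => x; rewrite -!/(rderivs w _).
have df := rsmooth_derivable x i w sf; have dg := rsmooth_derivable x i w sg.
have dkf := derivableZ (k := k) df.
have e := deriveD dkf dg; rewrite (deriveZ k df) in e.
exact: e.
Qed.

Lemma rsmooth_lin (k : R) f g : rsmooth f -> rsmooth g ->
  rsmooth (fun x => k * f x + g x).
Proof.
move=> sf sg w x; rewrite rderivs_lin //.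
have [cf _] := sf w x; have [cg _] := sg w x; split.
  exact: (@cvgD _ _ _ (nbhs x) _ _ _ _ _ (cvgMr (a := k) cf) cg).
move=> i; have df := rsmooth_derivable x i w sf; have dg := rsmooth_derivable x i w sg.
exact: (derivableD (derivableZ (k := k) df) dg).
Qed.

Lemma rderivs_cst0 w : rderivs w (fun _ : E => 0 : R) = (fun _ => 0).
Proof. by elim: w => //= i w ->; apply/funext => x; exact: derive_cst. Qed.

Lemma rsmooth0 : rsmooth (fun _ : E => 0 : R).
Proof.
move=> w x; rewrite rderivs_cst0; split; first exact: cst_continuous.
by move=> i; exact: derivable_cst.
Qed.

Lemma rsmooth_sum (I : Type) (r : seq I) (k : I -> R) (f : I -> E -> R) :
  (forall j, rsmooth (f j)) -> rsmooth (fun x => \sum_(j <- r) k j * f j x).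
Proof.
move=> sf; elim: r => [|j r IH].
  by under eq_fun do rewrite big_nil; exact: rsmooth0.
under eq_fun do rewrite big_cons; exact: rsmooth_lin.
Qed.

Lemma rderivs_sum (I : Type) (r : seq I) (k : I -> R) (f : I -> E -> R) w :
  (forall j, rsmooth (f j)) ->
  rderivs w (fun x => \sum_(j <- r) k j * f j x) =
  (fun x => \sum_(j <- r) k j * rderivs w (f j) x).
Proof.
move=> sf; elim: r => [|j r IH].
  rewrite (_ : (fun x => _) = fun=> 0); last by apply/funext => x; rewrite big_nil.
  by rewrite rderivs_cst0; apply/funext => x; rewrite big_nil.
rewrite (_ : (fun x => \sum_(i <- j :: r) k i * f i x) =
   fun x => k j * f j x + \sum_(i <- r) k i * f i x); last first.
  by apply/funext => x; rewrite big_cons.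
rewrite rderivs_lin //; last exact: rsmooth_sum.
by rewrite IH; apply/funext => x; rewrite big_cons.
Qed.

Definition ddir b f : E -> R := fun x => \sum_i b 0 i * 'D_(delta_mx 0 i) f x.

Lemma rsmooth_ddir b f : rsmooth f -> rsmooth (ddir b f).
Proof.
move=> sf; apply: rsmooth_sum => i; exact: (rsmooth_rderivs [:: i] sf).
Qed.

Lemma rsb_ddir b f k m N : rsmooth f -> rsb k m.+1 N f ->
  rsb k m (n%:R * `|b| * N) (ddir b f).
Proof.
move=> sf bf w x wm; rewrite /ddir rderivs_sum; last first.
  by move=> i; exact: (rsmooth_rderivs [:: i] sf).
rewrite -[X in X * _](ger0_norm (exprn_ge0 k (omega_ge0 x))) -normrM mulr_sumr.
apply: (le_trans (ler_norm_sum _ _ _)).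
rewrite (_ : _ * N = \sum_(i < n) (`|b| * N)); last first.
  by rewrite sumr_const card_ord -[RHS]mulr_natl mulrA.
apply: ler_sum => i _; rewrite mulrCA !normrM.
apply: ler_pM => //; first exact: coord_le_norm.
rewrite (ger0_norm (exprn_ge0 k (omega_ge0 x))).
rewrite -[rderivs w _]/(rderivs w (rderivs [:: i] f)) -rderivs_cat.
by apply: bf; rewrite size_cat addn1.
Qed.

Lemma rsmooth_line f b x s : rsmooth f ->
  is_derive s (1 : R) (fun t : R => f (x + t *: b)) (ddir b f (x + s *: b)).
Proof.
move=> sf; have [dv e] := rsmooth_is_derive (x + s *: b) b sf.
by rewrite /ddir -e; exact: is_derive_line.
Qed.

Lemma rderivs_scale_shift w (c : R) v f : rsmooth f ->
  rderivs w (fun x => c * f (x + v)) = (fun x => c * rderivs w f (x + v)).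
Proof.
move=> sf; elim: w => //= i w; rewrite -/(rderivs w _) => ->; apply/funext => x.
rewrite -!/(rderivs w _).
have qe : (fun h : R => h^-1 *: (((fun x : E => rderivs w f (x + v)) \o shift x) (h *: delta_mx 0 i)
            - rderivs w f (x + v))) =
         (fun h : R => h^-1 *: ((rderivs w f \o shift (x + v)) (h *: delta_mx 0 i) - rderivs w f (x + v))).
  by apply/funext => h /=; rewrite addrA.
have df := rsmooth_derivable (x + v) i w sf.
have ds : derivable (fun x : E => rderivs w f (x + v)) x (delta_mx 0 i).
  by rewrite /derivable qe.
have := deriveZ c ds; rewrite [in RHS]/derive qe => e.
exact: e.
Qed.

Lemma rsmooth_scale_shift (c : R) v f : rsmooth f -> rsmooth (fun x => c * f (x + v)).
Proof.
move=> sf w x; rewrite rderivs_scale_shift //; split.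
  have cs : {for x, continuous (fun x => rderivs w f (x + v))}.
    apply: (@continuous_comp E E R (fun x => x + v) (rderivs w f) x).
      exact: (@cvgD _ _ _ (nbhs x) _ _ _ _ _ (@cvg_id _ _) (cvg_cst v)).
    by have [] := sf w (x + v).
  exact: cvgMr cs.
move=> i.
have qe : (fun h : R => h^-1 *: (((fun x : E => rderivs w f (x + v)) \o shift x) (h *: delta_mx 0 i)
            - rderivs w f (x + v))) =
         (fun h : R => h^-1 *: ((rderivs w f \o shift (x + v)) (h *: delta_mx 0 i) - rderivs w f (x + v))).
  by apply/funext => h /=; rewrite addrA.
have df := rsmooth_derivable (x + v) i w sf.
have ds : derivable (fun x : E => rderivs w f (x + v)) x (delta_mx 0 i).
  by rewrite /derivable qe.
exact: (derivableZ (k := c) ds).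
Qed.

Lemma omega_shift x (z : R) b : omega x <= omega (x + z *: b) * ((1 + `|z|) * (1 + `|b|)).
Proof.
rewrite -{1}(addrK (z *: b) x); apply: (le_trans (omegaD _ _)).
apply: ler_wpM2l; first exact: omega_ge0.
rewrite /omega normrN normrZ mulrDl mul1r mulrDr mulr1 -!addrA lerD2l.
by rewrite addrA lerDr addr_ge0.
Qed.

Lemma omega_shift_exp m x (z : R) b :
  omega x ^+ m <= omega (x + z *: b) ^+ m * ((1 + `|z|) ^+ m * (1 + `|b|) ^+ m).
Proof.
rewrite -!exprMn; apply: lerXn2r; last exact: omega_shift.
  by rewrite nnegrE omega_ge0.
by rewrite nnegrE mulr_ge0 ?omega_ge0 // mulr_ge0 // addr_ge0.
Qed.

Lemma rsb_shift k m N f (z : R) b : rsmooth f -> rsb k m N f -> forall w x, (size w <= m)%N ->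
  omega x ^+ k * `|rderivs w f (x + z *: b)| <= (1 + `|z|) ^+ k * ((1 + `|b|) ^+ k * N).
Proof.
move=> sf bf w x wm.
apply: (le_trans (ler_wpM2r (normr_ge0 _) (omega_shift_exp k x z b))).
rewrite mulrAC mulrC -mulrA; apply: ler_wpM2l; first by rewrite exprn_ge0 // addr_ge0.
apply: ler_wpM2l; first by rewrite exprn_ge0 // addr_ge0.
exact: bf.
Qed.

End RealLinear.

Section GaussianAverage.
Variables (R : realType) (n : nat).
Local Notation leb := (@lebesgue_measure R).
Local Notation RR := (measurableTypeR R).
Local Notation E := 'rV[R]_n.
Implicit Types (f g : E -> R) (x b : E) (i : 'I_n) (w : seq 'I_n).

Lemma rschwartz_bborel f : rschwartz f -> exists C, bborel f C.
Proof.
move=> [sf bf]; have [N b] := bf 0; exists N; split.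
  exact/continuous_borel_fun/rsmooth_continuous.
by move=> x; exact: (rsb_abs (w := [::]) x b).
Qed.

Definition gmoment (m : nat) : R := \int[leb]_z (gpdf z * (1 + `|z|) ^+ m).

Section fixed.
Variables (b : E) (f : E -> R) (N : nat -> R).
Hypotheses (sf : rsmooth f) (bf : forall m, rsb m m (N m) f).

Let F (z : RR) (x : E) : R := gpdf z * f (x + z *: b).
Let g (m : nat) (z : RR) : R := (1 + `|b|) ^+ m * N m * (gpdf z * (1 + `|z|) ^+ m).

Let sF z : [set: RR] z -> rsmooth (F z).
Proof. by move=> _; exact: rsmooth_scale_shift. Qed.

Let mF w x : measurable_fun [set: RR] (fun z : RR => rderivs w (F z) x).
Proof.
rewrite /F; under eq_fun do rewrite rderivs_scale_shift //.
apply: measurable_funM; first exact: measurable_gpdf.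
apply: measurable_line; apply: continuous_borel_fun.
by apply: rsmooth_continuous; exact: rsmooth_rderivs.
Qed.

Let bF m z : [set: RR] z -> rsb m m (g m z) (F z).
Proof.
move=> _ w x wm; rewrite /F rderivs_scale_shift // normrM (ger0_norm (gpdf_ge0 z)).
rewrite mulrCA (_ : g m z = gpdf z * ((1 + `|z|) ^+ m * ((1 + `|b|) ^+ m * N m))).
  by apply: ler_wpM2l; [exact: gpdf_ge0|apply: rsb_shift wm => //; exact: bf].
rewrite /g; ring.
Qed.

Let ig m : leb.-integrable [set: RR] (EFin \o g m).
Proof. by apply: integrable_mulrl => //; exact: integrable_gpdf_moment. Qed.

Lemma rderivs_gavg w : rderivs w (gavg b f) = gavg b (rderivs w f).
Proof.
rewrite -[gavg b f]/(average leb setT F) (rderivs_average measurableT sF mF bF ig).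
apply/funext => x; apply: eq_Rintegral => z _.
by rewrite /F rderivs_scale_shift.
Qed.

Lemma rsmooth_gavg : rsmooth (gavg b f).
Proof. exact: (rsmooth_average measurableT sF mF bF ig). Qed.

Lemma rsb_gavg m : rsb m m (gmoment m * (1 + `|b|) ^+ m * N m) (gavg b f).
Proof.
have := rsb_average measurableT sF mF bF ig (m := m).
rewrite /g RintegralZl //; last exact: integrable_gpdf_moment.
by rewrite mulrC mulrA.
Qed.

End fixed.

Lemma rschwartz_bound f : rschwartz f -> exists N, forall m, rsb m m (N m) f.
Proof.
move=> [_ /(_ _)/cid bf]; exists (fun m => projT1 (bf m)) => m.
exact: projT2 (bf m).
Qed.

Lemma rschwartz_gavg b f : rschwartz f -> rschwartz (gavg b f).
Proof.
move=> Sf; have [N bN] := rschwartz_bound Sf; split; first exact: rsmooth_gavg Sf.1 bN.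
move=> m; exists (gmoment m * (1 + `|b|) ^+ m * N m).
by apply: rsb_gavg; [exact: Sf.1|exact: bN].
Qed.

Lemma gmoment_ge1 m : 1 <= gmoment m.
Proof.
rewrite -[leLHS](@Rintegral_gpdf R) /gmoment; apply: le_Rintegral => //.
- have := @integrable_gpdf_moment R 0.
  by under eq_fun do rewrite expr0 mulr1.
- exact: integrable_gpdf_moment.
- move=> z _; rewrite ler_peMr ?gpdf_ge0 //.
  by rewrite exprn_ege1 // lerDl.
Qed.

(* The average of f(x+zb) only sees the even part of its Taylor polynomial. *)
Definition kappa : R := \int[leb]_z (gpdf z * z ^+ 2) / 2.

(** The moments of order 1 and 3 vanish, so the Taylor polynomial of degree 3 contributes only the
    two subtracted terms, and the remainder has order |b|^4. Moving the weight from x to x + c b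
    costs (1 + |z|)^m (1 + |b|)^m; with the factor |z|^4 of the remainder this produces
    [gmoment (m + 4)]. *)
Lemma gavg_taylor f b m (N : R) x : rschwartz f -> rsb m 4 N f ->
  omega x ^+ m * `|gavg b f x - f x - kappa * ddir b (ddir b f) x| <=
  gmoment (m + 4) * ((1 + `|b|) ^+ m * (n%:R * `|b|) ^+ 4 * N).
Proof.
move=> Sf bf; have sf := Sf.1.
pose G k := iter k (ddir b) f.
have sG k : rsmooth (G k).
  by elim: k => [|k IH]; [exact: sf|exact: rsmooth_ddir].
have bG : rsb m 0 ((n%:R * `|b|) ^+ 4 * N) (G 4%N).
  have b1 := rsb_ddir b (sG 0%N) bf.
  have b2 := rsb_ddir b (sG 1%N) b1.
  have b3 := rsb_ddir b (sG 2%N) b2.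
  have b4 := rsb_ddir b (sG 3%N) b3.
  by rewrite !exprS expr0 mulr1 -!mulrA; rewrite -!mulrA in b4.
pose K := (1 + `|b|) ^+ m * ((n%:R * `|b|) ^+ 4 * N).
pose T z := \sum_(j < 4) G j x * (z ^+ j / j`!%:R).
have pt z : omega x ^+ m * `|f (x + z *: b) - T z| <= K * (1 + `|z|) ^+ (m + 4).
  have o0 : 0 < omega x ^+ m by rewrite exprn_gt0 // omega_gt0.
  have N0 : 0 <= N by apply: le_trans (bf [::] 0 isT); rewrite mulr_ge0 ?exprn_ge0 ?omega_ge0.
  have K0 : 0 <= K by rewrite !mulr_ge0 // ?exprn_ge0 // ?addr_ge0 // mulr_ge0.
  have dG k (t : R) : is_derive t (1 : R) (fun t => G k (x + t *: b)) (G k.+1 (x + t *: b)).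
    exact: rsmooth_line.
  have bd c : `|c| <= `|z| -> `|G 4%N (x + c *: b)| <= (1 + `|z|) ^+ m * K / omega x ^+ m.
    move=> cz; rewrite ler_pdivlMr // mulrC.
    apply: (le_trans (rsb_shift (w := [::]) c b (sG 4%N) bG x isT)).
    rewrite /K; apply: ler_wpM2r => //.
    by apply: lerXn2r; rewrite ?nnegrE ?addr_ge0 // lerD2l.
  have := taylor_bound dG bd.
  under eq_bigr do rewrite scale0r addr0.
  rewrite -/(T z) => h; rewrite mulrC -ler_pdivlMr //.
  apply: (le_trans h); rewrite exprD mulrAC ler_pM2r ?invr_gt0 //.
  rewrite (mulrC _ K) -mulrA; apply: ler_wpM2l => //.
  apply: ler_wpM2l; first by rewrite exprn_ge0 // addr_ge0.
  by apply: lerXn2r; rewrite ?nnegrE ?addr_ge0 // lerDr.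
have [C bC] := rschwartz_bborel Sf.
have igz k : leb.-integrable [set: RR] (EFin \o (fun z : RR => gpdf z * z ^+ k)).
  apply: (@integrable_gpdf_poly R k 1); first exact: measurable_funX.
  move=> z; rewrite mul1r normrX; apply: lerXn2r; rewrite ?nnegrE ?addr_ge0 //.
  by rewrite lerDr.
have eT z : gpdf z * T z = f x * (gpdf z * z ^+ 0) + G 1%N x * (gpdf z * z ^+ 1)
      + G 2%N x / 2 * (gpdf z * z ^+ 2) + G 3%N x / 6 * (gpdf z * z ^+ 3).
  rewrite /T !big_ord_recl big_ord0 /= /bump /=.
  rewrite -[(1 + (1 + (1 + 0)))%N]/3%N -[(1 + (1 + 0))%N]/2%N -[(1 + 0)%N]/1%N.
  rewrite (_ : 3`! = 6)%N // (_ : 2`! = 2)%N // (_ : 1`! = 1)%N // fact0.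
  move: (ddir b (ddir b (ddir b f)) x) (ddir b (ddir b f) x) (ddir b f x) (f x) (gpdf z).
  by move=> d3 d2 d1 d0 gz; field.
have [IT iT] : \int[leb]_z (gpdf z * T z) = f x + kappa * ddir b (ddir b f) x /\
    leb.-integrable [set: RR] (EFin \o (fun z : RR => gpdf z * T z)).
  have i0 : leb.-integrable [set: RR] (EFin \o (fun z : RR => f x * (gpdf z * z ^+ 0))).
    exact: integrable_mulrl.
  have i1 : leb.-integrable [set: RR] (EFin \o (fun z : RR => G 1%N x * (gpdf z * z ^+ 1))).
    exact: integrable_mulrl.
  have i2 : leb.-integrable [set: RR] (EFin \o (fun z : RR => G 2%N x / 2 * (gpdf z * z ^+ 2))).
    exact: integrable_mulrl.
  have i3 : leb.-integrable [set: RR] (EFin \o (fun z : RR => G 3%N x / 6 * (gpdf z * z ^+ 3))).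
    exact: integrable_mulrl.
  split; last first.
    under eq_fun do rewrite eT.
    by do 3 apply: integrable_addr => //.
  transitivity (\int[leb]_z (f x * (gpdf z * z ^+ 0) + G 1%N x * (gpdf z * z ^+ 1)
      + G 2%N x / 2 * (gpdf z * z ^+ 2) + G 3%N x / 6 * (gpdf z * z ^+ 3))).
    by apply: eq_Rintegral => z _; exact: eT.
  rewrite RintegralD //; last first.
    by apply: integrable_addr => //; exact: integrable_addr.
  rewrite RintegralD //; last exact: integrable_addr.
  rewrite RintegralD // !RintegralZl //.
  rewrite (@gpdf_odd_moment R 1) // (@gpdf_odd_moment R 3) // (_ : \int[leb]_z (gpdf z * z ^+ 0) = 1); last first.
    by under eq_Rintegral do rewrite expr0 mulr1; exact: Rintegral_gpdf.
  rewrite /kappa -[G 2%N x]/(ddir b (ddir b f) x).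
  move: (ddir b (ddir b f) x) (G 1%N x) (G 3%N x) (f x) (\int[leb]_z (gpdf z * z ^+ 2)).
  by move=> d2 d1 d3 d0 I2; field.
have o0 : 0 < omega x ^+ m by rewrite exprn_gt0 // omega_gt0.
rewrite -addrA -opprD -IT mulrC -ler_pdivlMr //.
have iK : leb.-integrable [set: RR]
    (EFin \o (fun z : RR => K / omega x ^+ m * (gpdf z * (1 + `|z|) ^+ (m + 4)))).
  by apply: integrable_mulrl => //; exact: integrable_gpdf_moment.
apply: (le_trans (Rintegral_dist_le measurableT (integrable_gavg b x bC) iT iK _)).
  move=> z _; rewrite -mulrBr normrM (ger0_norm (gpdf_ge0 z)) [leRHS]mulrCA.
  apply: ler_wpM2l; first exact: gpdf_ge0.
  by rewrite mulrAC ler_pdivlMr // mulrC; exact: pt.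
rewrite RintegralZl //; last exact: integrable_gpdf_moment.
rewrite -/(gmoment _) -(mulrA _ _ N) -/K mulrAC (mulrC K).
exact: lexx.
Qed.

End GaussianAverage.

(** * Gaussian averages on the Schwartz space *)

Section SchwartzOperators.
Variables (R : realType) (n : nat).
Local Notation E := 'rV[R]_n.
Local Notation S := (schwartz R n).
Implicit Types (u v : S) (b : E) (i : 'I_n) (w : seq 'I_n) (N : 'M[R]_n).

Lemma schwartz_inj u v : (u : E -> R[i]) = v -> u = v.
Proof. exact: val_inj. Qed.

Lemma cReal_comb (c : R[i]) u v x :
  cReal (c *: u + v : S) x =
  complex.Re c * cReal u x + (- complex.Im c * cImag u x + cReal v x).
Proof.
rewrite -[schwartz_fun _]/(c *: (u : E -> R[i]) + (v : E -> R[i])) cReal_lin.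
by rewrite addrA.
Qed.

Lemma cImag_comb (c : R[i]) u v x :
  cImag (c *: u + v : S) x =
  complex.Re c * cImag u x + (complex.Im c * cReal u x + cImag v x).
Proof.
rewrite -[schwartz_fun _]/(c *: (u : E -> R[i]) + (v : E -> R[i])) cImag_lin.
by rewrite addrA.
Qed.

Lemma cRealZD (r : R) u v x : cReal (r%:C%C *: u + v : S) x = r * cReal u x + cReal v x.
Proof. by rewrite cReal_comb /= oppr0 mul0r add0r. Qed.

Lemma cImagZD (r : R) u v x : cImag (r%:C%C *: u + v : S) x = r * cImag u x + cImag v x.
Proof. by rewrite cImag_comb /= mul0r add0r. Qed.

Lemma cReal0 x : cReal (0 : S) x = 0. Proof. by []. Qed.
Lemma cImag0 x : cImag (0 : S) x = 0. Proof. by []. Qed.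

Lemma cRealZ (r : R) u x : cReal (r%:C%C *: u : S) x = r * cReal u x.
Proof. by rewrite -[_ *: u]addr0 cRealZD cReal0 addr0. Qed.

Lemma cImagZ (r : R) u x : cImag (r%:C%C *: u : S) x = r * cImag u x.
Proof. by rewrite -[_ *: u]addr0 cImagZD cImag0 addr0. Qed.

Lemma cRealD u v x : cReal (u + v : S) x = cReal u x + cReal v x.
Proof. by have := cRealZD 1 u v x; rewrite mul1r scale1r. Qed.

Lemma cImagD u v x : cImag (u + v : S) x = cImag u x + cImag v x.
Proof. by have := cImagZD 1 u v x; rewrite mul1r scale1r. Qed.

Lemma cRealN u x : cReal (- u : S) x = - cReal u x.
Proof. by apply/eqP; rewrite -addr_eq0 -cRealD addNr. Qed.

Lemma cImagN u x : cImag (- u : S) x = - cImag u x.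
Proof. by apply/eqP; rewrite -addr_eq0 -cImagD addNr. Qed.

Lemma cReal_sum (I : Type) (r : seq I) (F : I -> S) x :
  cReal (\sum_(j <- r) F j) x = \sum_(j <- r) cReal (F j) x.
Proof. by elim: r => [|j r IH]; rewrite ?big_nil ?cReal0 // !big_cons cRealD IH. Qed.

Lemma cImag_sum (I : Type) (r : seq I) (F : I -> S) x :
  cImag (\sum_(j <- r) F j) x = \sum_(j <- r) cImag (F j) x.
Proof. by elim: r => [|j r IH]; rewrite ?big_nil ?cImag0 // !big_cons cImagD IH. Qed.

HB.instance Definition _ w := GRing.isLinear.Build R[i] S S _ (spartial w) (spartial_lin w).

Lemma spartial_spartial w w' v : spartial w (spartial w' v) = spartial (w ++ w') v.
Proof.
by apply: schwartz_inj; rewrite !spartialE /pderivs foldr_cat.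
Qed.

Lemma spartial_perm w w' v : perm_eq w w' -> spartial w v = spartial w' v.
Proof.
by move=> p; apply: schwartz_inj; rewrite !spartialE (pderivs_perm (schwartz_smooth v) p).
Qed.

Lemma spartialC w w' v : spartial w (spartial w' v) = spartial w' (spartial w v).
Proof. by rewrite !spartial_spartial; apply: spartial_perm; rewrite perm_catC. Qed.

Definition sgavg b v : S :=
  schwartz_pair (rschwartz_gavg b (rschwartz_cReal v)) (rschwartz_gavg b (rschwartz_cImag v)).

Lemma gavg_lin (k : R) b (F G : E -> R) C C' x : bborel F C -> bborel G C' ->
  gavg b (fun x => k * F x + G x) x = k * gavg b F x + gavg b G x.
Proof.
move=> bF bG; have bkF : bborel (fun x => k * F x) (`|k| * C).
  split; last by move=> y; rewrite normrM ler_wpM2l // bF.2.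
  by move=> d T g mg; apply: measurable_funM => //; exact: bF.1.
rewrite (gavgD _ _ bkF bG); congr (_ + _); rewrite /gavg.
under eq_Rintegral do rewrite mulrCA.
by rewrite RintegralZl //; exact: integrable_gavg bF.
Qed.

Lemma bborel_cReal v : exists C, bborel (cReal v) C.
Proof. exact/rschwartz_bborel/rschwartz_cReal. Qed.

Lemma bborel_cImag v : exists C, bborel (cImag v) C.
Proof. exact/rschwartz_bborel/rschwartz_cImag. Qed.

Lemma sgavg_lin b : linear (sgavg b).
Proof.
move=> c u v; have [Cr bur] := bborel_cReal u; have [Ci bui] := bborel_cImag u.
have [Dr bvr] := bborel_cReal v; have [Di bvi] := bborel_cImag v.
have bI (k : R) (F G : E -> R) C C' : bborel F C -> bborel G C' ->
    bborel (fun x => k * F x + G x) (`|k| * C + C').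
  move=> bF bG; apply: bborelD bG; split; last by move=> y; rewrite normrM ler_wpM2l // bF.2.
  by move=> d T g mg; apply: measurable_funM => //; exact: bF.1.
apply: schwartz_eqP => x.
  rewrite cReal_comb.
  rewrite -[LHS]/(gavg b (cReal (c *: u + v : S)) x).
  rewrite (_ : cReal _ = fun x => complex.Re c * cReal u x + (- complex.Im c * cImag u x + cReal v x)); last first.
    by apply/funext => y; exact: cReal_comb.
  by rewrite (gavg_lin _ _ _ bur (bI (- complex.Im c) _ _ _ _ bui bvr)) (gavg_lin _ _ _ bui bvr).
rewrite cImag_comb.
rewrite -[LHS]/(gavg b (cImag (c *: u + v : S)) x).
rewrite (_ : cImag _ = fun x => complex.Re c * cImag u x + (complex.Im c * cReal u x + cImag v x)); last first.
  by apply/funext => y; exact: cImag_comb.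
by rewrite (gavg_lin _ _ _ bui (bI (complex.Im c) _ _ _ _ bur bvi)) (gavg_lin _ _ _ bur bvi).
Qed.

HB.instance Definition _ b := GRing.isLinear.Build R[i] S S _ (sgavg b) (sgavg_lin b).

Lemma spartial_sgavg w b v : spartial w (sgavg b v) = sgavg b (spartial w v).
Proof.
have [sr _] := rschwartz_cReal v; have [si _] := rschwartz_cImag v.
apply: schwartz_eqP => x.
  exact: (congr1 (fun f => f x) (rderivs_gavg b sr (fun m => @rsb_cReal R n m v) w)).
exact: (congr1 (fun f => f x) (rderivs_gavg b si (fun m => @rsb_cImag R n m v) w)).
Qed.

Lemma snorm_sgavg m b v :
  snorm m (sgavg b v) <= 2 * gmoment R m * (1 + `|b|) ^+ m * snorm m v.
Proof.
have [sr _] := rschwartz_cReal v; have [si _] := rschwartz_cImag v.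
have h1 := @rsb_gavg R n b _ _ sr (fun m => @rsb_cReal R n m v) m.
have h2 := @rsb_gavg R n b _ _ si (fun m => @rsb_cImag R n m v) m.
apply: (le_trans (@snorm_le_rsb R n m (sgavg b v) _ _ h1 h2)).
rewrite le_eqVlt; apply/orP; left; apply/eqP; ring.
Qed.

Lemma sgavg_comm b c v : sgavg b (sgavg c v) = sgavg c (sgavg b v).
Proof.
have [Cr br] := bborel_cReal v; have [Ci bi] := bborel_cImag v.
apply: schwartz_eqP => x; first exact: (gavg_comm b c x br).
exact: (gavg_comm b c x bi).
Qed.

Lemma sgavg_parallel b (p q r : R) v : 0 <= p -> 0 <= q -> 0 <= r ->
  r ^+ 2 = p ^+ 2 + q ^+ 2 -> sgavg (p *: b) (sgavg (q *: b) v) = sgavg (r *: b) v.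
Proof.
move=> p0 q0 r0 e; have [Cr br] := bborel_cReal v; have [Ci bi] := bborel_cImag v.
apply: schwartz_eqP => x; first exact: (gavg_parallel b x br).
exact: (gavg_parallel b x bi).
Qed.

Lemma sgavg0 v : sgavg 0 v = v.
Proof. by apply: schwartz_eqP => x; exact: gavg0. Qed.

(** With N = [kappa R *: a t] this is the generator of the evolution at time t. *)
Definition slap N v : S := \sum_i \sum_j (N i j)%:C%C *: spartial [:: i; j] v.

Lemma slap_lin N : linear (slap N).
Proof.
move=> c u v; rewrite /slap scaler_sumr -big_split; apply: eq_bigr => i _ /=.
rewrite scaler_sumr -big_split; apply: eq_bigr => j _ /=.
by rewrite linearP scalerDr !scalerA mulrC.
Qed.

HB.instance Definition _ N := GRing.isLinear.Build R[i] S S _ (slap N) (slap_lin N).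

Lemma slap_linl (r : R) N N' v : slap (r *: N + N') v = r%:C%C *: slap N v + slap N' v.
Proof.
rewrite /slap scaler_sumr -big_split; apply: eq_bigr => i _ /=.
rewrite scaler_sumr -big_split; apply: eq_bigr => j _ /=.
by rewrite !mxE rmorphD rmorphM scalerDl scalerA.
Qed.

Lemma slap0l v : slap 0 v = 0.
Proof.
by rewrite /slap big1 // => i _; rewrite big1 // => j _; rewrite mxE scale0r.
Qed.

Lemma slapDl N N' v : slap (N + N') v = slap N v + slap N' v.
Proof. by have := slap_linl 1 N N' v; rewrite !scale1r. Qed.

Lemma slapZl (r : R) N v : slap (r *: N) v = r%:C%C *: slap N v.
Proof. by have := slap_linl r N 0 v; rewrite slap0l !addr0. Qed.

Definition mxsum N : R := \sum_i \sum_j `|N i j|.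

Lemma mxsum_ge0 N : 0 <= mxsum N.
Proof. by apply: sumr_ge0 => i _; apply: sumr_ge0. Qed.

Lemma snorm_slap m N v : snorm m (slap N v) <= mxsum N * snorm (m + 2) v.
Proof.
apply: (le_trans (snorm_sum _ _ _ _)); rewrite /mxsum mulr_suml.
apply: ler_sum => i _; apply: (le_trans (snorm_sum _ _ _ _)); rewrite mulr_suml.
apply: ler_sum => j _; apply: (le_trans (snormZr _ _ _)).
by apply: ler_wpM2l => //; exact: snorm_spartial.
Qed.

Lemma spartial_slap w N v : spartial w (slap N v) = slap N (spartial w v).
Proof.
rewrite /slap linear_sum; apply: eq_bigr => i _; rewrite linear_sum.
by apply: eq_bigr => j _; rewrite linearZ /= spartialC.
Qed.

Lemma slap_rank1 (s : R) b (f : E -> R) x : rsmooth f ->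
  \sum_i \sum_j (s *: (b^T *m b)) i j * rderivs [:: i; j] f x = s * ddir b (ddir b f) x.
Proof.
move=> sf; rewrite {1}/ddir mulr_sumr; apply: eq_bigr => i _.
have -> : 'D_(delta_mx 0 i) (ddir b f) x = \sum_j b 0 j * rderivs [:: i; j] f x.
  exact: (congr1 (fun g => g x) (rderivs_sum (index_enum 'I_n) (b 0) [:: i] (fun j => rsmooth_rderivs [:: j] sf))).
rewrite !mulr_sumr; apply: eq_bigr => j _.
by rewrite !mxE big_ord1 !mxE; ring.
Qed.

(** The error of the second-order expansion of the average. It commutes with derivatives, so the
    pointwise bound of [gavg_taylor], applied to each derivative of v, yields every Schwartz
    norm. *)
Definition gdefect b v : S := sgavg b v - v - slap (kappa R *: (b^T *m b)) v.

Lemma spartial_gdefect w b v : spartial w (gdefect b v) = gdefect b (spartial w v).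
Proof. by rewrite /gdefect !linearB /= spartial_sgavg spartial_slap. Qed.

Lemma cReal_gdefect b v x : cReal (gdefect b v) x =
  gavg b (cReal v) x - cReal v x - kappa R * ddir b (ddir b (cReal v)) x.
Proof.
have [sr _] := rschwartz_cReal v.
rewrite /gdefect !cRealD !cRealN; congr (_ - _ - _).
rewrite -slap_rank1 // /slap cReal_sum; apply: eq_bigr => i _.
by rewrite cReal_sum; apply: eq_bigr => j _; rewrite cRealZ.
Qed.

Lemma cImag_gdefect b v x : cImag (gdefect b v) x =
  gavg b (cImag v) x - cImag v x - kappa R * ddir b (ddir b (cImag v)) x.
Proof.
have [sr _] := rschwartz_cImag v.
rewrite /gdefect !cImagD !cImagN; congr (_ - _ - _).
rewrite -slap_rank1 // /slap cImag_sum; apply: eq_bigr => i _.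
by rewrite cImag_sum; apply: eq_bigr => j _; rewrite cImagZ.
Qed.

Definition gdefect_cst m : R := 2 * gmoment R (m + 4) * n%:R ^+ 4.

Lemma snorm_gdefect m b v :
  snorm m (gdefect b v) <= gdefect_cst m * (1 + `|b|) ^+ m * `|b| ^+ 4 * snorm (m + 4) v.
Proof.
apply: snorm_le => w x wm; rewrite -spartialE spartial_gdefect.
set u := spartial w v.
have lift4 (f : E -> R) : rsb (m + 4) (m + 4) (snorm (m + 4) v) f ->
    rsb m 4 (snorm (m + 4) v) (rderivs w f).
  move=> bf; apply: rsb_rderivs; apply: rsb_le bf => //; first exact: leq_addr.
  by rewrite addnC leq_add2r.
have h1 := gavg_taylor b x (rschwartz_cReal u) (lift4 _ (@rsb_cReal R n (m + 4) v)).
have h2 := gavg_taylor b x (rschwartz_cImag u) (lift4 _ (@rsb_cImag R n (m + 4) v)).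
rewrite -cReal_gdefect in h1; rewrite -cImag_gdefect in h2.
apply: (@le_trans _ _ (omega x ^+ m * (`|cReal (gdefect b u) x| + `|cImag (gdefect b u) x|))).
  apply: ler_wpM2l; first by rewrite exprn_ge0 // omega_ge0.
  by rewrite /cReal /cImag; case: (schwartz_fun (gdefect b u) x) => p q; exact: normc_le.
rewrite mulrDr; apply: (le_trans (lerD h1 h2)).
rewrite exprMn /gdefect_cst le_eqVlt; apply/orP; left; apply/eqP; ring.
Qed.

End SchwartzOperators.

(** * Iterated Gaussian averages *)

(** Linear identities with real coefficients are checked at each point, on real and imaginary parts
    separately. *)
Ltac schwartz_ring := apply: schwartz_eqP => ?;
  rewrite ?(cRealD, cRealN, cRealZ, cReal0, cImagD, cImagN, cImagZ, cImag0); ring.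

Section IteratedAverages.
Variables (R : realType) (n : nat).
Local Notation E := 'rV[R]_n.
Local Notation S := (schwartz R n).
Implicit Types (u v : S) (b : E) (l : seq E) (m k : nat).

Definition havg l v : S := foldr (@sgavg R n) v l.

(** Half the covariance of the random vector sum z_b b, with independent z_b of density [gpdf]. For
    a list that represents W(s, t) it is A(t) - A(s). *)
Definition cov l : 'M[R]_n := \sum_(b <- l) b^T *m b.

(** A measure of elapsed time: it is at most the trace of [cov l], hence O(t - s) for the lists of
    the evolution. *)
Definition rho l : R := \sum_(b <- l) `|b| ^+ 2.

Lemma rho_ge0 l : 0 <= rho l.
Proof. by apply: sumr_ge0 => b _; exact: sqr_ge0. Qed.

Lemma havg_lin l : linear (havg l).
Proof.
move=> c u v; elim: l => [//|b l IH] /=.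
by rewrite -!/(havg l _) IH linearP.
Qed.

HB.instance Definition _ l := GRing.isLinear.Build R[i] S S _ (havg l) (havg_lin l).

Lemma havg_cat l l' v : havg (l ++ l') v = havg l (havg l' v).
Proof. by rewrite /havg foldr_cat. Qed.

Lemma sgavg_havg b l v : sgavg b (havg l v) = havg l (sgavg b v).
Proof. by elim: l => [//|c l IH] /=; rewrite sgavg_comm -!/(havg l _) IH. Qed.

Definition avg_cst m (B : R) : R := 2 * gmoment R m * (1 + B) ^+ m.

Lemma avg_cst_ge1 m B : 0 <= B -> 1 <= avg_cst m B.
Proof.
move=> B0; rewrite /avg_cst.
have h1 : 1 <= 2 * gmoment R m.
  by rewrite (le_trans (gmoment_ge1 R m)) // ler_peMl ?ler1n // (le_trans _ (gmoment_ge1 R m)).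
apply: (le_trans h1); rewrite ler_peMr //; first exact: le_trans h1.
by rewrite exprn_ege1 // lerDl.
Qed.

Lemma snorm_sgavg_le m B b v : `|b| <= B -> snorm m (sgavg b v) <= avg_cst m B * snorm m v.
Proof.
move=> bB; apply: (le_trans (snorm_sgavg m b v)); apply: ler_wpM2r; first exact: snorm_ge0.
apply: ler_wpM2l; first by rewrite mulr_ge0 // (le_trans _ (gmoment_ge1 R m)).
have B0 : 0 <= B by exact: le_trans bB.
by apply: lerXn2r; rewrite ?nnegrE ?addr_ge0 // lerD2l.
Qed.

(** The bound has to be the same for all lists of length at most k with vectors of norm at most B.
    As [avg_cst] is at least 1, its power [size l] may be raised to k. *)
Lemma snorm_havg m k B l v : (size l <= k)%N -> (forall b, b \in l -> `|b| <= B) -> 0 <= B ->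
  snorm m (havg l v) <= avg_cst m B ^+ k * snorm m v.
Proof.
move=> lk lB B0; have c1 := avg_cst_ge1 m B0; have c0 := le_trans ler01 c1.
apply: (@le_trans _ _ (avg_cst m B ^+ size l * snorm m v)); last first.
  by apply: ler_wpM2r; [exact: snorm_ge0|exact: ler_weXn2l].
elim: l lB {lk} => [|b l IH] lB /=; first by rewrite expr0 mul1r.
apply: (le_trans (snorm_sgavg_le m (havg l v) (lB b (mem_head _ _)))).
rewrite exprS -mulrA; apply: ler_wpM2l => //; apply: IH => c cl.
by apply: lB; rewrite in_cons cl orbT.
Qed.

Lemma mxsum_rank1 b : mxsum (kappa R *: (b^T *m b)) <= `|kappa R| * n%:R ^+ 2 * `|b| ^+ 2.
Proof.
rewrite /mxsum (_ : _ * _ * _ = \sum_(i < n) \sum_(j < n) `|kappa R| * `|b| ^+ 2); last first.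
  by rewrite !sumr_const !card_ord -[RHS]mulr_natl -[X in _ = _ * X]mulr_natl; ring.
apply: ler_sum => i _; apply: ler_sum => j _.
rewrite !mxE big_ord1 !mxE !normrM ler_wpM2l // expr2.
by apply: ler_pM => //; exact: coord_le_norm.
Qed.

Lemma mxsumD (M N : 'M[R]_n) : mxsum (M + N) <= mxsum M + mxsum N.
Proof.
rewrite /mxsum -big_split; apply: ler_sum => i _; rewrite -big_split.
by apply: ler_sum => j _; rewrite mxE ler_normD.
Qed.

Lemma mxsum0 : mxsum (0 : 'M[R]_n) = 0.
Proof. by rewrite /mxsum big1 // => i _; rewrite big1 // => j _; rewrite mxE normr0. Qed.

Lemma mxsum_cov l : mxsum (kappa R *: cov l) <= `|kappa R| * n%:R ^+ 2 * rho l.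
Proof.
rewrite /cov /rho; elim: l => [|b l IH].
  by rewrite !big_nil scaler0 mxsum0 mulr0.
rewrite !big_cons scalerDr mulrDr; apply: (le_trans (mxsumD _ _)).
by apply: lerD => //; exact: mxsum_rank1.
Qed.

(** The defect is of order |b|^4, hence at most a multiple of B^2 |b|^2, and the rank one operator
    is of order |b|^2. The index m + 4 is that of the defect. *)
Lemma sgavg_sub_le m B : 0 <= B -> exists2 C : R, 0 <= C & forall b v, `|b| <= B ->
  snorm m (sgavg b v - v) <= C * `|b| ^+ 2 * snorm (m + 4) v.
Proof.
move=> B0.
have g0 k : 0 <= gmoment R k by exact: le_trans (gmoment_ge1 R k).
have c0 : 0 <= gdefect_cst R n m by rewrite /gdefect_cst !mulr_ge0 // exprn_ge0.
have := @snorm_gdefect R n m; move: (gdefect_cst R n m) c0 => G c0 hG.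
exists (G * (1 + B) ^+ m * B ^+ 2 + `|kappa R| * n%:R ^+ 2).
  by rewrite addr_ge0 ?mulr_ge0 ?exprn_ge0 ?addr_ge0.
move=> b v bB.
have -> : sgavg b v - v = gdefect b v + slap (kappa R *: (b^T *m b)) v.
  by rewrite /gdefect subrK.
apply: (le_trans (snormD _ _ _)); rewrite mulrDl mulrDl; apply: lerD.
  apply: (le_trans (hG _ _)); apply: ler_wpM2r; first exact: snorm_ge0.
  rewrite -!mulrA ler_wpM2l // (_ : `|b| ^+ 4 = `|b| ^+ 2 * `|b| ^+ 2); last by ring.
  rewrite ler_pM ?exprn_ge0 ?addr_ge0 ?mulr_ge0 //.
    by apply: lerXn2r; rewrite ?nnegrE ?addr_ge0 // lerD2l.
  by rewrite mulrA -expr2 ler_wpM2r ?sqr_ge0 //; apply: lerXn2r; rewrite ?nnegrE.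
apply: (le_trans (snorm_slap _ _ _)); apply: ler_pM.
- exact: mxsum_ge0.
- exact: snorm_ge0.
- exact: mxsum_rank1.
- by apply: snorm_mono; rewrite leq_add2l.
Qed.

Definition hdefect l v : S := havg l v - v - slap (kappa R *: cov l) v.

(** One more vector contributes the averaged old defect, its own defect, and a cross term that tells
    how far the average along b is from the identity on the second-order term of l. *)
Lemma hdefect_cons b l v : hdefect (b :: l) v = sgavg b (hdefect l v) + gdefect b v
  + (sgavg b (slap (kappa R *: cov l) v) - slap (kappa R *: cov l) v).
Proof.
rewrite /hdefect /gdefect /= -/(havg l v) /cov big_cons scalerDr slapDl.
rewrite -!/(cov l) !linearB /=.
move: (slap (kappa R *: cov l) v) (slap (kappa R *: (b^T *m b)) v) => p q.
move: (sgavg b p) (sgavg b (havg l v)) (sgavg b v) => p' h' v'.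
by schwartz_ring.
Qed.

(** The three terms of [hdefect_cons] have sizes rho^2, |b|^4 and |b|^2 rho, with rho taken on the
    tail, and each is at most (|b|^2 + rho)^2. The index m + 6 comes from the cross term: 4 for the
    increment of one average and 2 for the second-order operator inside. *)
Lemma snorm_hdefect m k B : 0 <= B -> exists2 C : R, 0 <= C & forall l v,
  (size l <= k)%N -> (forall b, b \in l -> `|b| <= B) ->
  snorm m (hdefect l v) <= C * rho l ^+ 2 * snorm (m + 6) v.
Proof.
move=> B0; have [C1 C10 h1] := sgavg_sub_le m B0.
have A1 := avg_cst_ge1 m B0; have A0 := le_trans ler01 A1.
have g0 j : 0 <= gmoment R j by exact: le_trans (gmoment_ge1 R j).
have c0 : 0 <= gdefect_cst R n m * (1 + B) ^+ m.
  by rewrite /gdefect_cst !mulr_ge0 // exprn_ge0 // addr_ge0.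
have hG b v : `|b| <= B ->
    snorm m (gdefect b v) <= gdefect_cst R n m * (1 + B) ^+ m * `|b| ^+ 4 * snorm (m + 6) v.
  move=> bB; apply: (le_trans (snorm_gdefect m b v)).
  have G0 : 0 <= gdefect_cst R n m by rewrite /gdefect_cst !mulr_ge0 // exprn_ge0.
  apply: ler_pM; [by rewrite !mulr_ge0 ?exprn_ge0 ?addr_ge0|exact: snorm_ge0| |].
    rewrite ler_wpM2r ?exprn_ge0 // ler_wpM2l //.
    by apply: lerXn2r; rewrite ?nnegrE ?addr_ge0 // lerD2l.
  by apply: snorm_mono; rewrite leq_add2l.
move: (gdefect_cst R n m * (1 + B) ^+ m) c0 hG => G c0 hG.
pose K := `|kappa R| * n%:R ^+ 2.
have K0 : 0 <= K by rewrite mulr_ge0 // exprn_ge0.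
elim: k => [|k [C C0 IH]].
  exists 0 => // l v; rewrite leqn0 size_eq0 => /eqP -> _.
  rewrite /hdefect /= subrr /cov big_nil scaler0 slap0l subrr snorm0.
  by rewrite !mul0r.
exists (avg_cst m B * C + G + C1 * K).
  by rewrite !addr_ge0 // mulr_ge0.
move=> [|b l] v lk lB.
  rewrite /hdefect /= subrr /cov big_nil scaler0 slap0l subrr snorm0.
  apply: mulr_ge0; last exact: snorm_ge0.
  apply: mulr_ge0; last exact: sqr_ge0.
  by rewrite !addr_ge0 // mulr_ge0.
have bB := lB b (mem_head _ _).
have lB' c : c \in l -> `|c| <= B by move=> cl; apply: lB; rewrite in_cons cl orbT.
have s0 := snorm_ge0 (m + 6) v; have r0 := rho_ge0 l.
rewrite hdefect_cons.
have t1 : snorm m (sgavg b (hdefect l v)) <= avg_cst m B * C * rho l ^+ 2 * snorm (m + 6) v.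
  apply: (le_trans (snorm_sgavg_le m _ bB)).
  apply: (le_trans (ler_wpM2l A0 (IH l v lk lB'))).
  by rewrite (mulrA (avg_cst m B)) (mulrA (avg_cst m B)) lexx.
have t2 := hG b v bB.
have t3 : snorm m (sgavg b (slap (kappa R *: cov l) v) - slap (kappa R *: cov l) v) <=
    C1 * K * (`|b| ^+ 2 * rho l) * snorm (m + 6) v.
  apply: (le_trans (h1 b _ bB)).
  have hs := snorm_slap (m + 4) (kappa R *: cov l) v; rewrite -addnA in hs.
  have hs' := le_trans hs (ler_wpM2r s0 (mxsum_cov l)).
  rewrite -/K in hs'.
  apply: (le_trans (ler_wpM2l _ hs')); first by rewrite mulr_ge0 ?sqr_ge0.
  by rewrite le_eqVlt; apply/orP; left; apply/eqP; ring.
apply: (le_trans (snormD _ _ _)).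
apply: (le_trans (lerD (le_trans (snormD _ _ _) (lerD t1 t2)) t3)).
rewrite /rho big_cons -/(rho l) -!mulrDl; apply: ler_wpM2r => //.
have x0 : 0 <= `|b| ^+ 2 by exact: sqr_ge0.
rewrite (_ : `|b| ^+ 4 = `|b| ^+ 2 ^+ 2); last by rewrite -exprM.
move: (`|b| ^+ 2) (rho l) x0 r0 => x r x0 r0.
have xr : 0 <= x * r by exact: mulr_ge0.
have A2 : 0 <= avg_cst m B * C by exact: mulr_ge0.
have A3 : 0 <= C1 * K by exact: mulr_ge0.
move: (avg_cst m B * C) (C1 * K) A2 A3 => p q p0 q0.
have h2 (y z : R) : 0 <= y -> z <= (x + r) ^+ 2 -> y * z <= y * (x + r) ^+ 2.
  by move=> y0; apply: ler_wpM2l.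
rewrite !mulrDl; apply: lerD; [apply: lerD|]; apply: h2 => //.
- by apply: lerXn2r; rewrite ?nnegrE ?addr_ge0 // lerDr.
- by apply: lerXn2r; rewrite ?nnegrE ?addr_ge0 // lerDl.
- by rewrite sqrrD; have := sqr_ge0 x; have := sqr_ge0 r; rewrite mulr2n; lra.
Qed.

Definition hscale (s : R) l : seq E := [seq s *: b | b <- l].

(** Scaling all vectors by sqrt tau runs the flow of l for a fraction tau of the time, and the
    Pythagorean relation is additivity in time. Commutation of the averages lets the rule for one
    vector be applied to each. *)
Lemma havg_parallel l (p q r : R) v : 0 <= p -> 0 <= q -> 0 <= r ->
  r ^+ 2 = p ^+ 2 + q ^+ 2 ->
  havg (hscale r l) v = havg (hscale p l) (havg (hscale q l) v).
Proof.
move=> p0 q0 r0 e; elim: l => [//|b l IH] /=.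
rewrite -!/(havg _ _) -!/(hscale _ _) IH -(sgavg_parallel b _ p0 q0 r0 e).
by rewrite (sgavg_havg (q *: b)).
Qed.

Lemma cov_hscale s l : cov (hscale s l) = s ^+ 2 *: cov l.
Proof.
rewrite /cov big_map scaler_sumr; apply: eq_bigr => b _.
by rewrite [(s *: b)^T]linearZ /= -scalemxAl -scalemxAr scalerA expr2.
Qed.

Lemma rho_hscale s l : rho (hscale s l) = s ^+ 2 * rho l.
Proof.
rewrite /rho big_map mulr_sumr; apply: eq_bigr => b _.
by rewrite normrZ exprMn real_normK ?num_real.
Qed.

Lemma hscale1 l : hscale 1 l = l.
Proof. by rewrite /hscale -[RHS]map_id; apply: eq_map => b; exact: scale1r. Qed.

Lemma havg_hscale0 l v : havg (hscale 0 l) v = v.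
Proof. by elim: l => [//|b l IH] /=; rewrite scale0r sgavg0; exact: IH. Qed.

Lemma norm_bound_seq l : exists2 B : R, 0 <= B & forall b, b \in l -> `|b| <= B.
Proof.
exists (\sum_(b <- l) `|b|); first exact: sumr_ge0.
move=> b bl; rewrite (big_rem b) //= lerDl; exact: sumr_ge0.
Qed.

Lemma mem_hscale s l B b : 0 <= s <= 1 -> (forall b, b \in l -> `|b| <= B) ->
  b \in hscale s l -> `|b| <= B.
Proof.
move=> /andP[s0 s1] lB /mapP[c cl ->]; rewrite normrZ ger0_norm //.
by apply: le_trans (lB c cl); rewrite ler_piMl.
Qed.

(* Interpolating between the two lists, tau |-> havg (sqrt tau l) (havg (sqrt (1 - tau) l') v)
   is constant: its increments are quadratic in the time step, because both
   families have the same generator. *)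
Lemma havg_cov l l' v : cov l = cov l' -> havg l v = havg l' v.
Proof.
move=> ll'.
have [B1 B10 lB1] := norm_bound_seq l; have [B2 B20 lB2] := norm_bound_seq l'.
pose B := B1 + B2; have B0 : 0 <= B by exact: addr_ge0.
have lB b : b \in l -> `|b| <= B by move=> /lB1 h; apply: le_trans h _; rewrite lerDl.
have lB' b : b \in l' -> `|b| <= B by move=> /lB2 h; apply: le_trans h _; rewrite lerDr.
pose k := maxn (size l) (size l').
have lk : (size l <= k)%N by exact: leq_maxl.
have lk' : (size l' <= k)%N by exact: leq_maxr.
have [C C0 hC] := snorm_hdefect 0 k B0.
pose Q (t : R) := havg (hscale (Num.sqrt t) l) (havg (hscale (Num.sqrt (1 - t)) l') v).
pose r := rho l ^+ 2 + rho l' ^+ 2.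
(* From left to right: stability of the outer average, the defects of both lists over one step, and
   growth of the norm of order 6 under the inner average. *)
pose D := avg_cst 0 B ^+ k * (C * r * (avg_cst 6 B ^+ k * snorm 6 v)).
have A0 m : 0 <= avg_cst m B by exact: le_trans (avg_cst_ge1 m B0).
have s01 (t : R) : 0 <= t <= 1 -> 0 <= Num.sqrt t <= 1.
  by move=> /andP[t0 t1]; rewrite sqrtr_ge0 -[leRHS]sqrtr1 ler_wsqrtr.
have step (t e : R) : 0 <= t -> 0 <= e -> t + e <= 1 ->
    snorm 0 (Q (t + e) - Q t) <= D * e ^+ 2.
  move=> t0 e0 te.
  have te0 : 0 <= t + e by exact: addr_ge0.
  have te1 : 0 <= 1 - (t + e) by rewrite subr_ge0.
  have t1 : 0 <= 1 - t by rewrite (le_trans te1) // lerD2l lerN2 lerDl.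
  pose g := havg (hscale (Num.sqrt (1 - (t + e))) l') v.
  have q1 : Q (t + e) = havg (hscale (Num.sqrt t) l) (havg (hscale (Num.sqrt e) l) g).
    by rewrite /Q; apply: havg_parallel; rewrite ?sqrtr_ge0 // !sqr_sqrtr.
  have q2 : Q t = havg (hscale (Num.sqrt t) l) (havg (hscale (Num.sqrt e) l') g).
    rewrite /Q; congr havg; apply: havg_parallel; rewrite ?sqrtr_ge0 // !sqr_sqrtr //; ring.
  have tt : 0 <= t <= 1 by rewrite t0 (le_trans _ te) // lerDl.
  have ee : 0 <= e <= 1 by rewrite e0 (le_trans _ te) // lerDr.
  have te' : 0 <= 1 - (t + e) <= 1 by rewrite te1 lerBlDr lerDl.
  have covs : cov (hscale (Num.sqrt e) l) = cov (hscale (Num.sqrt e) l').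
    by rewrite !cov_hscale ll'.
  (* Equal covariances make the second-order terms of the two steps coincide, so only the defects
     survive. *)
  have -> : Q (t + e) - Q t = havg (hscale (Num.sqrt t) l)
     (hdefect (hscale (Num.sqrt e) l) g - hdefect (hscale (Num.sqrt e) l') g).
    rewrite q1 q2 -linearB /=; congr havg; rewrite /hdefect covs.
    move: (slap _ g) (havg _ g) (havg _ g) => p1 p2 p3.
    by schwartz_ring.
  have h0 := @snorm_havg 0 k B (hscale (Num.sqrt t) l)
    (hdefect (hscale (Num.sqrt e) l) g - hdefect (hscale (Num.sqrt e) l') g).
  apply: (le_trans (h0 _ (fun b => mem_hscale (s01 t tt) lB) B0)); first by rewrite size_map.
  rewrite /D -mulrA; apply: ler_wpM2l; first exact: exprn_ge0.
  apply: (le_trans (snormB _ _ _)).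
  have d1 := hC (hscale (Num.sqrt e) l) g.
  have d2 := hC (hscale (Num.sqrt e) l') g.
  rewrite size_map in d1; rewrite size_map in d2.
  have d1' := d1 lk (fun b => mem_hscale (s01 e ee) lB).
  have d2' := d2 lk' (fun b => mem_hscale (s01 e ee) lB').
  apply: (le_trans (lerD d1' d2')); rewrite add0n !rho_hscale !sqr_sqrtr //.
  have hg : snorm 6 g <= avg_cst 6 B ^+ k * snorm 6 v.
    apply: snorm_havg; [by rewrite size_map|exact: (fun b => mem_hscale (s01 _ te') lB')|by []].
  rewrite -mulrDl (_ : C * (e * rho l) ^+ 2 + C * (e * rho l') ^+ 2 = C * r * e ^+ 2); last first.
    by rewrite /r; ring.
  rewrite mulrAC; apply: ler_wpM2r; first exact: sqr_ge0.
  by apply: ler_wpM2l => //; rewrite mulr_ge0 // addr_ge0 // sqr_ge0.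
have D0 : 0 <= D.
  rewrite /D !mulr_ge0 ?exprn_ge0 ?addr_ge0 ?sqr_ge0 ?snorm_ge0 //.
have tele (N j : nat) : (j <= N.+1)%N ->
    snorm 0 (Q (j%:R / N.+1%:R) - Q 0) <= j%:R * (D * (N.+1%:R^-1) ^+ 2).
  elim: j => [_|j IH jN]; first by rewrite !mul0r subrr snorm0.
  rewrite (_ : Q _ - Q 0 = (Q (j.+1%:R / N.+1%:R) - Q (j%:R / N.+1%:R)) +
     (Q (j%:R / N.+1%:R) - Q 0)); last by rewrite addrA subrK.
  apply: (le_trans (snormD _ _ _)); rewrite -[X in _ <= X * _]natr1.
  rewrite [leRHS]mulrDl mul1r [leLHS]addrC.
  apply: lerD; first exact: IH (ltnW jN).
  rewrite (_ : j.+1%:R / N.+1%:R = j%:R / N.+1%:R + N.+1%:R^-1); last by rewrite -natr1 mulrDl mul1r.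
  apply: step; rewrite ?divr_ge0 ?invr_ge0 //.
  by rewrite -[X in _ + X]mul1r -mulrDl natr1 ler_pdivrMr // mul1r ler_nat.
(* Averages along null vectors are trivial, so Q 1 and Q 0 are the two sides. Division into N + 1
   steps bounds their distance by D / (N + 1). *)
suff e : snorm 0 (Q 1 - Q 0) <= 0.
  have := snorm_eq0 e; rewrite /Q sqrtr1 subrr sqrtr0 subr0 sqrtr1 !hscale1 !havg_hscale0.
  by move/eqP; rewrite subr_eq0 => /eqP.
apply/ler_addgt0Pr => e e0; rewrite add0r.
have [N hN] : exists N : nat, D / e < N.+1%:R.
  exists (Num.truncn (D / e)); have := truncnS_gt (D / e); exact.
have := tele N N.+1 (leqnn _); rewrite divff // => h; apply: (le_trans h).
rewrite (_ : _ * (_ * _) = D / N.+1%:R); last by field.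
by rewrite ler_pdivrMr // mulrC -ler_pdivrMr // ltW.
Qed.

End IteratedAverages.

(** * The heat kernel as an iterated Gaussian average *)

Section Kernel.
Variable R : realType.
Local Notation leb := (@lebesgue_measure R).
Local Notation RR := (measurableTypeR R).

Definition gker n (M : 'M[R]_n) (x : 'rV[R]_n) : R :=
  (Num.sqrt ((4 * pi) ^+ n * \det M))^-1 *
  expR (- (4^-1 * (x *m invmx M *m x^T) 0 0)).

Definition gavgs n (l : seq 'rV[R]_n) (F : 'rV[R]_n -> R) : 'rV[R]_n -> R :=
  foldr (@gavg R n) F l.

Definition row_of n (t : n.-tuple RR) : 'rV[R]_n := \row_i tnth t i.

Lemma bborel_gavgs n (l : seq 'rV[R]_n) F C : bborel F C -> bborel (gavgs l F) C.
Proof. by move=> bF; elim: l => [//|b l IH] /=; exact: bborel_gavg. Qed.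

Lemma gavgs_ge0 n (l : seq 'rV[R]_n) F x : (forall x, 0 <= F x) -> 0 <= gavgs l F x.
Proof. by move=> F0; elim: l x => [//|b l IH] x /=; exact: gavg_ge0. Qed.

(** Vectors with vanishing first coordinate leave that coordinate frozen, which lets an induction on
    the dimension act on the remaining ones. *)
Lemma gavgs_row_mx0 n (l : seq 'rV[R]_n) (F : 'rV[R]_(1 + n) -> R) (y : 'rV[R]_1) (x : 'rV[R]_n) :
  gavgs [seq row_mx 0 c | c <- l] F (row_mx y x) = gavgs l (fun x => F (row_mx y x)) x.
Proof.
elim: l x => [//|c l IH] x /=; apply: eq_Rintegral => z _; congr (_ * _).
by rewrite scale_row_mx scaler0 add_row_mx addr0 IH.
Qed.

Lemma borel_gker n (M : 'M[R]_n) : borel_fun (gker M).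
Proof.
move=> d T g mg; apply: measurable_funM => //.
apply: measurableT_comp; first exact: measurable_expR.
apply: measurableT_comp => //; apply: measurable_funM => //.
rewrite (_ : (fun t => _) = fun t => \sum_j (\sum_i g i t * invmx M i j) * g j t); last first.
  apply/funext => t; rewrite !mxE; apply: eq_bigr => j _; rewrite !mxE.
  by congr (_ * _); apply: eq_bigr => i _; rewrite mxE.
apply: measurable_sum => j; apply: measurable_funM; last exact: mg.
by apply: measurable_sum => i; apply: measurable_funM => //; exact: mg.
Qed.

Lemma gker_ge0 n (M : 'M[R]_n) x : 0 <= gker M x.
Proof. by rewrite mulr_ge0 ?expR_ge0 // invr_ge0 sqrtr_ge0. Qed.

Lemma measurable_row_of n (F : 'rV[R]_n -> R) : borel_fun F ->
  measurable_fun [set: n.-tuple RR] (fun t => F (row_of t) : RR).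
Proof.
move=> bF; apply: borel_fun_comp => // i; rewrite /row_of.
by under eq_fun do rewrite mxE; exact: measurable_tnth.
Qed.

Lemma row_of_tcons n (p : RR * n.-tuple RR) :
  row_of (tcons p) = row_mx (p.1%:M : 'rV[R]_1) (row_of p.2) :> 'rV[R]_(1 + n).
Proof.
apply/rowP => i; rewrite mxE; case: (split_ordP i) => j ->.
  rewrite row_mxEl ord1 mxE eqxx mulr1n (_ : lshift n 0 = ord0) ?tnth0 //.
  exact: val_inj.
rewrite row_mxEr mxE (_ : rshift 1 j = lift ord0 j) ?tnthS //.
exact: val_inj.
Qed.

(** The measure on n + 1 coordinates is by construction the image of a product, to which Tonelli's
    theorem applies. *)
Lemma integral_lebesgue_tupleS n (f : n.+1.-tuple RR -> R) :
  measurable_fun [set: n.+1.-tuple RR] f -> (forall t, 0 <= f t) ->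
  (\int[lebesgue_tuple n.+1]_t (f t)%:E =
   \int[leb]_y \int[lebesgue_tuple n]_t (f (tcons (y, t)))%:E)%E.
Proof.
move=> mf f0; have mEf : measurable_fun [set: n.+1.-tuple RR] (EFin \o f).
  exact/measurable_EFinP.
have Ef0 (t : n.+1.-tuple RR) : (0 <= (EFin \o f) t)%E by rewrite /= lee_fin.
have := ge0_integral_pushforward (@measurable_tcons R n) (leb \x lebesgue_tuple n)%E
  (measurableT : measurable [set: n.+1.-tuple RR]) mEf (fun t _ => Ef0 t).
rewrite preimage_setT => e.
transitivity (\int[(leb \x lebesgue_tuple n)%E]_p (f (tcons p))%:E)%E.
  apply: etrans e; apply: (@eq_measure_integral _ _ _ _
    (measure_function_pushforward__canonical__measure_function_Measure
      (leb \x lebesgue_tuple n)%E (@measurable_tcons R n))) => A _ _.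
  by [].
rewrite fubini_tonelli1 //; last by move=> p; exact: Ef0.
apply/measurable_EFinP; apply: (measurableT_comp mf); exact: measurable_tcons.
Qed.

(** * Schur complement of the first diagonal entry *)

Section Schur.
Variables (n : nat) (M : 'M[R]_(1 + n)).
Hypothesis sM : spd_mx M.

Let b : 'rV[R]_n := ursubmx M.
Let a : R := M 0 0.

Lemma spd_corner : 0 < a.
Proof.
have [_ pM] := sM.
have e0 : delta_mx 0 0 != 0 :> 'rV[R]_(1 + n).
  by apply/eqP => /rowP/(_ 0); rewrite !mxE !eqxx => /eqP; rewrite oner_eq0.
by have := pM _ e0; rewrite -rowE trmx_delta -colE !mxE.
Qed.

Definition schur : 'M[R]_n := drsubmx M - a^-1 *: (b^T *m b).

Lemma spd_block : M = block_mx (a%:M : 'M[R]_1) b b^T (schur + a^-1 *: (b^T *m b)).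
Proof.
rewrite -[LHS]submxK /schur subrK; congr block_mx.
- apply/matrixP => i j; rewrite !ord1 !mxE eqxx mulr1n /a; congr (M _ _); exact: val_inj.
- by rewrite /b trmx_ursub sM.1.
Qed.

(** Completing the square in the first coordinate. *)
Lemma spd_schur_quad (z : R) (y : 'rV[R]_n) :
  let x := row_mx (z%:M : 'rV[R]_1) y in
  (x *m M *m x^T) 0 0 = a * (z + a^-1 * (y *m b^T) 0 0) ^+ 2 + (y *m schur *m y^T) 0 0.
Proof.
have a0 : a != 0 by rewrite gt_eqF // spd_corner.
rewrite /= [in LHS]spd_block; move: schur => N.
have yb : b *m y^T = (y *m b^T)^T by rewrite trmx_mul trmxK.
have e1 : y *m (a^-1 *: (b^T *m b)) *m y^T = a^-1 *: ((y *m b^T) *m (y *m b^T)^T).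
  by rewrite -yb -scalemxAr -scalemxAl !mulmxA.
rewrite mul_row_block tr_row_mx mul_row_col tr_scalar_mx !mul_scalar_mx mul_mx_scalar.
rewrite [y *m (N + _)]mulmxDr mulmxDl mulmxDl e1 -scalemxAl yb.
move: (y *m b^T) (y *m N *m y^T) => c e.
rewrite !mxE big_ord1 !mxE ?eqxx ?mulr1n.
by field.
Qed.

Lemma spd_schur : spd_mx schur.
Proof.
split.
  rewrite /schur linearB /= linearZ /= trmx_mul trmxK; congr (_ - _).
  by rewrite trmx_drsub sM.1.
move=> y y0; have [_ pM] := sM; have a0 : a != 0 by rewrite gt_eqF // spd_corner.
(* This z makes the square vanish, so the form of M at (z, y) is the form of the Schur complement at
   y. *)
pose z := - (a^-1 * (y *m b^T) 0 0).
have x0 : row_mx (z%:M : 'rV[R]_1) y != 0 :> 'rV[R]_(1 + n).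
  by rewrite row_mx_eq0 (negbTE y0) andbF.
have := pM _ x0; have /= -> := spd_schur_quad z y.
by rewrite /z addNr expr0n /= mulr0 add0r.
Qed.

(** Block elimination: the left factor is lower triangular with unit diagonal. *)
Lemma det_schur : \det M = a * \det schur.
Proof.
have a0 : a != 0 by rewrite gt_eqF // spd_corner.
have -> : M = block_mx (1%:M : 'M[R]_1) 0 (a^-1 *: b^T) 1%:M *m block_mx a%:M b 0 schur.
  rewrite mulmx_block !mul1mx !mul0mx !addr0 -scalemxAl mul_mx_scalar scalerA mulVf //.
  by rewrite scale1r -scalemxAl addrC; exact: spd_block.
by rewrite det_mulmx det_lblock det_ublock !det1 !mul1r det_scalar1.
Qed.

End Schur.

Lemma spd_det_gt0 n (M : 'M[R]_n) : spd_mx M -> 0 < \det M.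
Proof.
elim: n M => [|n IH] M sM; first by rewrite det_mx00.
by rewrite (det_schur (n := n) sM) mulr_gt0 ?(spd_corner (n := n) sM) // IH //; exact: spd_schur.
Qed.

Lemma spd_unitmx n (M : 'M[R]_n) : spd_mx M -> M \in unitmx.
Proof. by move=> /spd_det_gt0 d0; rewrite unitmxE unitfE gt_eqF. Qed.

(** The dual completion of the square: Z = (z1, z') solves Z M = X by back substitution, and the
    form of the inverse is Z X^T. *)
Lemma spd_inv_quad n (M : 'M[R]_(1 + n)) (sM : spd_mx M) (x1 : R) (x : 'rV[R]_n) :
  let a := M 0 0 in let X := row_mx (x1%:M : 'rV[R]_1) x in
  let q := x - (x1 / a) *: ursubmx M in
  (X *m invmx M *m X^T) 0 0 = x1 ^+ 2 / a + (q *m invmx (schur M) *m q^T) 0 0.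
Proof.
move=> a X q; have a0 : a != 0 by rewrite gt_eqF // (spd_corner sM).
pose b : 'rV[R]_n := ursubmx M.
pose z' := q *m invmx (schur M).
pose z1 := (x1 - (z' *m b^T) 0 0) / a.
have uM := spd_unitmx sM; have uS := spd_unitmx (spd_schur sM).
have ZM : row_mx (z1%:M : 'rV[R]_1) z' *m M = X.
  rewrite [in LHS](spd_block sM) mul_row_block; congr row_mx.
    apply/matrixP => i j; rewrite !ord1 mul_scalar_mx !mxE eqxx !mulr1n.
    rewrite -/b -[\sum_k _]/((\sum_k z' 0 k * b^T k 0)).
    have -> : \sum_j z' 0 j * b^T j 0 = (z' *m b^T) 0 0 by rewrite mxE.
    by rewrite -/a /z1 divfK // subrK.
  rewrite mul_scalar_mx mulmxDr /z' mulmxKV // -/z' -scalemxAr mulmxA -/b -/a.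
  have -> : z' *m b^T = ((z' *m b^T) 0 0)%:M by apply/matrixP => i j; rewrite !ord1 [RHS]mxE eqxx mulr1n.
  rewrite mul_scalar_mx scalerA addrCA -scalerDl /q /z1 -/b.
  by rewrite mulrBl (mulrC a^-1) subrK subrK.
have -> : X *m invmx M = row_mx z1%:M z' by rewrite -ZM mulmxK.
rewrite /X tr_row_mx mul_row_col tr_scalar_mx -scalar_mxM [LHS]mxE mxE eqxx mulr1n.
have -> : q^T = x^T - (x1 / a) *: b^T by rewrite /q linearB /= linearZ.
have sub (A B : 'M[R]_1) : (A - B) 0 0 = A 0 0 - B 0 0 by rewrite !mxE.
have scl (k : R) (A : 'M[R]_1) : (k *: A) 0 0 = k * A 0 0 by rewrite !mxE.
rewrite mulmxBr -scalemxAr -/z' sub scl /z1.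
move: ((z' *m b^T) 0 0) ((z' *m x^T) 0 0) => p r.
by field.
Qed.

(** A Gaussian density factors into the marginal of its first coordinate, of scale d, and the
    conditional density of the others, whose centre is proportional to x1. *)
Lemma gker_schur n (M : 'M[R]_(1 + n)) (sM : spd_mx M) (x1 : R) (x : 'rV[R]_n) :
  let d := Num.sqrt (M 0 0) in
  gker M (row_mx (x1%:M : 'rV[R]_1) x) = d^-1 * gpdf (x1 / d) *
    gker (schur M) (x - (x1 / d) *: (d^-1 *: ursubmx M)).
Proof.
move=> d; have a0 := spd_corner sM.
have d0 : 0 < d by rewrite sqrtr_gt0.
have dd : d ^+ 2 = M 0 0 by rewrite sqr_sqrtr // ltW.
rewrite /gker (spd_inv_quad sM) (det_schur sM) -dd.
rewrite scalerA -(mulrA x1) -invfM -expr2.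
have -> : Num.sqrt ((4 * pi) ^+ (1 + n) * (d ^+ 2 * \det (schur M))) =
   Num.sqrt (4 * pi) * d * Num.sqrt ((4 * pi) ^+ n * \det (schur M)).
  have p0 : 0 <= 4 * pi :> R by rewrite mulr_ge0 // pi_ge0.
  rewrite exprD expr1 mulrACA sqrtrM; last by rewrite mulr_ge0 // sqr_ge0.
  rewrite sqrtrM // sqrtr_sqr gtr0_norm //.
rewrite /gpdf (mulrDr 4^-1 (x1 ^+ 2 / d ^+ 2)) (opprD (4^-1 * (x1 ^+ 2 / d ^+ 2))) expRD.
rewrite (invfM (Num.sqrt (4 * pi) * d)) (invfM (Num.sqrt (4 * pi))).
rewrite (_ : 4^-1 * (x1 ^+ 2 / d ^+ 2) = (x1 / d) ^+ 2 / 4); last by rewrite expr_div_n mulrC.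
move: (expR _) (expR _) (Num.sqrt _)^-1 (Num.sqrt _)^-1 => e1 e2 s1 s2; ring.
Qed.

(** One step of the Cholesky factorisation: the list consists of the rows of the upper triangular
    factor. *)
Lemma cov_schur n (M : 'M[R]_(1 + n)) (l : seq 'rV[R]_n) : spd_mx M -> cov l = schur M ->
  let d := Num.sqrt (M 0 0) in
  cov (row_mx (d%:M : 'rV[R]_1) (d^-1 *: ursubmx M) ::
       [seq row_mx (0 : 'rV[R]_1) c | c <- l]) = M.
Proof.
move=> sM cl d; have a0 := spd_corner sM.
have d0 : 0 < d by rewrite sqrtr_gt0.
have dd : d ^+ 2 = M 0 0 by rewrite sqr_sqrtr // ltW.
rewrite /cov big_cons big_map /=.
have -> : \sum_(c <- l) (row_mx (0 : 'rV[R]_1) c)^T *m row_mx 0 c =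
    block_mx (0 : 'M[R]_1) 0 0 (cov l).
  rewrite /cov; elim: (l) => [|c s IHs]; first by rewrite !big_nil block_mx0.
  rewrite !big_cons IHs tr_row_mx mul_col_row trmx0 !mul0mx mulmx0.
  by rewrite add_block_mx !addr0.
rewrite cl tr_row_mx mul_col_row add_block_mx !addr0.
rewrite [RHS](spd_block sM); congr block_mx.
+ by rewrite tr_scalar_mx -scalar_mxM -expr2 dd.
+ by rewrite tr_scalar_mx mul_scalar_mx scalerA divff ?gt_eqF // scale1r.
+ by rewrite mul_mx_scalar linearZ /= scalerA divff ?gt_eqF // scale1r.
+ by rewrite addrC [(d^-1 *: _)^T]linearZ /= -scalemxAl -scalemxAr scalerA -invfM -expr2 dd.
Qed.

Lemma row_mx_shift n (x1 y : R) (x' z : 'rV[R]_n) :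
  row_mx (x1%:M : 'rV[R]_1) x' - row_mx (y%:M : 'rV[R]_1) z =
  row_mx ((x1 - y)%:M : 'rV[R]_1) (x' - z).
Proof. by rewrite opp_row_mx add_row_mx raddfB. Qed.

Lemma row_mx_axpy n (x1 z d : R) (x' r : 'rV[R]_n) :
  row_mx (x1%:M : 'rV[R]_1) x' + z *: row_mx (d%:M : 'rV[R]_1) r =
  row_mx ((x1 + z * d)%:M : 'rV[R]_1) (x' + z *: r).
Proof. by rewrite scale_row_mx add_row_mx scale_scalar_mx raddfD. Qed.

(** Induction on the dimension. By [gker_schur] the integral over the last n coordinates is the
    average for the Schur complement, and what is left in the first coordinate is a one-dimensional
    average along the new vector b0. Nonnegativity of F keeps everything within Tonelli's
    theorem. *)
Lemma gker_average n (M : 'M[R]_n) : spd_mx M -> exists l : seq 'rV[R]_n,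
  [/\ size l = n, cov l = M & forall F C, (forall x, 0 <= F x) -> bborel F C -> forall x,
    (\int[lebesgue_tuple n]_t (gker M (x - row_of t) * F (row_of t))%:E =
      (gavgs l F x)%:E)%E].
Proof.
elim: n M => [|n IH] M sM.
  exists [::]; split => //; first by apply/matrixP => -[].
  move=> F C F0 bF x; rewrite /= integral_dirac //; last first.
    apply/measurable_EFinP; apply: measurable_funM; last exact: measurable_row_of bF.1.
    by rewrite (_ : (fun _ => _) = cst (gker M x)) //; apply/funext => t; congr gker; apply/rowP => -[].
  rewrite diracT mul1e; congr EFin.
  rewrite (_ : row_of [tuple] = x); last by apply/rowP => -[].
  rewrite /gker det_mx00 expr0 mulr1 sqrtr1 invr1 mul1r !mxE big1 ?mulr0 ?oppr0 ?expR0 ?mul1r //.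
  by move=> [].
have [l' [sl' cl' hl']] := IH _ (spd_schur (n := n) sM).
pose d := Num.sqrt (M 0 0); have a0 := spd_corner (n := n) sM.
have d0 : 0 < d by rewrite sqrtr_gt0.
have dd : d ^+ 2 = M 0 0 by rewrite sqr_sqrtr // ltW.
pose r : 'rV[R]_n := d^-1 *: (ursubmx (M : 'M[R]_(1 + n))).
pose b0 : 'rV[R]_(1 + n) := row_mx (d%:M : 'rV[R]_1) r.
exists (b0 :: [seq (row_mx (0 : 'rV[R]_1) c : 'rV[R]_(1 + n)) | c <- l']); split.
- by rewrite /= size_map sl'.
- exact: (cov_schur (n := n) sM cl').
move=> F C F0 bF x.
pose x1 : R := (lsubmx (x : 'rV[R]_(1 + n))) 0 0.
pose x' : 'rV[R]_n := rsubmx (x : 'rV[R]_(1 + n)).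
have xE : x = row_mx (x1%:M : 'rV[R]_1) x' :> 'rV[R]_(1 + n).
  rewrite -[LHS](@hsubmxK _ _ 1 n); congr row_mx.
  by apply/matrixP => i j; rewrite !ord1 [RHS]mxE eqxx mulr1n.
pose G : 'rV[R]_(1 + n) -> R := fun y => gker M (x - y) * F y.
have bG : borel_fun G.
  move=> dd' T g mg; apply: measurable_funM; last exact: bF.1.
  apply: borel_fun_comp; first exact: borel_gker.
  move=> i; under eq_fun do rewrite !mxE.
  by apply: measurable_funB => //; exact: mg.
rewrite (@integral_lebesgue_tupleS n (fun t => G (row_of t))); first last.
- by move=> t; rewrite mulr_ge0 ?gker_ge0.
- exact: measurable_row_of.
pose P := gavgs [seq (row_mx (0 : 'rV[R]_1) c : 'rV[R]_(1 + n)) | c <- l'] F.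
have bP : bborel P C by exact: bborel_gavgs.
have P0 y : 0 <= P y by exact: gavgs_ge0.
pose H (y : R) : R := d^-1 * gpdf ((x1 - y) / d) *
  P (row_mx (y%:M : 'rV[R]_1) (x' - ((x1 - y) / d) *: r)).
have inner (y : R) : (\int[lebesgue_tuple n]_t (G (row_of (tcons (y, t))))%:E = (H y)%:E)%E.
  have bFy : bborel (fun z => F (row_mx (y%:M : 'rV[R]_1) z)) C.
    split; last by move=> z; exact: bF.2.
    move=> dd' T g mg; apply: borel_fun_comp; first exact: bF.1.
    move=> i; case: (split_ordP i) => j ->.
      by under eq_fun do rewrite row_mxEl; exact: measurable_cst.
    by under eq_fun do rewrite row_mxEr mxE; exact: mg.
  have c0 : 0 <= d^-1 * gpdf ((x1 - y) / d) by rewrite mulr_ge0 ?gpdf_ge0 // invr_ge0 ltW.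
  rewrite /H EFinM /P gavgs_row_mx0 -(hl' _ C _ bFy); last by move=> z; exact: F0.
  rewrite -ge0_integralZl_EFin //; first last.
  + apply/measurable_EFinP; apply: measurable_funM; last exact: measurable_row_of bFy.1.
    apply: (@measurable_row_of n (fun z => gker (schur M) (x' - (x1 - y) / d *: r - z))).
    move=> dd' T g mg; apply: borel_fun_comp; first exact: borel_gker.
    move=> i; under eq_fun do rewrite !mxE.
    by apply: measurable_funB => //; exact: mg.
  + by move=> t _; rewrite lee_fin mulr_ge0 ?gker_ge0.
  apply: eq_integral => t _; rewrite -EFinM; congr EFin; rewrite /G row_of_tcons mulrA.
  congr (_ * _).
  have -> : x - row_mx (y%:M : 'rV[R]_1) (row_of t) =
    row_mx ((x1 - y)%:M : 'rV[R]_1) (x' - row_of t) :> 'rV[R]_(1 + n).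
    by rewrite -row_mx_shift -xE.
  rewrite (gker_schur (n := n) sM).
  by rewrite -/d -/r (addrAC x').
under eq_integral do rewrite inner.
have mH : measurable_fun [set: RR] H.
  apply: measurable_funM.
    apply: measurable_funM => //; apply: (measurableT_comp (@measurable_gpdf R)).
    by apply: measurable_funM => //; exact: measurable_funB.
  apply: borel_fun_comp; first exact: bP.1.
  move=> i; case: (split_ordP i) => j ->.
    by under eq_fun do rewrite row_mxEl mxE ord1 eqxx mulr1n; exact: measurable_id.
  under eq_fun do rewrite row_mxEr !mxE.
  apply: measurable_funB => //; apply: measurable_funM => //.
  by apply: measurable_funM => //; exact: measurable_funB.
have H0 y : 0 <= H y by rewrite /H !mulr_ge0 ?gpdf_ge0 // invr_ge0 ltW.
(* The substitution y = x1 + d z turns (x1 - y) / d into -z; as [gpdf] is even, the argument of P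
   becomes x + z b0. *)
rewrite (@ge0_integral_affine R H d x1) ?gt_eqF //= -/P -(gavgE b0 x bP) (gtr0_norm d0).
rewrite -ge0_integralZl_EFin //; first last.
- exact: ltW.
- apply/measurable_EFinP; apply: (measurableT_comp mH); exact: measurable_affine.
- by move=> z _; rewrite lee_fin.
apply: eq_integral => z _; rewrite -EFinM; congr EFin.
have ez : (x1 - (d * z + x1)) / d = - z by move: d0 => /lt0r_neq0 d1; field; exact: d1.
rewrite /H ez gpdfN !mulrA divff ?gt_eqF // mul1r; congr (_ * P _).
have -> : x + z *: b0 = row_mx ((x1 + z * d)%:M : 'rV[R]_1) (x' + z *: r) :> 'rV[R]_(1 + n).
  by rewrite -row_mx_axpy -xE.
by rewrite scaleNr opprK addrC (mulrC z d).
Qed.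

(** Both F + C and the constant C are nonnegative with finite integrals, so the identities for them
    may be subtracted. *)
Lemma gker_average_signed n (M : 'M[R]_n) (sM : spd_mx M) (l : seq 'rV[R]_n) :
  (forall F C, (forall x, 0 <= F x) -> bborel F C -> forall x,
    (\int[lebesgue_tuple n]_t (gker M (x - row_of t) * F (row_of t))%:E =
      (gavgs l F x)%:E)%E) ->
  forall F C x, bborel F C ->
    integral_Rn (fun y => gker M (x - y) * F y) = gavgs l F x.
Proof.
move=> h F C x bF0; have [bF F0] := bborel_shift bF0.
have C0 : 0 <= C by exact: le_trans (bF0.2 0).
have mG : borel_fun (fun y => gker M (x - y)).
  move=> d T g mg; apply: borel_fun_comp; first exact: borel_gker.
  move=> i; under eq_fun do rewrite !mxE.
  by apply: measurable_funB => //; exact: mg.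
have int G D : (forall x, 0 <= G x) -> bborel G D ->
    (lebesgue_tuple n).-integrable [set: n.-tuple RR]
      (EFin \o (fun t => gker M (x - row_of t) * G (row_of t))) /\
    \int[lebesgue_tuple n]_t (gker M (x - row_of t) * G (row_of t)) = gavgs l G x.
  move=> G0 bG; split; last by rewrite /Rintegral (h _ _ G0 bG).
  apply/integrableP; split.
    apply/measurable_EFinP; apply: measurable_funM; [exact: (measurable_row_of mG)|].
    exact: measurable_row_of bG.1.
  under eq_integral do rewrite /= ger0_norm ?mulr_ge0 ?gker_ge0 //.
  by rewrite (h _ _ G0 bG) ltry.
have [i1 e1] := int _ _ F0 bF.
have [i2 e2] := int (fun=> C) _ (fun=> C0) (bborel_cst n C).
have gc : gavgs l (fun=> C) x = C.
  elim: (l) x {i1 e1 i2 e2 int mG} => [//|b s IHs] x /=.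
  by rewrite -[RHS](gavg_cst C b x); apply: eq_Rintegral => z _; rewrite IHs.
have gs y : gavgs l (fun x => F x + C) y = gavgs l F y + C.
  elim: (l) y {h i1 e1 i2 e2 int gc} => [//|b s IHs] y /=.
  rewrite (_ : gavgs s _ = fun y => gavgs s F y + C); last exact/funext.
  by rewrite (gavgD _ _ (bborel_gavgs s bF0) (bborel_cst n C)) gavg_cst.
rewrite /integral_Rn -[RHS](addrK C) -gs -e1 -{2}gc -e2 -RintegralB //.
by apply: eq_Rintegral => t _; rewrite -mulrBr addrK.
Qed.

End Kernel.

(** * The primitive of the coefficient *)

Section HeatConvolution.
Variables (R : realType) (n : nat).
Local Notation S := (schwartz R n).
Local Notation E := 'rV[R]_n.

Lemma cReal_havg l (v : S) x : cReal (havg l v) x = gavgs l (cReal v) x.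
Proof.
elim: l x => [//|b l IH] x; rewrite /= -!/(havg l _) -/(gavgs l _).
rewrite -[LHS]/(gavg b (cReal (havg l v)) x).
by rewrite (_ : cReal (havg l v) = gavgs l (cReal v)) //; exact/funext.
Qed.

Lemma cImag_havg l (v : S) x : cImag (havg l v) x = gavgs l (cImag v) x.
Proof.
elim: l x => [//|b l IH] x; rewrite /= -!/(havg l _) -/(gavgs l _).
rewrite -[LHS]/(gavg b (cImag (havg l v)) x).
by rewrite (_ : cImag (havg l v) = gavgs l (cImag v)) //; exact/funext.
Qed.

Lemma convolution_real (k : E -> R) (v : E -> R[i]) x :
  convolution (fun x => (k x)%:C%C) v x =
  (integral_Rn (fun y => k (x - y) * cReal v y) +i*
   integral_Rn (fun y => k (x - y) * cImag v y))%C.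
Proof.
rewrite /convolution /cintegral_Rn; congr (_ +i* _)%C; congr integral_Rn; apply/funext => y;
  rewrite /cReal /cImag; case: (v y) => p q /=.
  by rewrite mul0r subr0.
by rewrite mul0r addr0.
Qed.

Lemma heat_average (M : 'M[R]_n) : spd_mx M -> exists l : seq E,
  [/\ size l = n, cov l = M &
     forall v : S, havg l v = convolution (fun x => (gker M x)%:C%C) v :> (E -> R[i])].
Proof.
move=> sM; have [l [sl cl hl]] := gker_average sM; exists l; split => // v.
have h := gker_average_signed sM hl.
apply/funext => x; rewrite convolution_real.
have [C1 b1] := bborel_cReal v; have [C2 b2] := bborel_cImag v.
by rewrite (h _ _ x b1) (h _ _ x b2) -cReal_havg -cImag_havg /cReal /cImag; case: (havg l v x).
Qed.

End HeatConvolution.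

(** * Functions continuous on the closed half-line *)

Section WithinHalfline.
Variables (R : realType) (V : normedModType R) (f : R -> V).
Hypothesis cf : {within `[0, +oo[, continuous f}.

Lemma continuous_segment a b : 0 <= a -> {within `[a, b], continuous f}.
Proof.
move=> a0; apply: continuous_subspaceW cf => x /=; rewrite !in_itv /= andbT => /andP[ax _].
exact: le_trans ax.
Qed.

Lemma bounded_segment b : exists2 C : R, 0 <= C & forall s, 0 <= s <= b -> `|f s| <= C.
Proof.
have c : compact (f @` `[0, b]) by apply: continuous_compact; [exact: continuous_segment|exact: segment_compact].
have [M [_ hM]] := compact_bounded c.
exists (`|M| + 1); first by rewrite addr_ge0.
move=> s sb; apply: hM; first by rewrite ltr_pwDr // ler_norm.
by exists s => //=; rewrite in_itv.
Qed.

Lemma within_delta (t e : R) : 0 <= t -> 0 < e ->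
  exists2 d : R, 0 < d & forall x, 0 <= x -> `|x - t| < d -> `|f x - f t| <= e.
Proof.
move=> t0 e0; have /subspace_continuousP/(_ t) := cf.
rewrite /= in_itv /= andbT t0 => /(_ isT)/cvgrPdist_le/(_ _ e0)/nbhs_ballP[d d0 hd].
exists d => // x x0 xt; rewrite distrC; apply: hd; last by rewrite /= in_itv /= andbT.
by rewrite /ball /= distrC.
Qed.

End WithinHalfline.

Section Primitive.
Variable R : realType.
Local Notation leb := (@lebesgue_measure R).
Variable f : R -> R.
Hypothesis cf : {within `[0, +oo[, continuous f}.

Let F (t : R) : R := \int[leb]_(s in `[0, t]) f s.

Lemma within_continuous_pos t : 0 < t -> {for t, continuous f}.
Proof.
move=> t0; have /subspace_continuousP/(_ t) := cf.
rewrite /= in_itv /= andbT (ltW t0) => /(_ isT).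
rewrite within_interior // /interior; near=> x; rewrite /= in_itv /= andbT; apply: ltW.
near: x; exact: lt_nbhsr.
Unshelve. all: by end_near. Qed.

Lemma integrable_segment a b : 0 <= a -> leb.-integrable `[a, b] (EFin \o f).
Proof.
by move=> a0; apply: continuous_compact_integrable; [exact: segment_compact|exact: continuous_segment].
Qed.

Lemma is_derive_primitive (t : R) : 0 < t -> is_derive t (1 : R) F (f t).
Proof.
move=> t0; have tt : t < t + 1 by rewrite ltrDl.
have [d e] := continuous_FTC1_closed tt (integrable_segment (t + 1) (lexx 0)) t0
  (within_continuous_pos t0).
by apply: (DeriveDef d); rewrite -derive1E; exact: e.
Qed.

Lemma continuous_primitive a b : 0 <= a -> {within `[a, b], continuous F}.
Proof.
move=> a0; have [ab|ba] := leP a b; last first.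
  by rewrite set_itv_ge ?bnd_simp -?ltNge //; exact: continuous_subspace0.
apply: (@continuous_subspaceW _ _ _ `[0, b]).
  by move=> x /=; rewrite !in_itv /= => /andP[ax ->]; rewrite (le_trans a0 ax).
by apply: parameterized_integral_continuous; [exact: le_trans ab|exact: integrable_segment].
Qed.

End Primitive.

(** * Increments of the primitive matrix *)

Section Coefficient.
Variables (R : realType) (n : nat) (a : R -> 'M[R]_n).
Hypothesis ha : heat_coefficient a.
Local Notation A := (primitive_mx a).
Local Notation E := 'rV[R]_n.

Lemma coef_within : {within `[0, +oo[, continuous a}. Proof. by have [] := ha. Qed.

Lemma coef_entry_within i j : {within `[0, +oo[, continuous (fun s => a s i j)}.
Proof.
move=> x; apply: (@continuous_comp (subspace _) _ _ a (fun M : 'M[R]_n => M i j)).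
  exact: coef_within.
exact: coord_continuous.
Qed.

(** The Frobenius pairing. A mean value theorem for all linear functionals of A serves the quadratic
    forms (c = x^T x) and the entries (c a matrix unit). *)
Definition mxpair (c M : 'M[R]_n) : R := \sum_i \sum_j c i j * M i j.

(** The mean value theorem uses derivatives inside ]s, t[ and continuity up to the ends, which
    admits s = 0. *)
Lemma primitive_mvt c s t : 0 <= s -> s < t ->
  exists2 xi, s < xi < t & mxpair c (A t) - mxpair c (A s) = mxpair c (a xi) * (t - s).
Proof.
move=> s0 st.
pose F i j : R -> R := fun t => \int[@lebesgue_measure R]_(s in `[0, t]) a s i j.
pose G (t : R) : R := \sum_i \sum_j c i j * F i j t.
have GE t' : mxpair c (A t') = G t'.
  by apply: eq_bigr => i _; apply: eq_bigr => j _; rewrite mxE.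
rewrite !GE.
have [|x|xi xst ->] := @MVT R G (fun t => mxpair c (a t)) s t st.
- move=> x; rewrite in_itv /= => /andP[sx _].
  rewrite (_ : G = \sum_i \sum_j (c i j \*: F i j)); last first.
    apply/funext => y; rewrite fct_sumE; apply: eq_bigr => i _.
    by rewrite fct_sumE; apply: eq_bigr.
  apply: is_derive_sum => i; apply: is_derive_sum => j; apply: is_deriveZ.
  apply: is_derive_primitive; [exact: coef_entry_within|exact: le_lt_trans sx].
- apply: (cvg_big add_continuous) => i _; apply: (cvg_big add_continuous) => j _.
  apply: cvgM; first exact: cvg_cst.
  have := @continuous_primitive R _ (@coef_entry_within i j) s t s0 x; exact.
- by exists xi; rewrite // -in_itv.
Qed.

Lemma mxpair_quad (x : E) M : mxpair (x^T *m x) M = (x *m M *m x^T) 0 0.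
Proof.
rewrite /mxpair exchange_big mxE; apply: eq_bigr => j _; rewrite !mxE mulr_suml.
by apply: eq_bigr => i _; rewrite !mxE big_ord1 !mxE mulrAC.
Qed.

Lemma mxpair_delta i j M : mxpair (delta_mx i j) M = M i j.
Proof.
rewrite /mxpair (bigD1 i) //= (bigD1 j) //= !mxE !eqxx mul1r.
rewrite big1 => [|k kj]; last by rewrite mxE (negbTE kj) andbF mul0r.
rewrite big1 ?addr0 // => k ki; rewrite big1 // => l _.
by rewrite mxE (negbTE ki) mul0r.
Qed.

(** Each quadratic form of the increment is t - s times that of some a(xi), where xi depends on the
    vector. *)
Lemma primitive_spd s t : 0 <= s -> s < t -> spd_mx (A t - A s).
Proof.
move=> s0 st; have [_ _ _ sa] := ha; split.
  rewrite linearB /=; congr (_ - _); apply/matrixP => i j; rewrite !mxE;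
    apply: eq_Rintegral => r; rewrite inE /= in_itv /= => /andP[r0 _];
    by rewrite -[in LHS](sa r r0).1 mxE.
move=> x x0; have [xi /andP[sx _] e] := primitive_mvt (x^T *m x) s0 st.
rewrite mulmxBr mulmxBl [X in 0 < X]mxE [X in _ + X]mxE -!mxpair_quad e.
rewrite mulr_gt0 ?subr_gt0 // mxpair_quad; apply: (sa _ _).2 => //.
exact: ltW (le_lt_trans s0 sx).
Qed.

Lemma primitive_entry_mvt i j s t : 0 <= s -> s < t ->
  exists2 xi, s < xi < t & A t i j - A s i j = a xi i j * (t - s).
Proof.
move=> s0 st; have [xi sxt e] := primitive_mvt (delta_mx i j) s0 st.
by exists xi; rewrite -?[LHS](mxpair_delta i j) // -!(mxpair_delta i j).
Qed.

Lemma entry_le_norm (M : 'M[R]_n) i j : `|M i j| <= `|M|.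
Proof. by rewrite [leRHS]mx_normrE; exact: (le_bigmax _ _ (i, j)). Qed.

Lemma primitive_lipschitz b : exists2 C, 0 <= C & forall s t i j, 0 <= s -> s <= t -> t <= b ->
  `|A t i j - A s i j| <= C * (t - s).
Proof.
have [C C0 hC] := bounded_segment coef_within b; exists C => // s t i j s0.
rewrite le_eqVlt => /predU1P[->|st tb]; first by rewrite !subrr normr0 mulr0.
have [xi /andP[sx xt] ->] := primitive_entry_mvt i j s0 st.
rewrite normrM (gtr0_norm (_ : 0 < t - s)) ?subr_gt0 // ler_wpM2r ?subr_ge0 ?(ltW st) //.
apply: (le_trans (entry_le_norm _ _ _)); apply: hC.
by rewrite (ltW (le_lt_trans s0 sx)) (ltW (lt_le_trans xt tb)).
Qed.

(** Strong differentiability, with both end points moving near r; r = 0 is covered. This is the form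
    that [mild_strong_derive] consumes. *)
Lemma primitive_strong_derive (r e : R) : 0 <= r -> 0 < e ->
  exists2 d : R, 0 < d & forall s t, 0 <= s -> s <= t -> `|s - r| < d -> `|t - r| < d ->
    mxsum (A t - A s - (t - s) *: a r) <= e * (t - s).
Proof.
move=> r0 e0; have k0 : 0 < n%:R * n%:R + 1 :> R by rewrite ltr_wpDl // mulr_ge0.
have [d d0 hd] := within_delta coef_within r0 (divr_gt0 e0 k0).
exists d => // s t s0; rewrite le_eqVlt => /predU1P[->|st sr tr].
  by rewrite !subrr scale0r subr0 mxsum0 mulr0.
have st0 : 0 < t - s by rewrite subr_gt0.
apply: (@le_trans _ _ (\sum_(i < n) \sum_(j < n) e / (n%:R * n%:R + 1) * (t - s))).
  apply: ler_sum => i _; apply: ler_sum => j _; rewrite !mxE.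
  have := primitive_entry_mvt i j s0 st; rewrite !mxE => -[xi /andP[sx xt] ->].
  rewrite (mulrC (t - s)) -mulrBl normrM (gtr0_norm st0) ler_pM2r //.
  apply: (@le_trans _ _ `|a xi - a r|).
    by have := entry_le_norm (a xi - a r) i j; rewrite !mxE.
  apply: hd; first exact: ltW (le_lt_trans s0 sx).
  move: sr tr; rewrite !ltr_norml => /andP[h1 h2] /andP[h3 h4]; apply/andP; split; lra.
set q := e / _ * _; rewrite sumr_const sumr_const !card_ord -[q *+ n]mulr_natl -[(_ * q) *+ n]mulr_natl mulrA {}/q.
move: (n%:R * n%:R) k0 => k k0.
rewrite mulrA ler_wpM2r ?(ltW st0) //.
by rewrite mulrA ler_pdivrMr // mulrC ler_pM2l // lerDl.
Qed.

(** Lists are chosen once for all pairs of times. The empty list serves s = t, where [heat_operator]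
    is the identity, and the pairs outside the domain. *)
Lemma heat_semigroup_lists : exists L : R -> R -> seq E, forall s t, 0 <= s -> s <= t ->
  [/\ (size (L s t) <= n)%N, cov (L s t) = A t - A s &
    forall v : schwartz R n, havg (L s t) v = heat_operator a s t v :> (E -> R[i])].
Proof.
pose P (p : R * R) l := 0 <= p.1 -> p.1 <= p.2 ->
  [/\ (size l <= n)%N, cov l = A p.2 - A p.1 &
    forall v : schwartz R n, havg l v = heat_operator a p.1 p.2 v :> (E -> R[i])].
have [|L hL] := @choice _ _ P; last by exists (fun s t => L (s, t)) => s t; exact: (hL (s, t)).
move=> [s t]; have [s0|s0] := boolP (0 <= s); last by exists [::]; rewrite /P /= (negbTE s0).
have [st|ts|<-] := ltgtP s t; last 2 first.
- by exists [::]; rewrite /P /= (leNgt s t) ts.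
- exists [::] => _ _; split => //; first by rewrite /cov big_nil subrr.
  by move=> v; rewrite /heat_operator eqxx.
have [l [sl cl hl]] := heat_average (primitive_spd s0 st).
exists l => _ _; split => //; first by rewrite sl.
by move=> v; rewrite /heat_operator (lt_eqF st); exact: hl.
Qed.

End Coefficient.

(** * Integrals of curves in the Schwartz space *)

Section UniformCurves.
Variables (R : realType) (n : nat).
Local Notation S := (schwartz R n).
Implicit Types (f g : R -> S) (a b : R) (m : nat).

(** Steps of length d / 2 reach t after finitely many, by the Archimedean property. *)
Lemma chain_ind (P : R -> Prop) a b (d : R) : 0 < d -> P a ->
  (forall s t, a <= s -> s <= t -> t <= b -> t - s < d -> P s -> P t) ->
  forall t, a <= t -> t <= b -> P t.
Proof.
move=> d0 Pa step t; have d20 : 0 < d / 2 by rewrite divr_gt0.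
have [k tk] : exists k : nat, t <= a + k%:R * (d / 2).
  exists (Num.bound `|(t - a) / (d / 2)|).
  rewrite -lerBlDl -ler_pdivrMr //; apply: le_trans (ler_norm _) _.
  by apply/ltW/archi_boundP/normr_ge0.
elim: k t tk => [|k IH] t.
  by rewrite mul0r addr0 => ta at_; rewrite (@le_anti _ _ t a) // ta.
rewrite -natr1 mulrDl mul1r addrA => tk at_ tb.
have [ts|st] := leP (t - d / 2) a.
  by apply: (step a t) => //; have : d / 2 < d by [lra]; lra.
apply: (step (t - d / 2) t) => //; [exact: ltW|lra|lra|].
by apply: IH; [lra|exact: ltW|lra].
Qed.

Definition ucont f a b := forall m (e : R), 0 < e -> exists2 d : R, 0 < d &
  forall s t, a <= s -> s <= t -> t <= b -> t - s < d -> snorm m (f t - f s) <= e.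

Lemma ucont_sub f a b a' b' : a <= a' -> b' <= b -> ucont f a b -> ucont f a' b'.
Proof.
move=> aa bb uf m e e0; have [d d0 hd] := uf m e e0; exists d => // s t as_ st tb.
by apply: hd => //; lra.
Qed.

Lemma ucont_dist f a b m (e : R) : ucont f a b -> 0 < e -> exists2 d : R, 0 < d &
  forall s t, a <= s <= b -> a <= t <= b -> `|t - s| < d -> snorm m (f t - f s) <= e.
Proof.
move=> uf e0; have [d d0 hd] := uf m e e0; exists d => // s t /andP[as_ sb] /andP[at_ tb].
have [st|ts] := leP s t; first by rewrite ger0_norm ?subr_ge0 // => h; exact: hd.
by rewrite ltr0_norm ?subr_lt0 // opprB snorm_distC => h; apply: hd => //; exact: ltW.
Qed.

Lemma ucont_bounded f a b m : ucont f a b -> exists2 C : R, 0 <= C &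
  forall s, a <= s <= b -> snorm m (f s) <= C.
Proof.
move=> uf; have [ab|ba] := leP a b; last first.
  by exists 0 => // s /andP[h1 h2]; have : a <= b := le_trans h1 h2; rewrite leNgt ba.
have [d d0 hd] := uf m 1 ltr01.
suff [C C0 hC] : exists2 C : R, 0 <= C & forall s, a <= s <= b -> snorm m (f s) <= C.
  by exists C.
apply: (@chain_ind (fun t => exists2 C : R, 0 <= C & forall s, a <= s <= t -> snorm m (f s) <= C)
  a b d) => //.
  exists (snorm m (f a)); first exact: snorm_ge0.
  by move=> s /le_anti <-.
move=> s t as_ st tb ts [C C0 hC]; exists (C + 1); first by rewrite addr_ge0.
move=> r /andP[ar rt]; have [rs|sr] := leP r s.
  by apply: (le_trans (hC r _)); rewrite ?ar // lerDl.
rewrite -[f r](subrK (f s)) addrC; apply: (le_trans (snormD _ _ _)); apply: lerD.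
  by apply: hC; rewrite as_ lexx.
by apply: hd => //; [exact: ltW|lra|lra].
Qed.

(** Heine-Cantor: compactness of [0, b] makes the local radii uniform. *)
Lemma continuous_ucont f b : {within `[0, +oo[, continuous f} -> ucont f 0 b.
Proof.
move=> cf m e e0; have e20 : 0 < e / 2 by rewrite divr_gt0.
have := segment_compact (a := 0) (b := b); rewrite compact_near_coveringP => cov.
have := cov R ((0 : R)^'+) (fun d x => 0 <= x -> forall y, 0 <= y -> `|y - x| < d ->
  snorm m (f y - f x) <= e) _.
case.
- move=> x; rewrite /= in_itv /= => /andP[x0 _].
  have /subspace_continuousP/(_ x) := cf; rewrite /= in_itv /= andbT x0 => /(_ isT).
  rewrite schwartz_cvg_snormP => /(_ m _ e20)/nbhs_ballP[r r0 hr].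
  have r20 : 0 < r / 2 by rewrite divr_gt0.
  near=> x' d => /= x'0 y y0 yx.
  have xx : `|x - x'| < r / 2 by near: x'; exists (r / 2).
  have dr : d < r / 2 by near: d; exact: nbhs_right_lt.
  have hx : snorm m (f x' - f x) < e / 2.
    by apply: hr; rewrite /ball /= ?in_itv /= ?andbT //; lra.
  have hy : snorm m (f y - f x) < e / 2.
    apply: hr; rewrite /ball /= ?in_itv /= ?andbT //.
    by move: xx yx; rewrite !ltr_norml => /andP[? ?] /andP[? ?]; apply/andP; split; lra.
  rewrite -[f y - f x'](subrKA (f x)); apply: (le_trans (snormD _ _ _)).
  have hx' : snorm m (f x - f x') < e / 2 by rewrite snorm_distC.
  rewrite -[X in _ <= X](_ : e / 2 + e / 2 = e); last by rewrite -splitr.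
  exact: (lerD (ltW hy) (ltW hx')).
- move=> d d0 hd; have d20 : 0 < d / 2 by rewrite divr_gt0.
  exists (d / 2) => // s t s0 st tb ts; apply: (hd (d / 2)) => //=.
  + by rewrite sub0r normrN gtr0_norm //; lra.
  + by rewrite in_itv /= s0 (le_trans st).
  + exact: le_trans st.
  + by rewrite ger0_norm // subr_ge0.
Unshelve. all: by end_near. Qed.

Lemma ucont_continuous f : (forall b, ucont f 0 b) -> {within `[0, +oo[, continuous f}.
Proof.
move=> uf; apply/subspace_continuousP => x /=; rewrite in_itv /= andbT => x0.
apply/schwartz_cvg_snormP => m e e0; have e20 : 0 < e / 2 by rewrite divr_gt0.
have [d d0 hd] := ucont_dist m (uf (x + 1)) e20.
apply/nbhs_ballP; exists (Num.min d 1); first by rewrite /= lt_min d0 ltr01.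
move=> y; rewrite /ball /= lt_min => /andP[yd y1]; rewrite in_itv /= andbT => y0.
apply: (@le_lt_trans _ _ (e / 2)); last by lra.
by apply: hd; rewrite ?x0 ?y0 ?(distrC y) //=; move: y1; rewrite ltr_norml => /andP[? ?]; lra.
Qed.

(** A bound linear in the length adds up exactly over consecutive pieces, so for an additive X the
    local estimate becomes global with the same constant. *)
Lemma sewing (X : R -> R -> S) a b (d e : R) m : 0 < d -> 0 <= e ->
  (forall r s t, a <= r -> r <= s -> s <= t -> t <= b -> X r t = X r s + X s t) ->
  (forall s t, a <= s -> s <= t -> t <= b -> t - s < d -> snorm m (X s t) <= e * (t - s)) ->
  a <= b -> snorm m (X a b) <= e * (b - a).
Proof.
move=> d0 e0 addX loc ab.
apply: (@chain_ind (fun t => snorm m (X a t) <= e * (t - a)) a b d) => //.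
  by apply: loc; rewrite ?subrr.
move=> s t as_ st tb ts h; rewrite (addX a s t) //; apply: (le_trans (snormD _ _ _)).
rewrite (_ : t - a = (s - a) + (t - s)); last by ring.
by rewrite (mulrDr e (s - a)); apply: lerD h _; exact: loc.
Qed.

End UniformCurves.

Section SchwartzIntegral.
Variables (R : realType) (n : nat).
Local Notation S := (schwartz R n).
Local Notation leb := (@lebesgue_measure R).
Implicit Types (f g : R -> S) (a b : R) (m : nat).

Definition is_sint f a b (J : S) := forall x,
  cReal J x = \int[leb]_(z in `[a, b]) cReal (f z) x /\
  cImag J x = \int[leb]_(z in `[a, b]) cImag (f z) x.

Definition sint f a b : S := xget 0 [set J | is_sint f a b J].

Lemma is_sint_inj f a b J J' : is_sint f a b J -> is_sint f a b J' -> J = J'.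
Proof.
by move=> h h'; apply: schwartz_eqP => x; rewrite ?((h x).1) ?((h' x).1) ?((h x).2) ?((h' x).2).
Qed.

Section OneComponent.
Variables (a b : R) (F : R -> 'rV[R]_n -> R).
Hypothesis ab : a <= b.
Hypothesis sF : forall z, a <= z <= b -> rschwartz (F z).
Hypothesis cF : forall w x (e : R), 0 < e -> exists2 d : R, 0 < d &
  forall s t, a <= s <= b -> a <= t <= b -> `|t - s| < d ->
    `|rderivs w (F t) x - rderivs w (F s) x| <= e.

Lemma component_measurable w x :
  measurable_fun `[a, b] (fun z : measurableTypeR R => rderivs w (F z) x).
Proof.
apply: subspace_continuous_measurable_fun; first exact: measurable_itv.
apply/subspace_continuousP => z /=; rewrite in_itv /= => zab.
apply/cvgrPdist_le => e e0; have [d d0 hd] := cF w x e0.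
apply/nbhs_ballP; exists d => // y yz /=; rewrite in_itv /= => yab.
by apply: hd => //; rewrite /ball /= in yz.
Qed.

(** On a bounded interval the constant [g m] is an integrable dominating function, so the results on
    averages apply; its integral is the bound. *)
Lemma component_average (g : nat -> R) :
  (forall m z, a <= z <= b -> rsb m m (g m) (F z)) ->
  rschwartz (fun x => \int[leb]_(z in `[a, b]) F z x) /\
  forall m, rsb m m (g m * (b - a)) (fun x => \int[leb]_(z in `[a, b]) F z x).
Proof.
move=> bF.
have mab : measurable (`[a, b] : set (measurableTypeR R)) by exact: measurable_itv.
have s z : `[a, b]%classic z -> rsmooth (F z).
  by rewrite /= in_itv /= => /sF[].
have bb m z : `[a, b]%classic z -> rsb m m (g m) (F z).
  by rewrite /= in_itv /= => zab; exact: bF.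
have ig m : leb.-integrable `[a, b] (EFin \o (fun=> g m)).
  by apply: continuous_compact_integrable; [exact: segment_compact|move=> ?; exact: cvg_cst].
split; first exact: (@rschwartz_average _ _ _ leb n `[a, b] F (fun m z => g m) mab s component_measurable bb ig).
move=> m.
have := @rsb_average _ _ _ leb n `[a, b] F (fun m z => g m) mab s component_measurable bb ig m.
have lab : fine (leb `[a, b]) = b - a.
  rewrite lebesgue_measure_itv /= lte_fin.
  by move: ab; rewrite le_eqVlt => /predU1P[<-|->] //; rewrite ltxx subrr.
by rewrite Rintegral_cst // -[fine _]/(fine (leb `[a, b])) lab.
Qed.

End OneComponent.

Lemma ucont_components f a b : ucont f a b -> forall w x (e : R), 0 < e ->
  exists2 d : R, 0 < d & forall s t, a <= s <= b -> a <= t <= b -> `|t - s| < d ->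
    `|rderivs w (cReal (f t)) x - rderivs w (cReal (f s)) x| <= e /\
    `|rderivs w (cImag (f t)) x - rderivs w (cImag (f s)) x| <= e.
Proof.
move=> uf w x e e0; have [d d0 hd] := ucont_dist (size w) uf e0.
exists d => // s t sab tab ts; have h := hd s t sab tab ts.
have e1 : rderivs w (cReal (f t)) x - rderivs w (cReal (f s)) x =
    rderivs w (cReal (f t - f s)) x.
  rewrite -[in RHS]cReal_pderivs -spartialE [spartial w _]linearB /=.
  by rewrite -[RHS]/(cReal (spartial w (f t) - spartial w (f s)) x) cRealD cRealN.
have e2 : rderivs w (cImag (f t)) x - rderivs w (cImag (f s)) x =
    rderivs w (cImag (f t - f s)) x.
  rewrite -[in RHS]cImag_pderivs -spartialE [spartial w _]linearB /=.
  by rewrite -[RHS]/(cImag (spartial w (f t) - spartial w (f s)) x) cImagD cImagN.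
rewrite e1 e2; split; apply: le_trans h.
  apply: rsb_abs (leqnn _); exact: rsb_cReal.
apply: rsb_abs (leqnn _); exact: rsb_cImag.
Qed.

(** Existence is [component_average] for the real and the imaginary part; adding their bounds
    produces the factor 2. *)
Lemma sint_exists f a b : a <= b -> ucont f a b -> exists J : S, is_sint f a b J /\
  forall m (M : R), (forall z, a <= z <= b -> snorm m (f z) <= M) ->
    snorm m J <= 2 * M * (b - a).
Proof.
move=> ab uf; have cF := ucont_components uf.
have cR w x (e : R) : 0 < e -> exists2 d : R, 0 < d &
    forall s t, a <= s <= b -> a <= t <= b -> `|t - s| < d ->
    `|rderivs w (cReal (f t)) x - rderivs w (cReal (f s)) x| <= e.
  by move=> e0; have [d d0 hd] := cF w x e e0; exists d => // s t h1 h2 h3; have [] := hd s t h1 h2 h3.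
have cI w x (e : R) : 0 < e -> exists2 d : R, 0 < d &
    forall s t, a <= s <= b -> a <= t <= b -> `|t - s| < d ->
    `|rderivs w (cImag (f t)) x - rderivs w (cImag (f s)) x| <= e.
  by move=> e0; have [d d0 hd] := cF w x e e0; exists d => // s t h1 h2 h3; have [] := hd s t h1 h2 h3.
have sR z : a <= z <= b -> rschwartz (cReal (f z)) by move=> _; exact: rschwartz_cReal.
have sI z : a <= z <= b -> rschwartz (cImag (f z)) by move=> _; exact: rschwartz_cImag.
have [g hg] : exists g : nat -> R, forall m z, a <= z <= b -> snorm m (f z) <= g m.
  have [|g hg] := @choice _ _ (fun m (C : R) => forall z, a <= z <= b -> snorm m (f z) <= C).
    by move=> m; have [C _ hC] := ucont_bounded m uf; exists C.
  by exists g.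
have bR (g' : nat -> R) : (forall m z, a <= z <= b -> snorm m (f z) <= g' m) ->
    forall m z, a <= z <= b -> rsb m m (g' m) (cReal (f z)).
  by move=> h m z zab; apply: rsb_le (leqnn _) (leqnn _) (h m z zab) _; exact: rsb_cReal.
have bI (g' : nat -> R) : (forall m z, a <= z <= b -> snorm m (f z) <= g' m) ->
    forall m z, a <= z <= b -> rsb m m (g' m) (cImag (f z)).
  by move=> h m z zab; apply: rsb_le (leqnn _) (leqnn _) (h m z zab) _; exact: rsb_cImag.
have [r1 _] := component_average ab sR cR (bR _ hg).
have [r2 _] := component_average ab sI cI (bI _ hg).
exists (schwartz_pair r1 r2); split => // m M hM.
(* [component_average] wants bounds of all orders at once: M replaces the one of order m and the
   others are kept. The integrals do not depend on the bounds, so the estimate concerns the J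
   already built. *)
pose g' k := if k == m then M else g k.
have hg' k z : a <= z <= b -> snorm k (f z) <= g' k.
  by rewrite /g'; case: eqP => [->|_]; [exact: hM|exact: hg].
have [_ /(_ m) b1] := component_average ab sR cR (bR _ hg').
have [_ /(_ m) b2] := component_average ab sI cI (bI _ hg').
apply: le_trans (@snorm_le_rsb _ _ m (schwartz_pair r1 r2) _ _ b1 b2) _.
by rewrite /g' eqxx (_ : 2 * M * (b - a) = M * (b - a) + M * (b - a)) //; ring.
Qed.

Lemma sintP f a b : a <= b -> ucont f a b -> is_sint f a b (sint f a b).
Proof.
move=> ab uf; have [J [hJ _]] := sint_exists ab uf.
exact: (@xgetPex _ 0 [set J | is_sint f a b J] (ex_intro _ J hJ)).
Qed.

Lemma snorm_sint f a b m (M : R) : a <= b -> ucont f a b ->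
  (forall z, a <= z <= b -> snorm m (f z) <= M) -> snorm m (sint f a b) <= 2 * M * (b - a).
Proof.
move=> ab uf hM; have [J [hJ bJ]] := sint_exists ab uf.
by rewrite (is_sint_inj (sintP ab uf) hJ); exact: bJ.
Qed.

Lemma ucont_integrable f a b x : ucont f a b ->
  leb.-integrable `[a, b] (EFin \o (fun z => cReal (f z) x)) /\
  leb.-integrable `[a, b] (EFin \o (fun z => cImag (f z) x)).
Proof.
move=> uf; have h := ucont_components uf [::] x.
split; (apply: continuous_compact_integrable; first exact: segment_compact);
  apply/subspace_continuousP => z /=; rewrite in_itv /= => zab;
  apply/cvgrPdist_le => e e0; have [d d0 hd] := h e e0;
  apply/nbhs_ballP; exists d => // y yz /=; rewrite in_itv /= => yab;
  rewrite /ball /= in yz; by have [] := hd _ _ yab zab yz.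
Qed.

Lemma sint_add f a r b : a <= r -> r <= b -> ucont f a b ->
  sint f a b = sint f a r + sint f r b.
Proof.
move=> ar rb uf; have ab := le_trans ar rb.
have uar := ucont_sub (lexx a) rb uf; have urb := ucont_sub ar (lexx b) uf.
apply: schwartz_eqP => x; have [e1 e1'] := sintP ab uf x;
  have [e2 e2'] := sintP ar uar x; have [e3 e3'] := sintP rb urb x.
  rewrite cRealD e1 e2 e3; have [i1 _] := ucont_integrable x uf; have [i2 _] := ucont_integrable x urb.
  rewrite -(@Rintegral_itv_obnd_cbnd _ r (BRight b)); last first.
    by apply: integrableS i2 => //; exact: subset_itv_oc_cc.
  by rewrite -(Rintegral_itvB i1) ?bnd_simp // addrC subrK.
rewrite cImagD e1' e2' e3'; have [_ i1] := ucont_integrable x uf; have [_ i2] := ucont_integrable x urb.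
rewrite -(@Rintegral_itv_obnd_cbnd _ r (BRight b)); last first.
  by apply: integrableS i2 => //; exact: subset_itv_oc_cc.
by rewrite -(Rintegral_itvB i1) ?bnd_simp // addrC subrK.
Qed.

Lemma sint_cst (c : S) a b : a <= b -> sint (fun=> c) a b = (b - a)%:C%C *: c.
Proof.
move=> ab; have uc : ucont (fun=> c) a b.
  by move=> m e e0; exists 1 => // s t _ _ _ _; rewrite subrr snorm0 ltW.
have lab : fine (leb `[a, b]) = b - a.
  rewrite lebesgue_measure_itv /= lte_fin.
  by move: ab; rewrite le_eqVlt => /predU1P[<-|->] //; rewrite ltxx subrr.
apply: schwartz_eqP => x; have [e1 e2] := sintP ab uc x; rewrite ?e1 ?e2 ?cRealZ ?cImagZ.
  by rewrite Rintegral_cst // -[fine _]/(fine (leb `[a, b])) lab mulrC.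
by rewrite Rintegral_cst // -[fine _]/(fine (leb `[a, b])) lab mulrC.
Qed.

Lemma sint_sub f (c : S) a b : a <= b -> ucont f a b ->
  sint (fun z => f z - c) a b = sint f a b - (b - a)%:C%C *: c.
Proof.
move=> ab uf; have uf' : ucont (fun z => f z - c) a b.
  move=> m e e0; have [d d0 hd] := uf m e e0; exists d => // s t as_ st tb ts.
  by rewrite opprB addrA subrK; exact: hd.
have uc : ucont (fun=> c) a b.
  by move=> m e e0; exists 1 => // s t _ _ _ _; rewrite subrr snorm0 ltW.
rewrite -(sint_cst c ab).
apply: schwartz_eqP => x; have [e1 e1'] := sintP ab uf' x;
  have [e2 e2'] := sintP ab uf x; have [e3 e3'] := sintP ab uc x;
  have [i1 j1] := ucont_integrable x uf; have [i2 j2] := ucont_integrable x uc.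
  rewrite cRealD cRealN e1 e2 e3 -(RintegralB _ i1 i2); last exact: measurable_itv.
  by apply: eq_Rintegral => z _; rewrite cRealD cRealN.
rewrite cImagD cImagN e1' e2' e3' -(RintegralB _ j1 j2); last exact: measurable_itv.
by apply: eq_Rintegral => z _; rewrite cImagD cImagN.
Qed.

Lemma snorm_sint_sub f (c : S) a b m (M : R) : a <= b -> ucont f a b ->
  (forall z, a <= z <= b -> snorm m (f z - c) <= M) ->
  snorm m (sint f a b - (b - a)%:C%C *: c) <= 2 * M * (b - a).
Proof.
move=> ab uf hM; rewrite -sint_sub //; apply: snorm_sint => //.
move=> k e e0; have [d d0 hd] := uf k e e0; exists d => // s t as_ st tb ts.
by rewrite opprB addrA subrK; exact: hd.
Qed.

(** The tag xi is free in [s, t]: left end points serve [sint_unique], arbitrary tags serve Riemann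
    sums. *)
Lemma sint_local f a b m (e : R) : ucont f a b -> 0 < e -> exists2 d : R, 0 < d &
  forall s t xi, a <= s -> s <= xi -> xi <= t -> t <= b -> t - s < d ->
    snorm m (sint f s t - (t - s)%:C%C *: f xi) <= e * (t - s).
Proof.
move=> uf e0; have e20 : 0 < e / 2 by rewrite divr_gt0.
have [d d0 hd] := ucont_dist m uf e20; exists d => // s t xi as_ sx xt tb ts.
have st := le_trans sx xt.
rewrite -[X in X * (t - s)](_ : 2 * (e / 2) = e); last by rewrite mulrC divfK.
apply: snorm_sint_sub => //; first exact: ucont_sub uf.
move=> z /andP[sz zt]; apply: hd; rewrite ?ler_norml.
- by rewrite (le_trans as_ sx) (le_trans xt tb).
- by rewrite (le_trans as_ sz) (le_trans zt tb).
- by rewrite ltr_norml; apply/andP; split; lra.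
Qed.

(** The difference from the integral is additive and uniformly o(t - s), so it vanishes by [sewing].
    Linearity of the integral and its commutation with bounded operators are read off from this
    characterisation. *)
Lemma sint_unique f a b (X : R -> R -> S) : a <= b -> ucont f a b ->
  (forall r s t, a <= r -> r <= s -> s <= t -> t <= b -> X r t = X r s + X s t) ->
  (forall m (e : R), 0 < e -> exists2 d : R, 0 < d & forall s t, a <= s -> s <= t -> t <= b ->
    t - s < d -> snorm m (X s t - (t - s)%:C%C *: f s) <= e * (t - s)) ->
  X a b = sint f a b.
Proof.
move=> ab uf addX locX; apply/eqP; rewrite -subr_eq0; apply/eqP/snorm_eq0.
apply/ler_addgt0Pr => e e0; rewrite add0r.
have k0 : 0 < b - a + 1 by rewrite ltr_wpDl // subr_ge0.
pose e' := e / (b - a + 1) / 2; have e'0 : 0 < e' by rewrite !divr_gt0.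
have [d1 d10 h1] := locX 0%N e' e'0.
have [d2 d20 h2] := sint_local 0 uf e'0.
apply: (@le_trans _ _ (e / (b - a + 1) * (b - a))); last first.
  by rewrite mulrAC ler_pdivrMr // ler_pM2l // lerDl.
apply: (@sewing R n (fun s t => X s t - sint f s t) a b (Num.min d1 d2)) => //.
- by rewrite lt_min d10.
- by rewrite ltW // divr_gt0.
- move=> r s t ar rs st tb; rewrite (addX r s t) // (sint_add rs st) //; last exact: ucont_sub uf.
  by rewrite opprD addrACA.
move=> s t as_ st tb; rewrite lt_min => /andP[ts1 ts2].
rewrite -(subrKA ((t - s)%:C%C *: f s)); apply: (le_trans (snormD _ _ _)).
rewrite (_ : e / _ * _ = e' * (t - s) + e' * (t - s)); last by rewrite -mulrDl /e' -splitr.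
apply: lerD; first exact: h1.
by rewrite snorm_distC; apply: h2.
Qed.

Lemma sint_commute (T : {linear S -> S}) f a b : a <= b -> ucont f a b ->
  (forall m, exists2 C : R, 0 <= C & exists m', forall v, snorm m (T v) <= C * snorm m' v) ->
  ucont (T \o f) a b /\ T (sint f a b) = sint (T \o f) a b.
Proof.
move=> ab uf bT.
have uTf : ucont (T \o f) a b.
  move=> m e e0; have [C C0 [m' hT]] := bT m.
  have C1 : 0 < C + 1 by rewrite ltr_wpDl.
  have [d d0 hd] := uf m' _ (divr_gt0 e0 C1); exists d => // s t as_ st tb ts /=.
  rewrite -linearB; apply: (le_trans (hT _)).
  apply: (@le_trans _ _ ((C + 1) * (e / (C + 1)))); last by rewrite mulrC divfK ?gt_eqF.
  by apply: ler_pM => //; rewrite ?snorm_ge0 ?lerDl //; exact: hd.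
split => //; apply: (@sint_unique (T \o f) a b (fun s t => T (sint f s t))) => //.
  move=> r s t ar rs st tb; rewrite (sint_add rs st) ?linearD //.
  exact: ucont_sub uf.
move=> m e e0; have [C C0 [m' hT]] := bT m.
have C1 : 0 < C + 1 by rewrite ltr_wpDl.
have [d d0 hd] := sint_local m' uf (divr_gt0 e0 C1); exists d => // s t as_ st tb ts /=.
rewrite -linearZ -linearB; apply: (le_trans (hT _)).
apply: (@le_trans _ _ ((C + 1) * (e / (C + 1) * (t - s)))).
  by apply: ler_pM => //; rewrite ?snorm_ge0 ?lerDl //; exact: hd.
by rewrite mulrA (mulrC (C + 1)) divfK ?gt_eqF.
Qed.

Lemma ucont_lin (c : R[i]) f g a b : ucont f a b -> ucont g a b ->
  ucont (fun t => c *: f t + g t) a b.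
Proof.
move=> uf ug m e e0; have c0 : 0 <= normc c by exact: normc_ge0.
have c1 : 0 < normc c + 1 + 1 by rewrite !ltr_wpDl // addr_ge0.
have e'0 : 0 < e / (normc c + 1 + 1) by rewrite divr_gt0.
have [d1 d10 h1] := uf m _ e'0; have [d2 d20 h2] := ug m _ e'0.
exists (Num.min d1 d2); first by rewrite lt_min d10.
move=> s t as_ st tb; rewrite lt_min => /andP[ts1 ts2].
have -> : c *: f t + g t - (c *: f s + g s) = c *: (f t - f s) + (g t - g s).
  by rewrite scalerBr opprD addrACA.
apply: (le_trans (snorm_lin _ _ _ _)).
have a1 := h1 s t as_ st tb ts1; have a2 := h2 s t as_ st tb ts2.
have a3 := ler_wpM2l c0 a1.
apply: (le_trans (lerD a3 a2)).
move: (normc c) c0 c1 {a1 a2 a3 e'0 h1 h2} => k k0 k1.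
rewrite -[X in _ + X]mul1r -mulrDl mulrA ler_pdivrMr // mulrC ler_pM2l //.
by rewrite lerDl.
Qed.

Lemma sint_lin (c : R[i]) f g a b : a <= b -> ucont f a b -> ucont g a b ->
  sint (fun t => c *: f t + g t) a b = c *: sint f a b + sint g a b.
Proof.
move=> ab uf ug; apply/esym.
apply: (@sint_unique _ a b (fun s t => c *: sint f s t + sint g s t)) => //.
- exact: ucont_lin.
- move=> r s t ar rs st tb; rewrite (sint_add rs st) ?(@sint_add g r s t) //.
  + by rewrite scalerDr addrACA.
  + exact: ucont_sub ug.
  + exact: ucont_sub uf.
move=> m e e0; have c0 : 0 <= normc c by exact: normc_ge0.
have c1 : 0 < normc c + 1 + 1 by rewrite !ltr_wpDl // addr_ge0.
have e'0 : 0 < e / (normc c + 1 + 1) by rewrite divr_gt0.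
have [d1 d10 h1] := sint_local m uf e'0; have [d2 d20 h2] := sint_local m ug e'0.
exists (Num.min d1 d2); first by rewrite lt_min d10.
move=> s t as_ st tb; rewrite lt_min => /andP[ts1 ts2].
have -> : c *: sint f s t + sint g s t - (t - s)%:C%C *: (c *: f s + g s) =
    c *: (sint f s t - (t - s)%:C%C *: f s) + (sint g s t - (t - s)%:C%C *: g s).
  by rewrite scalerBr scalerDr opprD addrACA !scalerA (mulrC c).
apply: (le_trans (snorm_lin _ _ _ _)).
have a1 := h1 s t s as_ (lexx s) st tb ts1; have a2 := h2 s t s as_ (lexx s) st tb ts2.
have a3 := ler_wpM2l c0 a1.
apply: (le_trans (lerD a3 a2)).
move: (normc c) c0 c1 {a1 a2 a3 e'0 h1 h2} => k k0 k1.
rewrite mulrA -mulrDl ler_wpM2r ?subr_ge0 //.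
rewrite -[X in _ + X]mul1r -mulrDl mulrA ler_pdivrMr // mulrC ler_pM2l //.
by rewrite lerDl.
Qed.

Lemma riemann_sum_cons f x y s xi :
  riemann_sum f x (y :: s) xi =
  (y - x)%:C%C *: f (xi 0%N) + riemann_sum f y s (fun k => xi k.+1).
Proof.
rewrite /riemann_sum /= big_ord_recl /=; congr (_ + _); apply: eq_bigr => k _.
rewrite /bump /= add1n; congr ((_ - _)%:C%C *: _).
  by apply: set_nth_default; exact: ltn_ord.
by case: (nat_of_ord k) (ltn_ord k) => [//|j /= js]; apply: set_nth_default; exact: ltnW.
Qed.

(** Induction on the partition: local errors linear in the widths add up to e times the total
    length. The left end x moves along, while a stays fixed so that the local hypothesis keeps its
    range. *)
Lemma sint_riemann_sum f a b m (d e : R) : 0 < d ->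
  (forall s t xi, a <= s -> s <= xi -> xi <= t -> t <= b -> t - s < d ->
    snorm m (sint f s t - (t - s)%:C%C *: f xi) <= e * (t - s)) ->
  ucont f a b -> forall s x xi, a <= x -> path <%O x s -> last x s = b ->
  (forall k, (k < size s)%N -> nth x s k - nth x (x :: s) k < d /\
     nth x (x :: s) k <= xi k <= nth x s k) ->
  snorm m (sint f x b - riemann_sum f x s xi) <= e * (b - x).
Proof.
move=> d0 loc uf; elim=> [|y s IH] x xi ax.
  move=> _ /= xb _; rewrite -xb in loc *; rewrite /riemann_sum big_ord0.
  have := loc x x x ax (lexx x) (lexx x) (lexx x); rewrite subrr => /(_ d0).
  by rewrite scale0r.
rewrite [path _ _ _]/= => /andP[xy ys] yb tags.
have yb' : y <= b by rewrite -yb /=; exact: unstable.path_lt_le_last.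
have [dxy /andP[xi1 xi2]] := tags 0%N isT; rewrite /= in dxy xi1 xi2.
have ay := le_trans ax (ltW xy).
have IHy := IH y (fun k => xi k.+1) ay ys yb.
rewrite riemann_sum_cons (sint_add (ltW xy) yb'); last exact: ucont_sub uf.
rewrite opprD addrACA; apply: (le_trans (snormD _ _ _)).
rewrite (_ : b - x = (y - x) + (b - y)); last by ring.
rewrite (mulrDr e (y - x)); apply: lerD; first exact: loc.
apply: IHy => k ks; have := tags k.+1 ks.
rewrite -[nth x (y :: s) k.+1]/(nth x s k) -[nth x (x :: _) k.+1]/(nth x (y :: s) k).
rewrite (set_nth_default y x ks) (set_nth_default y x) //=; exact: ltnW.
Qed.

Lemma sint_is_riemann f a b : a <= b -> ucont f a b ->
  is_riemann_integral f a b (sint f a b).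
Proof.
move=> ab uf.
pose tagged (d : R) s xi := forall k, (k < size s)%N ->
  nth a s k - nth a (a :: s) k < d /\ nth a (a :: s) k <= xi k <= nth a s k.
(* Sets containing all Riemann sums of small enough mesh form a filter, and [is_riemann_integral] is
   convergence along it. Convergence can then be tested with [snorm]. *)
pose F : set_system S := [set U | exists2 d : R, 0 < d & forall s xi,
  itv_partition a b s -> tagged d s xi -> U (riemann_sum f a s xi)].
have FF : Filter F.
  apply: Build_Filter.
  - by exists 1.
  - move=> P Q [d1 d10 h1] [d2 d20 h2]; exists (Num.min d1 d2); first by rewrite lt_min d10.
    move=> s xi ps t; split; [apply: h1|apply: h2] => // k /t[]; rewrite lt_min;
      by move=> /andP[? ?].
  - by move=> P Q PQ [d d0 h]; exists d => // s xi ps t; exact/PQ/h.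
suff : F --> sint f a b by exact.
apply/schwartz_cvg_snormP => m e e0.
have k0 : 0 < b - a + 1 by rewrite ltr_wpDl // subr_ge0.
have [d d0 hd] := sint_local m uf (divr_gt0 e0 k0).
exists d => // s xi [ps /eqP lb] t; rewrite /= snorm_distC.
apply: le_lt_trans (sint_riemann_sum d0 hd uf (lexx a) ps lb t) _.
by rewrite mulrAC ltr_pdivrMr // ltr_pM2l // ltrDl.
Qed.

End SchwartzIntegral.

(** * The heat semigroup and Duhamel's formula *)

Section HeatSemigroup.
Variables (R : realType) (n : nat) (a : R -> 'M[R]_n).
Local Notation A := (primitive_mx a).
Local Notation E := 'rV[R]_n.
Local Notation S := (schwartz R n).
Hypothesis ha : heat_coefficient a.
Variable L : R -> R -> seq E.
Hypothesis hL : forall s t, 0 <= s -> s <= t ->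
  (size (L s t) <= n)%N /\ cov (L s t) = A t - A s.
Local Notation W s t := (@havg R n (L s t)).
Implicit Types (v : S) (b s t : R) (m : nat).

Lemma trace_rank1 (c : E) : \tr (c^T *m c) = \sum_i c 0 i ^+ 2.
Proof. by apply: eq_bigr => i _; rewrite mxE big_ord1 mxE expr2. Qed.

Lemma norm_sqr_le_trace (c : E) : `|c| ^+ 2 <= \tr (c^T *m c).
Proof.
rewrite trace_rank1; have s0 : 0 <= \sum_i c 0 i ^+ 2 by apply: sumr_ge0 => i _; exact: sqr_ge0.
rewrite -[leRHS]sqr_sqrtr // ler_sqr ?nnegrE ?sqrtr_ge0 //.
rewrite [leLHS]mx_normrE; apply: bigmax_le; first exact: sqrtr_ge0.
move=> [i j] _; rewrite /= ord1 -sqrtr_sqr ler_wsqrtr //.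
by rewrite (bigD1 j) //= lerDl; apply: sumr_ge0 => k _; exact: sqr_ge0.
Qed.

Lemma rho_le_trace (l : seq E) : rho l <= \tr (cov l).
Proof.
by rewrite /rho /cov raddf_sum; apply: ler_sum => c _; exact: norm_sqr_le_trace.
Qed.

(** The trace of [cov (L s t)] bounds the sum of the squared norms, whichever list was chosen, and
    it is O(t - s). Bounds on single vectors follow from 2 |c| <= 1 + |c|^2. *)
Lemma heat_list_bounds b : exists2 B : R, 0 <= B & forall s t, 0 <= s -> s <= t -> t <= b ->
  rho (L s t) <= B * (t - s) /\ forall c, c \in L s t -> `|c| <= B.
Proof.
have [C C0 hC] := primitive_lipschitz ha b.
pose K : R := n%:R * C; have K0 : 0 <= K by exact: mulr_ge0.
have B0 : 0 <= 1 + K + K * `|b| by rewrite !addr_ge0 // mulr_ge0.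
exists (1 + K + K * `|b|) => // s t s0 st tb; have ts : 0 <= t - s by rewrite subr_ge0.
have rK : rho (L s t) <= K * (t - s).
  apply: (le_trans (rho_le_trace _)); have [_ ->] := hL s0 st.
  apply: (@le_trans _ _ (\sum_(i < n) C * (t - s))); last first.
    by rewrite sumr_const card_ord -mulr_natl mulrA.
  apply: ler_sum => i _; rewrite [X in X <= _]mxE [X in _ + X]mxE; apply: le_trans (ler_norm _) _; exact: hC.
have Kb : K * (t - s) <= K * `|b|.
  by apply: ler_wpM2l => //; apply: le_trans (ler_norm _); lra.
split.
  apply: (le_trans rK); apply: ler_wpM2r => //.
  by rewrite addrAC lerDr addr_ge0 // mulr_ge0.
move=> c cl; have cr : `|c| ^+ 2 <= rho (L s t).
  by rewrite /rho (big_rem c) //= lerDl; apply: sumr_ge0 => ? _; exact: sqr_ge0.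
have := sqr_ge0 (`|c| - 1); have := normr_ge0 c.
move: (le_trans cr (le_trans rK Kb)); move: (K * `|b|) `|c| => k x h1 h2 h3.
have : x ^+ 2 - 2 * x + 1 >= 0 by rewrite (_ : _ + 1 = (x - 1) ^+ 2) //; ring.
by move=> h4; have : 2 * x <= 1 + k by [lra]; lra.
Qed.

Lemma heat_bound b m : exists2 C : R, 0 <= C & forall s t v, 0 <= s -> s <= t -> t <= b ->
  snorm m (W s t v) <= C * snorm m v.
Proof.
have [B B0 hB] := heat_list_bounds b.
exists (avg_cst m B ^+ n) => [|s t v s0 st tb].
  by apply/exprn_ge0/(le_trans ler01); exact: avg_cst_ge1.
have [_ cB] := hB s t s0 st tb; have [sl _] := hL s0 st.
exact: snorm_havg.
Qed.

(** [snorm_hdefect] with rho^2 = O((t - s)^2), the matrix of the list being exactly the increment of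
    A. *)
Lemma heat_step b m : exists2 C : R, 0 <= C & forall s t v, 0 <= s -> s <= t -> t <= b ->
  snorm m (W s t v - v - slap (kappa R *: (A t - A s)) v) <= C * (t - s) ^+ 2 * snorm (m + 6) v.
Proof.
have [B B0 hB] := heat_list_bounds b.
have [C C0 hC] := snorm_hdefect n m n B0.
exists (C * B ^+ 2) => [|s t v s0 st tb]; first by rewrite mulr_ge0 // exprn_ge0.
have [rB cB] := hB s t s0 st tb; have [sl cl] := hL s0 st.
have := hC (L s t) v sl cB; rewrite /hdefect cl => h; apply: (le_trans h).
apply: ler_wpM2r; first exact: snorm_ge0.
rewrite -mulrA -exprMn; apply: ler_wpM2l => //.
by rewrite ler_sqr ?nnegrE ?rho_ge0 ?mulr_ge0 ?subr_ge0.
Qed.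

Lemma heat_lipschitz b m : exists2 C : R, 0 <= C & forall s t v, 0 <= s -> s <= t -> t <= b ->
  snorm m (W s t v - v) <= C * (t - s) * snorm (m + 6) v.
Proof.
have [B B0 hB] := heat_list_bounds b; have [C C0 hC] := heat_step b m.
pose K : R := `|kappa R| * n%:R ^+ 2 * B.
have K0 : 0 <= K by rewrite !mulr_ge0 // exprn_ge0.
exists (C * `|b| + K) => [|s t v s0 st tb]; first by rewrite addr_ge0 // mulr_ge0.
have ts : 0 <= t - s by rewrite subr_ge0.
rewrite -[W s t v - v](subrK (slap (kappa R *: (A t - A s)) v)).
apply: (le_trans (snormD _ _ _)); rewrite mulrDl mulrDl.
have h1 := hC s t v s0 st tb; have v0 := snorm_ge0 (m + 6) v.
apply: lerD.
  apply: (le_trans h1); rewrite ler_wpM2r // expr2 mulrA ler_wpM2r // ler_wpM2l //.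
  by apply: le_trans (ler_norm _); lra.
apply: (le_trans (snorm_slap _ _ _)); apply: ler_pM; [exact: mxsum_ge0|exact: snorm_ge0| |].
  have [rB _] := hB s t s0 st tb; have [_ <-] := hL s0 st.
  apply: (le_trans (mxsum_cov _)); rewrite /K -(mulrA _ B); apply: ler_wpM2l rB.
  by rewrite mulr_ge0 // exprn_ge0.
by apply: snorm_mono; rewrite leq_add2l.
Qed.

(** Matrices of concatenated lists add up, the sum telescopes, and by [havg_cov] the average depends
    on the matrix only. *)
Lemma heat_semigroup r s t v : 0 <= r -> r <= s -> s <= t -> W s t (W r s v) = W r t v.
Proof.
move=> r0 rs st; rewrite -havg_cat; apply: havg_cov.
have [_ c1] := hL (le_trans r0 rs) st; have [_ c2] := hL r0 rs.
have [_ c3] := hL r0 (le_trans rs st).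
by rewrite c3 /cov big_cat /= -!/(cov _) c1 c2 addrA subrK.
Qed.

(* The integrated form of u' = h + kappa sum_ij a_ij d_i d_j u, which presupposes
   no differentiability of u. *)
Definition mild (u h : R -> S) b := forall m (e : R), 0 < e -> exists2 d : R, 0 < d &
  forall s t, 0 <= s -> s <= t -> t <= b -> t - s < d ->
    snorm m (u t - W s t (u s) - (t - s)%:C%C *: h s) <= e * (t - s).

Definition bounded_curve (u : R -> S) b := forall m, exists2 C : R, 0 <= C &
  forall s, 0 <= s -> s <= b -> snorm m (u s) <= C.

Lemma bounded_ucont (u : R -> S) b : ucont u 0 b -> bounded_curve u b.
Proof.
move=> uu m; have [C C0 hC] := ucont_bounded m uu.
by exists C => // s s0 sb; apply: hC; rewrite s0.
Qed.

(** The mild estimate at e = 1, the Lipschitz bound of W and the bounds on u and h make u Lipschitz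
    over short steps. *)
Lemma mild_ucont u h b : mild u h b -> bounded_curve u b -> bounded_curve h b -> ucont u 0 b.
Proof.
move=> mu bu bh m e e0.
have [d1 d10 h1] := mu m 1 ltr01; have [C C0 hC] := heat_lipschitz b m.
have [M M0 hM] := bu (m + 6)%N; have [N N0 hN] := bh m.
pose K : R := 1 + C * M + N + 1; have K0 : 0 < K by rewrite ltr_pwDr // !addr_ge0 // mulr_ge0.
exists (Num.min d1 (e / K)); first by rewrite lt_min d10 divr_gt0.
move=> s t s0 st tb; rewrite lt_min => /andP[ts1 ts2].
have ts : 0 <= t - s by rewrite subr_ge0.
have -> : u t - u s = (u t - W s t (u s) - (t - s)%:C%C *: h s) +
    ((W s t (u s) - u s) + (t - s)%:C%C *: h s).
  move: (W s t (u s)) => w; schwartz_ring.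
apply: (@le_trans _ _ ((1 + C * M + N) * (t - s))); last first.
  move: ts2; rewrite ltr_pdivlMr // => /ltW; apply: le_trans; rewrite mulrC; apply: ler_wpM2l => //.
  by rewrite /K lerDl.
have -> : (1 + C * M + N) * (t - s) = 1 * (t - s) + (C * M * (t - s) + N * (t - s)) by ring.
apply: (le_trans (snormD _ _ _)); apply: lerD; first exact: h1.
apply: (le_trans (snormD _ _ _)); apply: lerD.
  apply: (le_trans (hC s t (u s) s0 st tb)); rewrite mulrAC; apply: ler_wpM2r => //.
  by apply: ler_wpM2l => //; apply: hM => //; exact: le_trans tb.
apply: (le_trans (snormZr _ _ _)); rewrite ger0_norm // mulrC; apply: ler_wpM2r => //.
by apply: hN => //; exact: le_trans tb.
Qed.

Lemma mxsumZ (k : R) (M : 'M[R]_n) : mxsum (k *: M) = `|k| * mxsum M.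
Proof.
rewrite /mxsum mulr_sumr; apply: eq_bigr => i _; rewrite mulr_sumr; apply: eq_bigr => j _.
by rewrite mxE normrM.
Qed.

(** Over [s, t] near r, the increment of W(s, t) is replaced by the operator of A(t) - A(s), this by
    (t - s) a(r), and finally u(s) and h(s) by their values at r. *)
Lemma mild_strong_derive u h b : mild u h b -> bounded_curve u b -> ucont h 0 b ->
  forall r m (e : R), 0 <= r -> r <= b -> 0 < e -> exists2 d : R, 0 < d &
  forall s t, 0 <= s -> s <= t -> t <= b -> `|s - r| < d -> `|t - r| < d ->
    snorm m (u t - u s - (t - s)%:C%C *: (h r + slap (kappa R *: a r) (u r))) <= e * (t - s).
Proof.
move=> mu bu uh r m e r0 rb e0; have uu := mild_ucont mu bu (bounded_ucont uh).
have [M M0 hM] := bu (m + 2)%N; have [N N0 hN] := bu (m + 6)%N.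
have [C C0 hC] := heat_step b m.
pose Q := mxsum (kappa R *: a r); have Q0 : 0 <= Q by exact: mxsum_ge0.
(* Five errors share e (t - s): the mild estimate, the step error and the continuity of h count once
   each, the derivative of A counts |kappa| M, and the continuity of u counts Q. *)
pose K : R := 3 + `|kappa R| * M + Q.
have K0 : 0 < K by rewrite /K -addrA ltr_wpDr // addr_ge0 // mulr_ge0.
pose e' := e / K; have e'0 : 0 < e' by rewrite divr_gt0.
have [d1 d10 h1] := mu m e' e'0.
have CN0 : 0 < C * N + 1 by rewrite ltr_wpDl // mulr_ge0.
pose d2 := e' / (C * N + 1); have d20 : 0 < d2 by rewrite divr_gt0.
have [d3 d30 h3] := primitive_strong_derive ha r0 e'0.
have [d4 d40 h4] := ucont_dist (m + 2) uu e'0.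
have [d5 d50 h5] := ucont_dist m uh e'0.
pose d := Num.min (Num.min (d1 / 2) (d2 / 2)) (Num.min d3 (Num.min d4 d5)).
exists d; first by rewrite !lt_min d30 d40 d50 !divr_gt0.
move=> s t s0 st tb; rewrite !lt_min.
move=> /andP[/andP[sr1 sr2] /andP[sr3 /andP[sr4 sr5]]].
move=> /andP[/andP[tr1 tr2] /andP[tr3 _]].
have ts : 0 <= t - s by rewrite subr_ge0.
have ts1 : t - s < d1.
  by move: sr1 tr1; rewrite !ltr_norml => /andP[? ?] /andP[? ?]; lra.
have ts2 : t - s < d2.
  by move: sr2 tr2; rewrite !ltr_norml => /andP[? ?] /andP[? ?]; lra.
have sb : s <= b by exact: le_trans tb.
pose D := A t - A s - (t - s) *: a r.
have -> : u t - u s - (t - s)%:C%C *: (h r + slap (kappa R *: a r) (u r)) =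
    (u t - W s t (u s) - (t - s)%:C%C *: h s) +
    ((W s t (u s) - u s - slap (kappa R *: (A t - A s)) (u s)) +
    (slap (kappa R *: D) (u s) +
    ((t - s)%:C%C *: slap (kappa R *: a r) (u s - u r) + (t - s)%:C%C *: (h s - h r)))).
  have -> : slap (kappa R *: (A t - A s)) (u s) =
      slap (kappa R *: D) (u s) + (t - s)%:C%C *: slap (kappa R *: a r) (u s).
    rewrite -slapZl -slapDl /D; move: (A t) (A s) (a r) => X Y Z; congr (slap _ _).
    by apply/matrixP => i j; rewrite !mxE; ring.
  rewrite [slap _ (u s - u r)]linearB /=.
  move: (W s t (u s)) (slap _ _) (slap _ _) (slap _ _) => w x y z; schwartz_ring.
rewrite -[X in X * (t - s)](_ : e' * K = e); last by rewrite /e' divfK ?gt_eqF.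
have -> : e' * K * (t - s) = e' * (t - s) + (e' * (t - s) + (e' * (t - s) * (`|kappa R| * M) +
   ((t - s) * (Q * e') + (t - s) * e'))) by rewrite /K; move: (`|kappa R|) => k; ring.
apply: (le_trans (snormD _ _ _)); apply: lerD; first exact: h1.
apply: (le_trans (snormD _ _ _)); apply: lerD.
  apply: (le_trans (hC s t (u s) s0 st tb)).
  have := hN s s0 sb; move: (snorm_ge0 (m + 6) (u s)); move: (snorm _ _) => x x0 xN.
  rewrite expr2 mulrA mulrAC; apply: ler_wpM2r => //.
  apply: (@le_trans _ _ ((C * N + 1) * (t - s))).
    rewrite mulrAC; apply: ler_wpM2r => //; apply: (@le_trans _ _ (C * N)); first exact: ler_wpM2l.
    by rewrite lerDl.
  by move: ts2; rewrite /d2 ltr_pdivlMr // mulrC => /ltW.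
apply: (le_trans (snormD _ _ _)); apply: lerD.
  apply: (le_trans (snorm_slap _ _ _)); rewrite mxsumZ.
  have := hM s s0 sb; have := h3 s t s0 st sr3 tr3; have := mxsum_ge0 D.
  have := snorm_ge0 (m + 2) (u s); have := normr_ge0 (kappa R).
  rewrite -/D; move: `|kappa R| (mxsum D) (snorm _ (u s)) => k p q k0 q0 p0 hp hq.
  rewrite (_ : _ * (k * M) = k * (e' * (t - s)) * M); last by ring.
  by apply: ler_pM => //; [exact: mulr_ge0|exact: ler_wpM2l].
have rb' : 0 <= r <= b by rewrite r0.
have sb' : 0 <= s <= b by rewrite s0.
apply: (le_trans (snormD _ _ _)); apply: lerD; (apply: (le_trans (snormZr _ _ _));
  rewrite (ger0_norm ts); apply: ler_wpM2l => //).
  apply: (le_trans (snorm_slap _ _ _)); apply: ler_wpM2l => //.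
  exact: h4.
exact: h5.
Qed.

Lemma mild_derive u h b : mild u h b -> bounded_curve u b -> ucont h 0 b ->
  forall r, 0 < r -> r < b ->
    diff_quotient u r @ 0^' --> h r + slap (kappa R *: a r) (u r).
Proof.
move=> mu bu uh r r0 rb; set l := h r + _; apply/schwartz_cvg_snormP => m e e0.
have e20 : 0 < e / 2 by rewrite divr_gt0.
have [d d0 hd] := mild_strong_derive mu bu uh m (ltW r0) (ltW rb) e20.
have rho0 : 0 < Num.min d (Num.min r (b - r)) by rewrite !lt_min d0 r0 subr_gt0.
change (\forall x \near (0 : R)^', snorm m (diff_quotient u r x - l) < e); near=> x.
have x0 : x != 0 by near: x; exact: nbhs_dnbhs_neq.
have : `|x| < Num.min d (Num.min r (b - r)) by near: x; exact: dnbhs0_lt.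
rewrite !lt_min => /andP[xd /andP[xr xb]].
have nx : 0 < `|x| by rewrite normr_gt0.
have h0 : snorm m (u (x + r) - u r - x%:C%C *: l) <= e / 2 * `|x|.
  move: xd xr xb; rewrite !ltr_norml => /andP[? ?] /andP[? ?] /andP[? ?].
  (* For x >= 0 the point r is the left end of the step, for x < 0 the right end, and then the
     increment changes sign. *)
  have [xp|xn] := leP 0 x.
    have := hd r (x + r); rewrite subrr normr0 addrK (ger0_norm xp); apply => //; lra.
  have := hd (x + r) r; rewrite subrr normr0 addrK (ltr0_norm xn).
  rewrite (_ : r - (x + r) = - x); last by ring.
  move=> h1; rewrite -snormN.
  rewrite (_ : - (u (x + r) - u r - x%:C%C *: l) = u r - u (x + r) - (- x)%:C%C *: l); last first.
    by schwartz_ring.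
  by apply: h1 => //; lra.
rewrite /=; apply: (@le_lt_trans _ _ (e / 2)); last by rewrite ltr_pdivrMr // ltr_pMr // ltr1n.
have -> : diff_quotient u r x - l = (x^-1)%:C%C *: (u (x + r) - u r - x%:C%C *: l).
  have {1}-> : l = (x^-1)%:C%C *: (x%:C%C *: l) by rewrite scalerA -rmorphM /= mulVf // scale1r.
  by rewrite /diff_quotient -scalerBr.
apply: (le_trans (snormZr _ _ _)); rewrite normfV mulrC ler_pdivrMr //.
Unshelve. all: by end_near. Qed.

Lemma eq_sint (f g : R -> S) c b : (forall z, c <= z <= b -> f z = g z) ->
  sint f c b = sint g c b.
Proof.
move=> fg; rewrite /sint; congr xget; apply/funext => J; apply/propext.
have e x : \int[@lebesgue_measure R]_(z in `[c, b]) cReal (f z) x =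
    \int[@lebesgue_measure R]_(z in `[c, b]) cReal (g z) x.
  by apply: eq_Rintegral => z; rewrite inE /= in_itv /= => /fg ->.
have e' x : \int[@lebesgue_measure R]_(z in `[c, b]) cImag (f z) x =
    \int[@lebesgue_measure R]_(z in `[c, b]) cImag (g z) x.
  by apply: eq_Rintegral => z; rewrite inE /= in_itv /= => /fg ->.
by split => h x; have := h x; rewrite e e'.
Qed.

Lemma homogeneous_mild v b : mild (fun t => W 0 t v) (fun=> 0) b.
Proof.
move=> m e e0; exists 1 => // s t s0 st _ _.
by rewrite (heat_semigroup v (lexx 0) s0 st) subrr scaler0 subr0 snorm0 mulr_ge0 ?subr_ge0 // ltW.
Qed.

Definition duhamel (h : R -> S) t : S := sint (fun s => W s t (h s)) 0 t.

Lemma duhamel_ucont h t : ucont h 0 t -> ucont (fun s => W s t (h s)) 0 t.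
Proof.
move=> uh m e e0; have [C C0 hC] := heat_bound t m; have [N N0 hN] := heat_lipschitz t m.
have [M M0 hM] := bounded_ucont uh (m + 6)%N.
pose K : R := C * (1 + N * M) + 1.
have K0 : 0 < K by rewrite ltr_pwDr // mulr_ge0 // addr_ge0 // mulr_ge0.
have e'0 : 0 < e / K by rewrite divr_gt0.
have [d1 d10 h1] := uh m _ e'0.
exists (Num.min d1 (e / K)); first by rewrite lt_min d10.
move=> r s r0 rs st; rewrite lt_min => /andP[rs1 rs2].
have s0 := le_trans r0 rs; have rt := le_trans rs st.
(* By the evolution law W(r, t) = W(s, t) W(r, s), the difference factors through the bounded
   operator W(s, t). *)
have -> : W s t (h s) - W r t (h r) = W s t ((h s - h r) - (W r s (h r) - h r)).
  by rewrite opprB addrA subrK linearB /= (heat_semigroup (h r) r0 rs st).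
apply: (le_trans (hC s t _ s0 st (lexx t))).
apply: (@le_trans _ _ (C * (e / K + N * (e / K) * M))); last first.
  rewrite (_ : C * _ = C * (1 + N * M) * (e / K)); last by ring.
  by rewrite mulrA ler_pdivrMr // mulrC ler_pM2l // lerDl.
apply: ler_wpM2l => //; apply: (le_trans (snormB _ _ _)); apply: lerD; first exact: h1.
apply: (le_trans (hN r s (h r) r0 rs st)); apply: ler_pM; rewrite ?snorm_ge0 //.
- by rewrite mulr_ge0 // subr_ge0.
- by apply: ler_wpM2l => //; exact: ltW.
- exact: hM.
Qed.

(** The integral is split at s, and W(s, t) is pulled out of the first part by [sint_commute] and
    the evolution law. *)
Lemma duhamel_step h s t : 0 <= s -> s <= t -> ucont h 0 t ->
  duhamel h t = W s t (duhamel h s) + sint (fun z => W z t (h z)) s t.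
Proof.
move=> s0 st uh; rewrite {1}/duhamel (sint_add s0 st); last exact: duhamel_ucont.
congr (_ + _); rewrite /duhamel.
have us : ucont (fun z => W z s (h z)) 0 s by apply: duhamel_ucont; exact: ucont_sub uh.
have bW m : exists2 C : R, 0 <= C & exists m', forall v, snorm m (W s t v) <= C * snorm m' v.
  by have [C C0 hC] := heat_bound t m; exists C => //; exists m => v; exact: hC.
have [_ ->] := sint_commute s0 us bW.
apply: eq_sint => z /andP[z0 zs]; rewrite /= heat_semigroup //.
Qed.

(** After [duhamel_step] only the integral over [s, t] remains, and its integrand W(z, t) h(z) is
    uniformly close to h(s). *)
Lemma duhamel_mild h b : ucont h 0 b -> mild (duhamel h) h b.
Proof.
move=> uh m e e0; have e20 : 0 < e / 2 by rewrite divr_gt0.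
have [N N0 hN] := heat_lipschitz b m.
have [M M0 hM] := bounded_ucont uh (m + 6)%N.
have NM1 : 0 < N * M + 1 by rewrite ltr_wpDl // mulr_ge0.
have e40 : 0 < e / 2 / 2 by rewrite divr_gt0.
have [d1 d10 h1] := uh m _ e40.
exists (Num.min d1 (e / 2 / 2 / (N * M + 1))); first by rewrite lt_min d10 divr_gt0.
move=> s t s0 st tb; rewrite lt_min => /andP[ts1 ts2].
have uht : ucont h 0 t by exact: ucont_sub uh.
rewrite (duhamel_step s0 st uht) (addrC (W s t _)) addrK.
rewrite -[X in X * (t - s)](_ : 2 * (e / 2) = e); last by rewrite mulrC divfK.
apply: snorm_sint_sub => //; first by apply: (ucont_sub s0 (lexx t)); exact: duhamel_ucont.
move=> z /andP[sz zt]; have z0 := le_trans s0 sz; have zb := le_trans zt tb.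
rewrite -[W z t (h z) - h s](subrKA (h z)); apply: (le_trans (snormD _ _ _)).
rewrite [leRHS]splitr; apply: lerD; last by apply: h1 => //; lra.
apply: (le_trans (hN z t (h z) z0 zt tb)).
apply: (@le_trans _ _ (N * (t - z) * M)).
  by apply: ler_wpM2l; [rewrite mulr_ge0 // subr_ge0|exact: hM].
rewrite mulrAC; apply: (@le_trans _ _ ((N * M + 1) * (t - s))).
  by apply: ler_pM; rewrite ?mulr_ge0 ?subr_ge0 ?lerDl //; lra.
by move: ts2; rewrite ltr_pdivlMr // mulrC => /ltW.
Qed.

Lemma duhamel_bound b m : exists2 C : R, 0 <= C & forall h t (M : R), 0 <= t -> t <= b ->
  ucont h 0 t -> (forall s, 0 <= s <= t -> snorm m (h s) <= M) -> snorm m (duhamel h t) <= C * M.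
Proof.
have [C C0 hC] := heat_bound b m.
exists (2 * C * `|b|); first by rewrite !mulr_ge0.
move=> h t M t0 tb uh hM.
have M0 : 0 <= M by apply: le_trans (hM 0 _); rewrite ?snorm_ge0 ?lexx.
rewrite (_ : _ * M = 2 * (C * M) * `|b|); last by ring.
apply: le_trans (_ : 2 * (C * M) * (t - 0) <= _).
  apply: snorm_sint => //; first exact: duhamel_ucont.
  move=> z /andP[z0 zt]; apply: (le_trans (hC z t _ z0 zt tb)).
  by apply: ler_wpM2l => //; apply: hM; rewrite z0.
apply: ler_wpM2l; first by rewrite !mulr_ge0.
by rewrite subr0; apply: le_trans (ler_norm _).
Qed.

End HeatSemigroup.

(** * Differentiable families of curves *)

Section DifferenceQuotients.
Variables (R : realType) (n : nat).
Local Notation S := (schwartz R n).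
Implicit Types (f g : R -> S) (m : nat).

Lemma schwartz_cvgD (T : Type) (F : set_system T) (p q : T -> S) (x y : S) : Filter F ->
  p @ F --> x -> q @ F --> y -> (fun t => p t + q t) @ F --> x + y.
Proof.
move=> FF px qy; have := @schwartz_cvg_lin R n T F p q 1 x y FF px qy.
by rewrite scale1r; under eq_fun do rewrite scale1r.
Qed.

Lemma schwartz_cvgZ (T : Type) (F : set_system T) (c : T -> R) (p : T -> S) (k : R) (x : S) :
  Filter F -> c @ F --> k -> p @ F --> x -> (fun t => (c t)%:C%C *: p t) @ F --> k%:C%C *: x.
Proof.
move=> FF ck /schwartz_cvg_snormP px; apply/schwartz_cvg_snormP => m e e0.
have e20 : 0 < e / 2 by rewrite divr_gt0.
have k1 : 0 < `|k| + 1 by rewrite ltr_wpDl.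
have x1 : 0 < snorm m x + 1 by rewrite ltr_wpDl // snorm_ge0.
have c1 : \forall t \near F, `|k - c t| < 1 by move/cvgrPdist_lt : ck; apply.
have c2 : \forall t \near F, `|k - c t| < e / 2 / (snorm m x + 1).
  by move/cvgrPdist_lt : ck; apply; rewrite divr_gt0.
have p1 : \forall t \near F, snorm m (p t - x) < e / 2 / (`|k| + 1).
  by apply: px; rewrite divr_gt0.
change (\forall t \near F, snorm m ((c t)%:C%C *: p t - k%:C%C *: x) < e); near=> t.
have h1 : `|k - c t| < 1 by near: t.
have h2 : `|k - c t| < e / 2 / (snorm m x + 1) by near: t.
have h3 : snorm m (p t - x) < e / 2 / (`|k| + 1) by near: t.
have -> : (c t)%:C%C *: p t - k%:C%C *: x = (c t)%:C%C *: (p t - x) + (c t - k)%:C%C *: x.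
  schwartz_ring.
apply: (le_lt_trans (snormD _ _ _)); rewrite [ltRHS]splitr; apply: ler_ltD.
  apply: (le_trans (snormZr _ _ _)); have ctk : `|c t| <= `|k| + 1.
    rewrite -[c t](subKr k); apply: (le_trans (ler_normB _ _)).
    by rewrite lerD2l; exact: ltW.
  rewrite -[leRHS](@divfK _ (`|k| + 1)) ?gt_eqF // mulrC.
  by apply: ler_pM => //; [exact: snorm_ge0|exact: ltW].
apply: (le_lt_trans (snormZr _ _ _)); rewrite distrC.
apply: (@le_lt_trans _ _ (`|k - c t| * (snorm m x + 1))).
  by apply: ler_wpM2l => //; rewrite lerDl.
by rewrite -ltr_pdivlMr.
Unshelve. all: by end_near. Qed.

Lemma schwartz_cvg_bounded (T : Type) (F : set_system T) (A : {linear S -> S}) (p : T -> S) (x : S) :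
  Filter F -> (forall m, exists m', forall v, snorm m (A v) <= snorm m' v) ->
  p @ F --> x -> (A \o p) @ F --> A x.
Proof.
move=> FF hA /schwartz_cvg_snormP px; apply/schwartz_cvg_snormP => m e e0.
have [m' hm] := hA m.
have h : \forall t \near F, snorm m' (p t - x) < e := px m' e e0.
change (\forall t \near F, snorm m (A (p t) - A x) < e).
by apply: filterS h => t; rewrite -linearB; apply: le_lt_trans.
Qed.

Lemma diff_quotient_cvgD f g t (l k : S) : diff_quotient f t @ 0^' --> l ->
  diff_quotient g t @ 0^' --> k -> diff_quotient (fun s => f s + g s) t @ 0^' --> l + k.
Proof.
move=> fl gk; have -> : diff_quotient (fun s => f s + g s) t = (fun e => diff_quotient f t e + diff_quotient g t e).
  by apply/funext => e; rewrite /diff_quotient -scalerDr opprD addrACA.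
exact: schwartz_cvgD.
Qed.

Lemma diff_quotient_cvg_linear f t (l : S) (A : {linear S -> S}) :
  (forall m, exists m', forall v, snorm m (A v) <= snorm m' v) ->
  diff_quotient f t @ 0^' --> l -> diff_quotient (A \o f) t @ 0^' --> A l.
Proof.
move=> hA fl; have -> : diff_quotient (A \o f) t = A \o diff_quotient f t.
  apply/funext => e; transitivity (A (diff_quotient f t e)) => //.
  by rewrite [in RHS]/diff_quotient linearZ /= linearB.
exact: schwartz_cvg_bounded.
Qed.

Lemma diff_quotient_cvgZ (c : R -> R) (c' : R) f t (l : S) : is_derive t (1 : R) c c' ->
  diff_quotient f t @ 0^' --> l ->
  diff_quotient (fun s => (c s)%:C%C *: f s) t @ 0^' --> c'%:C%C *: f t + (c t)%:C%C *: l.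
Proof.
move=> dc fl.
have c1 : (fun e => e^-1 * (c (e + t) - c t)) @ 0^' --> c'.
  have [d <-] := dc; move: d => /cvg_ex[d hd].
  have -> : 'D_1 c t = d by apply: cvg_lim.
  by move: hd; under eq_fun do rewrite /= [_ *: 1]mulr1.
have c2 : (fun e => c (e + t)) @ 0^' --> c t.
  have /derivable1_diffP/differentiable_continuous ct : derivable c t 1 by case: dc.
  have : (fun e => c (e + t)) @ (0 : R) --> c t.
    apply: (@cvg_comp _ _ _ (fun e => e + t) c _ (nbhs t)) => //.
    have : (fun e => e + t) @ (0 : R) --> 0 + t by apply: cvgD; [exact: cvg_id|exact: cvg_cst].
    by rewrite add0r.
  by apply: cvg_trans; apply: cvg_app; exact: nbhs_dnbhs.
have -> : diff_quotient (fun s => (c s)%:C%C *: f s) t =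
    (fun e => (e^-1 * (c (e + t) - c t))%:C%C *: f t + (c (e + t))%:C%C *: diff_quotient f t e).
  apply/funext => e; rewrite /diff_quotient; move: (f _) (f _) (c _) (c _) (e^-1) => p q x y z.
  by schwartz_ring.
apply: schwartz_cvgD; apply: schwartz_cvgZ => //; exact: cvg_cst.
Qed.

Lemma diff_quotient_locally_bounded f t (l : S) m : diff_quotient f t @ 0^' --> l ->
  exists2 C : R, 0 <= C & \forall s \near t, snorm m (f s) <= C.
Proof.
move=> /schwartz_cvg_snormP/(_ m 1 ltr01).
rewrite near_map => /nbhs_ballP[d d0 hd].
exists (snorm m (f t) + (snorm m l + 1)); first by rewrite !addr_ge0 ?snorm_ge0.
apply/nbhs_ballP; exists (Num.min d 1); first by rewrite /= lt_min d0 ltr01.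
move=> s; rewrite /ball /= lt_min => /andP[sd s1].
have [->|st] := eqVneq s t; first by rewrite lerDl addr_ge0 ?snorm_ge0.
have st0 : s - t != 0 by rewrite subr_eq0.
have h : snorm m (diff_quotient f t (s - t) - l) < 1.
  by apply: hd => //; rewrite /ball /= sub0r normrN distrC.
have -> : f s = f t + (s - t)%:C%C *: ((diff_quotient f t (s - t) - l) + l).
  by rewrite subrK /diff_quotient scalerA -rmorphM /= divff // scale1r subrK addrC subrK.
apply: (le_trans (snormD _ _ _)); rewrite lerD2l; apply: (le_trans (snormZr _ _ _)).
apply: le_trans (_ : 1 * (1 + snorm m l) <= _); last by rewrite mul1r addrC.
apply: ler_pM => //; [exact: snorm_ge0|by rewrite distrC ltW|].
by apply: (le_trans (snormD _ _ _)); rewrite lerD2r ltW.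
Qed.

Lemma compact_locally_bounded (g : R -> R) (K : set R) : compact K ->
  (forall t, K t -> exists C : R, \forall s \near t, g s <= C) ->
  exists2 C : R, 0 <= C & forall t, K t -> g t <= C.
Proof.
move=> /compact_near_coveringP cK hg.
have : \forall M \near +oo, K `<=` (fun t => g t <= M).
  apply: cK => t /hg[C hC]; near=> s M.
  have gs : g s <= C by near: s.
  by apply: (le_trans gs) => /=; near: M; apply: nbhs_pinfty_ge; exact: num_real.
move=> h; have [M [M0 KM]] : exists M, 0 <= M /\ K `<=` (fun t => g t <= M).
  have [M] : exists M : R, 0 <= M /\ K `<=` (fun t => g t <= M); last by exists M.
  near (pinfty_nbhs R) => M; exists M; split.
    by near: M; apply: nbhs_pinfty_ge; exact: num_real.
  by near: M.
by exists M.
Unshelve. all: by end_near. Qed.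

Lemma diff_quotient_bounded f (g : R -> S) m (K : set R) :
  compact K -> K `<=` `]0, +oo[ -> (forall t, 0 < t -> diff_quotient f t @ 0^' --> g t) ->
  exists2 C : R, 0 <= C & forall t, K t -> snorm m (f t) <= C.
Proof.
move=> cK K0 fg; apply: compact_locally_bounded => // t /K0; rewrite /= in_itv /= andbT => t0.
by have [C _ hC] := diff_quotient_locally_bounded m (fg t t0); exists C.
Qed.

(* Bounds q allowed for a family of curves indexed by p : P; sub is the
   subtraction of P, so that adm is what continuity in p requires of q. *)
Definition adm (P : topologicalType) (sub : P -> P -> P) : set (P -> R) :=
  [set q | forall (p0 : P) (e : R), 0 < e -> \forall p \near p0, q (sub p p0) < e].

Section Adm.
Variables (P : topologicalType) (sub : P -> P -> P).

Lemma adm0 : adm sub (fun=> 0).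
Proof. by move=> p0 e e0; apply: nearW. Qed.

Lemma admD q1 q2 : adm sub q1 -> adm sub q2 -> adm sub (fun p => q1 p + q2 p).
Proof.
move=> h1 h2 p0 e e0; have e20 : 0 < e / 2 by rewrite divr_gt0.
by apply: filterS2 (h1 p0 _ e20) (h2 p0 _ e20) => p a1 a2; rewrite [ltRHS]splitr ltrD.
Qed.

Lemma admZ c q : 0 <= c -> adm sub q -> adm sub (fun p => c * q p).
Proof.
move=> c0 h p0 e e0; have c1 : 0 < c + 1 by rewrite ltr_wpDl.
apply: filterS (h p0 _ (divr_gt0 e0 c1)) => p qe.
apply: (@le_lt_trans _ _ (c * (e / (c + 1)))); first by apply: ler_wpM2l => //; exact: ltW.
by rewrite mulrA ltr_pdivrMr // mulrC ltr_pM2l // ltrDl.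
Qed.

Lemma adm_sum (I : Type) (r : seq I) (Q : I -> P -> R) : (forall i, adm sub (Q i)) ->
  adm sub (fun p => \sum_(i <- r) Q i p).
Proof.
move=> h; elim: r => [|i r IH]; first by under eq_fun do rewrite big_nil; exact: adm0.
rewrite (_ : (fun p => _) = fun p => Q i p + \sum_(j <- r) Q j p); first exact: admD.
by apply/funext => p; rewrite big_cons.
Qed.

Implicit Types (F G : P -> R -> S).

Definition bounded_family F := forall m (K : set R), compact K -> K `<=` `]0, +oo[ ->
  exists2 q, adm sub q & forall p t, K t -> snorm m (F p t) <= q p.

(** Differentiability of order k for every member, with bounds in p on each derivative, uniform on
    compact sets of positive times. Derivatives are carried existentially, so closure properties are
    proved by induction on k, and regularity in t and continuity in p come out together. *)
Fixpoint tame k F : Prop := bounded_family F /\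
  if k is k'.+1 then exists2 G : P -> R -> S,
    (forall p t, 0 < t -> diff_quotient (F p) t @ 0^' --> G p t) & tame k' G
  else True.

Lemma tame_bounded k F : tame k F -> bounded_family F. Proof. by case: k => [[]|k []]. Qed.

Lemma tameW k F : tame k.+1 F -> tame k F.
Proof.
elim: k F => [|k IH] F [bF [G FG tG]]; first by split.
by split => //; exists G => //; exact: IH.
Qed.

Lemma bounded_familyD F G : bounded_family F -> bounded_family G ->
  bounded_family (fun p t => F p t + G p t).
Proof.
move=> bF bG m K cK K0; have [q1 a1 h1] := bF m K cK K0; have [q2 a2 h2] := bG m K cK K0.
exists (fun p => q1 p + q2 p); first exact: admD.
by move=> p t Kt; apply: (le_trans (snormD _ _ _)); apply: lerD; [exact: h1|exact: h2].
Qed.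

Lemma tameD k F G : tame k F -> tame k G -> tame k (fun p t => F p t + G p t).
Proof.
elim: k F G => [|k IH] F G [bF dF] [bG dG]; (split; first exact: bounded_familyD) => //.
have [F' FF' tF'] := dF; have [G' GG' tG'] := dG.
exists (fun p t => F' p t + G' p t); last exact: IH.
by move=> p t t0; apply: diff_quotient_cvgD; [exact: FF'|exact: GG'].
Qed.

Lemma tame0 k : tame k (fun _ _ => 0).
Proof.
have b0 : bounded_family (fun _ _ => 0).
  by move=> m K _ _; exists (fun=> 0); [exact: adm0|move=> p t _; rewrite snorm0].
elim: k => [|k IH]; split => //; exists (fun _ _ => 0) => // p t t0.
rewrite (_ : diff_quotient _ t = fun=> 0); first exact: cvg_cst.
by apply/funext => e; rewrite /diff_quotient subrr scaler0.
Qed.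

Lemma tame_sum k (I : Type) (r : seq I) (F : I -> P -> R -> S) : (forall i, tame k (F i)) ->
  tame k (fun p t => \sum_(i <- r) F i p t).
Proof.
move=> h; elim: r => [|i r IH].
  rewrite (_ : (fun p t => _) = fun _ _ => 0); first exact: tame0.
  by apply/funext => p; apply/funext => t; rewrite big_nil.
rewrite (_ : (fun p t => _) = fun p t => F i p t + \sum_(j <- r) F j p t); first exact: tameD.
by apply/funext => p; apply/funext => t; rewrite big_cons.
Qed.

Lemma tame_linear k F (A : {linear S -> S}) :
  (forall m, exists m', forall v, snorm m (A v) <= snorm m' v) -> tame k F ->
  tame k (fun p t => A (F p t)).
Proof.
move=> hA; elim: k F => [|k IH] F [bF dF]; (split; first by move=> m K cK K0;
  have [m' hm] := hA m; have [q aq hq] := bF m' K cK K0;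
  exists q => // p t Kt; exact: le_trans (hm _) (hq p t Kt)) => //.
have [G FG tG] := dF; exists (fun p t => A (G p t)); last exact: IH.
by move=> p t t0; apply: (diff_quotient_cvg_linear hA); exact: FG.
Qed.

(** The Leibniz rule brings in the next derivative of the coefficient, hence the statement for a
    sequence of successive derivatives and for all j at once. *)
Lemma tame_scale k F (c : nat -> R -> R) :
  (forall j (t : R), 0 < t -> is_derive t (1 : R) (c j) (c j.+1 t)) -> tame k F ->
  forall j, tame k (fun p t => (c j t)%:C%C *: F p t).
Proof.
move=> dc; have bc j (K : set R) : compact K -> K `<=` `]0, +oo[ ->
    exists2 C : R, 0 <= C & forall t, K t -> `|c j t| <= C.
  move=> cK K0; apply: compact_locally_bounded => // t /K0; rewrite /= in_itv /= andbT => t0.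
  have /derivable1_diffP/differentiable_continuous ct : derivable (c j) t 1 by have [] := dc j t t0.
  exists (`|c j t| + 1); near=> s; rewrite -[c j s](subKr (c j t)).
  apply: (le_trans (ler_normB _ _)); rewrite lerD2l; near: s.
  by move/cvgrPdist_le : ct; apply.
elim: k F => [|k IH] F tF j; (split; first by move=> m K cK K0;
  have [q aq hq] := tame_bounded tF m cK K0; have [C C0 hC] := bc j K cK K0;
  exists (fun p => C * q p); [exact: admZ|move=> p t Kt];
  apply: (le_trans (snormZr _ _ _)); apply: ler_pM => //; rewrite ?snorm_ge0 //; [exact: hC|exact: hq]) => //.
have [bF [G FG tG]] := tF.
exists (fun p t => (c j.+1 t)%:C%C *: F p t + (c j t)%:C%C *: G p t).
  by move=> p t t0; apply: diff_quotient_cvgZ; [exact: dc|exact: FG].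
by apply: tameD; apply: IH => //; exact: tameW.
Unshelve. all: by end_near. Qed.

(** By uniqueness of limits the derivatives carried by [tame] are those of [curve_derivn]. A
    separate f, equal to [F p] at positive times, keeps the arbitrary values at t <= 0 out of the
    induction. *)
Lemma tame_derivn j k F : tame (j + k) F -> exists2 G, tame k G &
  forall p (f : R -> S), (forall t, 0 < t -> f t = F p t) ->
    forall t, 0 < t -> curve_derivn j f t = G p t.
Proof.
elim: j k => [|j IH] k; first by exists F.
rewrite addSnnS => /IH[G [bG [G' GG' tG']] hG]; exists G' => // p f fF t t0.
rewrite /curve_derivn /= -/(curve_derivn j f) /curve_deriv; apply: cvg_lim.
  exact: schwartz_hausdorff.
apply: diff_quotient_eq_cvg (GG' p t t0) => //.
by move=> s s0; rewrite (hG p f fF s s0).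
Qed.

End Adm.

End DifferenceQuotients.

(** * The topology of the solution space *)

Section SolutionSpace.
Variables (R : realType) (n : nat).
Local Notation S := (schwartz R n).
Local Notation X := (solution_space R n).
Implicit Types (x y h : X) (al be : {ffun 'I_n -> nat}) (m j : nat) (K : set R).

Lemma solution_curve h : is_solution_curve h.
Proof. exact/solution_predP/solution_funP. Qed.

Lemma solution_ucont h b : ucont h 0 b.
Proof. by apply: continuous_ucont; have [] := solution_curve h. Qed.

Lemma solution_derivn_cvg h j t : 0 < t ->
  diff_quotient (curve_derivn j h) t @ 0^' --> curve_derivn j.+1 h t.
Proof. by move=> t0; have [_ /(_ j t t0)] := solution_curve h. Qed.

(** The hypothesis [0 < e] serves the empty set, whose supremum is 0: the compact set in a seminorm
    may be empty. *)
Lemma sup_lt_bound (A : set R) (C e : R) : (forall r, A r -> r <= C) -> C < e -> 0 < e -> sup A < e.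
Proof.
move=> AC Ce e0; have [->|/set0P A0] := eqVneq A set0; first by rewrite sup0.
by apply: le_lt_trans Ce; apply: ge_sup.
Qed.

Lemma sup_le_bound (A : set R) (C : R) : (forall r, A r -> r <= C) -> 0 <= C -> sup A <= C.
Proof.
move=> AC C0; have [->|/set0P A0] := eqVneq A set0; first by rewrite sup0.
exact: ge_sup.
Qed.

Lemma sup_image_ge0 (T : Type) (f : T -> R) (A : set T) : (forall t, 0 <= f t) ->
  (exists C, forall t, A t -> f t <= C) -> 0 <= sup [set f t | t in A].
Proof.
move=> f0 [C hC]; have [->|/set0P[t At]] := eqVneq A set0; first by rewrite image_set0 sup0.
apply: (le_trans (f0 t)); apply: ub_le_sup; last by exists t.
by exists C => _ [s As <-]; exact: hC.
Qed.

Lemma exists_snorm_ge al be : exists m, forall v : S, schwartz_seminorm al be v <= snorm m v.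
Proof.
exists (\sum_i al i + size (mword be))%N => v.
by apply: seminorm_le_snorm; rewrite ?leq_addr ?leq_addl.
Qed.

Lemma seminorm_derivn_bounded al be j K h : compact K -> K `<=` `]0, +oo[ ->
  exists C : R, forall t, K t -> schwartz_seminorm al be (curve_derivn j h t) <= C.
Proof.
move=> cK K0; have [m hm] := exists_snorm_ge al be.
have [C _ hC] := diff_quotient_bounded m cK K0 (@solution_derivn_cvg h j).
by exists C => t Kt; exact: le_trans (hm _) (hC t Kt).
Qed.

Lemma seminorm_segment_bounded al be (b : R) h :
  exists C : R, forall t, `[0, b]%classic t -> schwartz_seminorm al be (h t) <= C.
Proof.
have [m hm] := exists_snorm_ge al be.
have [C _ hC] := ucont_bounded m (@solution_ucont h b).
by exists C => t; rewrite /= in_itv /= => tb; exact: le_trans (hm _) (hC t tb).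
Qed.

Lemma smooth_seminorm_ge al be j K h t : compact K -> K `<=` `]0, +oo[ -> K t ->
  schwartz_seminorm al be (curve_derivn j h t) <= solution_seminorm_smooth al be j K h.
Proof.
move=> cK K0 Kt; apply: ub_le_sup; last by exists t.
have [C hC] := seminorm_derivn_bounded al be j h cK K0.
by exists C => _ [s Ks <-]; exact: hC.
Qed.

Lemma cont_seminorm_ge al be (b : nat) h t : 0 <= t <= b%:R ->
  schwartz_seminorm al be (h t) <= solution_seminorm_cont al be b h.
Proof.
move=> tb; apply: ub_le_sup; last by exists t => //=; rewrite in_itv.
have [C hC] := seminorm_segment_bounded al be b%:R h.
by exists C => _ [s Ks <-]; exact: hC.
Qed.

Lemma seminormD al be (u v : S) :
  schwartz_seminorm al be (u + v) <= schwartz_seminorm al be u + schwartz_seminorm al be v.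
Proof. by have := schwartz_seminorm_lin al be 1 u v; rewrite scale1r normc1 mul1r. Qed.

Lemma curve_derivnD x y j t : 0 < t ->
  curve_derivn j (x + y : X) t = curve_derivn j x t + curve_derivn j y t.
Proof.
move=> t0; have := curve_derivn_lin 1 j (solution_curve x) (solution_curve y) t0.
by rewrite !scale1r.
Qed.

Lemma smooth_seminormD al be j K x y : compact K -> K `<=` `]0, +oo[ ->
  solution_seminorm_smooth al be j K (x + y) <=
  solution_seminorm_smooth al be j K x + solution_seminorm_smooth al be j K y.
Proof.
move=> cK K0; apply: sup_le_bound.
  move=> _ [t Kt <-]; have t0 : 0 < t by move: (K0 t Kt); rewrite /= in_itv /= andbT.
  rewrite curve_derivnD //; apply: (le_trans (seminormD _ _ _ _)).
  by apply: lerD; apply: smooth_seminorm_ge.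
by apply: addr_ge0; (apply: sup_image_ge0; [move=> t; exact: schwartz_seminorm_ge0|
  exact: seminorm_derivn_bounded]).
Qed.

Lemma cont_seminormD al be (b : nat) x y :
  solution_seminorm_cont al be b (x + y) <=
  solution_seminorm_cont al be b x + solution_seminorm_cont al be b y.
Proof.
apply: sup_le_bound.
  move=> _ [t Kt <-]; rewrite /= in_itv /= in Kt.
  apply: (le_trans (seminormD al be (x t) (y t))).
  by apply: lerD; apply: cont_seminorm_ge.
by apply: addr_ge0; (apply: sup_image_ge0; [move=> t; exact: schwartz_seminorm_ge0|
  exact: seminorm_segment_bounded]).
Qed.

Let subX (x y : X) : X := x - y.

Lemma subbase_nbhs (B : set X) x : solution_subbase B -> B x -> nbhs x B.
Proof.
move=> sB Bx; rewrite nbhsE; exists B => //; split => //.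
exists [set B]; last by rewrite bigcup_set1.
move=> _ ->; exists [fset B]%fset; last by rewrite set_fset1 bigcap_set1.
by move=> A /fset1P ->; exact/mem_set.
Qed.

Lemma smooth_seminorm0 al be j K : solution_seminorm_smooth al be j K (0 : X) <= 0.
Proof.
apply: sup_le_bound => // _ [t _ <-].
by rewrite -[solution_fun 0]/(0 : R -> S) curve_derivn0 schwartz_seminorm0.
Qed.

Lemma cont_seminorm0 al be (b : nat) : solution_seminorm_cont al be b (0 : X) <= 0.
Proof. by apply: sup_le_bound => // _ [t _ <-]; rewrite schwartz_seminorm0. Qed.

Lemma adm_smooth_seminorm al be j K : compact K -> K `<=` `]0, +oo[ ->
  adm subX (solution_seminorm_smooth al be j K).
Proof.
move=> cK K0 p0 e e0; apply: subbase_nbhs; last first.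
  by rewrite /subX subrr; exact: le_lt_trans (smooth_seminorm0 _ _ _ _) e0.
by left; exists (al, be, j, K), p0, e.
Qed.

Lemma adm_cont_seminorm al be (b : nat) : (0 < b)%N -> adm subX (solution_seminorm_cont al be b).
Proof.
move=> b0 p0 e e0; apply: subbase_nbhs; last first.
  by rewrite /subX subrr; exact: le_lt_trans (cont_seminorm0 _ _ _) e0.
by right; exists (al, be, b), p0, e.
Qed.

(** [snorm_dom] with seminorms of a curve in place of those of one vector: it bounds the norm of the
    values of a curve by a quantity that is admissible for continuity. *)
Definition snorm_dom_of m (p : {ffun 'I_n -> nat} -> {ffun 'I_n -> nat} -> X -> R) h : R :=
  2 ^+ m * \sum_(k < m.+1) \sum_(w : k.-tuple 'I_n)
    (p [ffun=> 0%N] [ffun i => count_mem i w] h +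
     \sum_i p (mono1 m i) [ffun i => count_mem i w] h).

Lemma adm_snorm_dom_of m p : (forall al be, adm subX (p al be)) -> adm subX (snorm_dom_of m p).
Proof.
move=> hp; apply: admZ; first exact: exprn_ge0.
apply: adm_sum => k; apply: adm_sum => w; apply: admD => //.
by apply: adm_sum.
Qed.

Lemma snorm_dom_of_ge m p h (v : S) : (forall al be, schwartz_seminorm al be v <= p al be h) ->
  snorm m v <= snorm_dom_of m p h.
Proof.
move=> hp; apply: (le_trans (snorm_le_dom _ _)); apply: ler_wpM2l; first exact: exprn_ge0.
apply: ler_sum => k _; apply: ler_sum => w _; apply: lerD => //.
by apply: ler_sum.
Qed.

(** For j = 0 this makes the source term h of the inhomogeneous equation tame of every order. *)
Lemma solution_derivn_tame k j : tame subX k (fun h => curve_derivn j h).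
Proof.
elim: k j => [|k IH] j; (split; first by move=> m K cK K0;
  exists (snorm_dom_of m (fun al be => solution_seminorm_smooth al be j K));
  [apply: adm_snorm_dom_of => al be; exact: adm_smooth_seminorm|
   move=> h t Kt; apply: snorm_dom_of_ge => al be; exact: smooth_seminorm_ge]) => //.
by exists (fun h => curve_derivn j.+1 h) => // h t t0; exact: solution_derivn_cvg.
Qed.

Lemma solution_segment_adm m (b : R) : exists2 q, adm subX q &
  forall h t, 0 <= t -> t <= b -> snorm m (h t) <= q h.
Proof.
(* The successor makes the index positive, as the subbase requires. *)
pose N := (Num.bound `|b|).+1.
exists (snorm_dom_of m (fun al be => solution_seminorm_cont al be N)).
  by apply: adm_snorm_dom_of => al be; exact: adm_cont_seminorm.
move=> h t t0 tb; apply: snorm_dom_of_ge => al be; apply: cont_seminorm_ge.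
rewrite t0; apply: (le_trans tb); apply: (le_trans (ler_norm _)).
apply: (@le_trans _ _ (Num.bound `|b|)%:R); first exact/ltW/archi_boundP/normr_ge0.
by rewrite ler_nat.
Qed.

Lemma solution_cvg_subbase (F : set_system X) x : Filter F ->
  (forall B : set X, solution_subbase B -> B x -> F B) -> F --> x.
Proof.
move=> FF hF A; rewrite /= nbhsE => -[_ [[B sB <-] [D BD Dv]] sA].
apply: filterS sA _; apply: (@filterS _ _ _ D); first by move=> w Dw; exists D.
have [K sK KD] := sB _ BD; rewrite -KD; apply: filter_bigI => U KU.
apply: hF; first exact/set_mem/(sK _ KU).
by move: Dv; rewrite -KD; exact.
Qed.

(** Compatibility with subtraction turns the increment from p0 into a value of T, bounded by
    [q (sub p p0)], which is small near p0. *)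
Lemma continuous_into_solution (P : topologicalType) (sub : P -> P -> P) (T : P -> X) :
  (forall p p0, T p - T p0 = T (sub p p0)) ->
  (forall m j K, compact K -> K `<=` `]0, +oo[ -> exists2 q, adm sub q &
     forall p t, K t -> snorm m (curve_derivn j (T p) t) <= q p) ->
  (forall m (b : nat), exists2 q, adm sub q &
     forall p t, 0 <= t <= b%:R -> snorm m (T p t) <= q p) ->
  continuous T.
Proof.
move=> lT sT cT p0; apply: solution_cvg_subbase => B [].
  move=> [[[[al be] j] K1] [u [e [[cK K0] e0 ->]]]] TU.
  (* Subbasic sets are semiballs with an arbitrary centre u: T p0 lies inside with this slack, which
     bounds the admissible increment. *)
  have ve : 0 < e - solution_seminorm_smooth al be j K1 (T p0 - u) by rewrite subr_gt0.
  have [m hm] := exists_snorm_ge al be; have [q aq hq] := sT m j K1 cK K0.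
  apply: filterS (aq p0 _ ve) => p qp; rewrite /preimage /mkset.
  rewrite (_ : T p - u = (T p - T p0) + (T p0 - u)); last by rewrite addrA subrK.
  apply: (le_lt_trans (smooth_seminormD _ _ _ _ _ cK K0)); rewrite -ltrBrDr lT.
  apply: (@sup_lt_bound _ (q (sub p p0))) => // _ [t Kt <-].
  exact: le_trans (hm _) (hq _ _ Kt).
move=> [[[al be] b] [u [e [b0 e0 ->]]]] TU.
have ve : 0 < e - solution_seminorm_cont al be b (T p0 - u) by rewrite subr_gt0.
have [m hm] := exists_snorm_ge al be; have [q aq hq] := cT m b.
apply: filterS (aq p0 _ ve) => p qp; rewrite /preimage /mkset.
rewrite (_ : T p - u = (T p - T p0) + (T p0 - u)); last by rewrite addrA subrK.
apply: (le_lt_trans (cont_seminormD _ _ _ _ _)); rewrite -ltrBrDr lT.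
apply: (@sup_lt_bound _ (q (sub p p0))) => // _ [t Kt <-].
by rewrite /= in_itv /= in Kt; exact: le_trans (hm _) (hq _ _ Kt).
Qed.

End SolutionSpace.

(** * The solution maps *)

Section SolutionMaps.
Variables (R : realType) (n : nat) (a : R -> 'M[R]_n).
Local Notation A := (primitive_mx a).
Local Notation E := 'rV[R]_n.
Local Notation S := (schwartz R n).
Local Notation X := (solution_space R n).
Hypothesis ha : heat_coefficient a.
Variable L : R -> R -> seq E.
Hypothesis hL : forall s t, 0 <= s -> s <= t ->
  (size (L s t) <= n)%N /\ cov (L s t) = A t - A s.
Local Notation W s t := (@havg R n (L s t)).

Lemma coef_entry_derivn i k j (t : R) : 0 < t ->
  is_derive t (1 : R) (fun t => kappa R * derive1n j a t i k) (kappa R * derive1n j.+1 a t i k).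
Proof.
move=> t0; have [/(_ j t t0) dj _ _ _] := ha.
apply: is_deriveZ; have /derivable_mxP/(_ i k) d := dj.
by apply: (DeriveDef d); rewrite derive1nS derive1E (derive_mx dj) mxE.
Qed.

Lemma spartial_bounded (w : seq 'I_n) m : exists m', forall v : S,
  snorm m (spartial w v) <= snorm m' v.
Proof. by exists (m + size w)%N => v; exact: snorm_spartial. Qed.

(** Entry by entry the operator is a bounded operator times a smooth scalar, so [tame_scale] applies
    to the successive derivatives of kappa a_ij. *)
Lemma tame_slap (P : topologicalType) (sub : P -> P -> P) k (F : P -> R -> S) :
  tame sub k F -> tame sub k (fun p t => slap (kappa R *: a t) (F p t)).
Proof.
move=> tF; rewrite (_ : (fun p t => _) = fun p t =>
    \sum_i \sum_j (kappa R * derive1n 0 a t i j)%:C%C *: spartial [:: i; j] (F p t)); last first.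
  apply/funext => p; apply/funext => t; apply: eq_bigr => i _; apply: eq_bigr => j _.
  by rewrite mxE.
apply: tame_sum => i; apply: tame_sum => j.
have tS := @tame_linear R n P sub k F (spartial [:: i; j]) (spartial_bounded _) tF.
exact: (tame_scale (coef_entry_derivn i j) tS 0).
Qed.

(** Bootstrap: if u is tame of order k, so is the right side of the equation, which is u', and u is
    tame of order k + 1. Order 0 is the bound [bF]. *)
Lemma mild_tame (P : topologicalType) (sub : P -> P -> P) (u h : P -> R -> S) :
  (forall p b, mild L (u p) (h p) b) -> (forall p b, bounded_curve (u p) b) ->
  (forall p b, ucont (h p) 0 b) -> bounded_family sub u -> (forall k, tame sub k h) ->
  forall k, tame sub k u.
Proof.
move=> mu bu uh bF th; elim=> [|k IH]; split => //.
exists (fun p t => h p t + slap (kappa R *: a t) (u p t)).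
  move=> p t t0; have tt : t < t + 1 by rewrite ltrDl.
  exact: (mild_derive ha hL (mu p (t + 1)) (bu p (t + 1)) (uh p (t + 1)) t0 tt).
by apply: tameD => //; exact: tame_slap.
Qed.

(** Curves of the solution space are encoded as vanishing at negative times. *)
Definition halfline (u : R -> S) (t : R) : S := if t < 0 then 0 else u t.

Lemma halflineE u t : 0 <= t -> halfline u t = u t.
Proof. by rewrite /halfline ltNge => ->. Qed.

Lemma halfline_mild u h b : mild L u h b -> mild L (halfline u) h b.
Proof.
move=> mu m e e0; have [d d0 hd] := mu m e e0; exists d => // s t s0 st tb ts.
by rewrite !halflineE ?(le_trans s0) //; exact: hd.
Qed.

Lemma tame_solution_curve (P : topologicalType) (sub : P -> P -> P) (u h : P -> R -> S) p :
  (forall b, mild L (u p) (h p) b) -> (forall b, bounded_curve (u p) b) ->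
  (forall b, ucont (h p) 0 b) -> (forall k, tame sub k u) ->
  (forall t, t < 0 -> u p t = 0) -> u p \in @solution_pred R n.
Proof.
move=> mu bu uh tu u0; apply/solution_predP; split => //.
  move=> k t t0; have [G [_ [G' GG' _]] hG] := tame_derivn (tu (k + 1)%N).
  apply/cvg_ex; exists (G' p t); apply: diff_quotient_eq_cvg (GG' p t t0) => //.
  by move=> s s0; rewrite (hG p (u p)).
apply: ucont_continuous => b; apply: (mild_ucont ha hL (mu b) (bu b)).
exact/bounded_ucont/uh.
Qed.

Lemma compact_halfline_bounded (K : set R) : compact K -> K `<=` `]0, +oo[ ->
  exists b : nat, forall t, K t -> 0 <= t <= b%:R.
Proof.
move=> /compact_bounded[M [_ hM]] K0.
exists (Num.bound (`|M| + 1)) => t Kt; have := K0 t Kt; rewrite /= in_itv /= andbT => t0.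
rewrite (ltW t0); apply: (le_trans (ler_norm t)).
apply: (@le_trans _ _ (`|M| + 1)); last by apply/ltW/archi_boundP; rewrite addr_ge0.
by apply: hM => //; rewrite ltr_pwDr // ler_norm.
Qed.

Lemma linear_map_exists (U V : lmodType R[i]) (f : U -> V) : linear f ->
  exists g : {linear U -> V}, g =1 f.
Proof.
by move=> lf; exists (HB.pack_for {linear U -> V} f (GRing.isLinear.Build R[i] U V _ f lf)).
Qed.

Let subS (v w : S) : S := v - w.
Let subX (x y : X) : X := x - y.

Let hom (v : S) := halfline (fun t => W 0 t v).

Lemma hom_bound (b : R) m : exists2 C : R, 0 <= C & forall v t, 0 <= t -> t <= b ->
  snorm m (hom v t) <= C * snorm m v.
Proof.
have [C C0 hC] := heat_bound ha hL b m; exists C => // v t t0 tb.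
by rewrite /hom halflineE //; exact: hC.
Qed.

Lemma adm_snorm m : adm subS (snorm m).
Proof.
move=> p0 e e0.
have [/(_ (@cvg_id _ (nbhs p0))) h _] := @schwartz_cvg_snormP R n (nbhs p0) p0 _; exact: h.
Qed.

Lemma hom_segment m (b : R) : exists2 q, adm subS q &
  forall v t, 0 <= t <= b -> snorm m (hom v t) <= q v.
Proof.
have [C C0 hC] := hom_bound b m; exists (fun v => C * snorm m v).
  by apply: admZ => //; exact: adm_snorm.
by move=> v t /andP[t0 tb]; exact: hC.
Qed.

Lemma hom_mild v b : mild L (hom v) (fun=> 0) b.
Proof. by apply: halfline_mild; exact: (homogeneous_mild hL). Qed.

Lemma hom_bounded_curve v b : bounded_curve (hom v) b.
Proof.
move=> m; have [C C0 hC] := hom_bound b m; exists (C * snorm m v).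
  by rewrite mulr_ge0 // snorm_ge0.
by move=> s s0 sb; exact: hC.
Qed.

Lemma ucont0 b : ucont (fun=> 0 : S) 0 b.
Proof. by move=> m e e0; exists 1 => // s t _ _ _ _; rewrite subrr snorm0 ltW. Qed.

Lemma hom_tame k : tame subS k hom.
Proof.
apply: (@mild_tame _ subS hom (fun _ _ => 0)).
- exact: hom_mild.
- exact: hom_bounded_curve.
- by move=> _ b; exact: ucont0.
- move=> m K cK K0; have [b Kb] := compact_halfline_bounded cK K0.
  have [q aq hq] := hom_segment m b%:R; exists q => // v t /Kb; exact: hq.
- by move=> j; exact: tame0.
Qed.

Lemma hom_solution v : hom v \in @solution_pred R n.
Proof.
apply: (@tame_solution_curve _ subS hom (fun _ _ => 0)).
- exact: hom_mild.
- exact: hom_bounded_curve.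
- exact: ucont0.
- exact: hom_tame.
- by move=> t t0; rewrite /hom /halfline t0.
Qed.

Let inh (h : X) := halfline (duhamel L h).

Lemma inh_segment m (b : R) : exists2 q, adm subX q &
  forall h t, 0 <= t <= b -> snorm m (inh h t) <= q h.
Proof.
have [C C0 hC] := duhamel_bound ha hL b m.
have [q aq hq] := @solution_segment_adm R n m b.
exists (fun h => C * q h); first exact: admZ.
move=> h t /andP[t0 tb]; rewrite /inh halflineE //.
apply: hC => //; first exact: solution_ucont.
by move=> s /andP[s0 st]; apply: hq => //; exact: le_trans tb.
Qed.

Lemma inh_mild h b : mild L (inh h) h b.
Proof. by apply: halfline_mild; apply: (duhamel_mild ha hL); exact: solution_ucont. Qed.

Lemma inh_bounded_curve h b : bounded_curve (inh h) b.
Proof.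
move=> m; have [q _ hq] := inh_segment m b; exists `|q h| => // s s0 sb.
by apply: (le_trans (hq h s _)); rewrite ?s0 ?ler_norm.
Qed.

Lemma inh_tame k : tame subX k inh.
Proof.
apply: (@mild_tame _ subX inh (fun h => h)).
- exact: inh_mild.
- exact: inh_bounded_curve.
- by move=> h b; exact: solution_ucont.
- move=> m K cK K0; have [b Kb] := compact_halfline_bounded cK K0.
  have [q aq hq] := inh_segment m b%:R; exists q => // v t /Kb; exact: hq.
- by move=> j; exact: (@solution_derivn_tame R n j 0).
Qed.

Lemma inh_solution h : inh h \in @solution_pred R n.
Proof.
apply: (@tame_solution_curve _ subX inh (fun h => h)).
- exact: inh_mild.
- exact: inh_bounded_curve.
- by move=> b; exact: solution_ucont.
- exact: inh_tame.
- by move=> t t0; rewrite /inh /halfline t0.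
Qed.

(** Tameness controls all time derivatives on compact sets of positive times, and the last
    hypothesis controls the values down to time 0; these are the two families of seminorms. *)
Lemma tame_continuous (P : topologicalType) (sub : P -> P -> P) (T : P -> X) (F : P -> R -> S) :
  (forall p, T p = F p :> (R -> S)) -> (forall p p0, T p - T p0 = T (sub p p0)) ->
  (forall k, tame sub k F) ->
  (forall m (b : R), exists2 q, adm sub q & forall p t, 0 <= t <= b -> snorm m (F p t) <= q p) ->
  continuous T.
Proof.
move=> TF lT tF bF; apply: (@continuous_into_solution R n P sub T lT).
  move=> m j K cK K0; have [G tG hG] := tame_derivn (tF (j + 0)%N).
  have [q aq hq] := tame_bounded tG m cK K0; exists q => // p t Kt.
  have t0 : 0 < t by move: (K0 t Kt); rewrite /= in_itv /= andbT.
  by rewrite TF (hG p (F p)) //; exact: hq.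
by move=> m b; have [q aq hq] := bF m b%:R; exists q => // p t tb; rewrite TF; exact: hq.
Qed.

Lemma homogeneous_solution_map : exists W0 : {linear S -> X},
  (forall v t, 0 <= t -> W0 v t = W 0 t v) /\ continuous W0.
Proof.
pose f v : X := SolutionSpace (hom_solution v).
have lf : linear f.
  move=> c u v; apply/val_inj/funext => t; rewrite /= /hom /halfline.
  rewrite -[RHS]/(c *: (if t < 0 then 0 else W 0 t u) + (if t < 0 then 0 else W 0 t v)).
  by case: ifP => _; rewrite ?linearP ?scaler0 ?addr0.
have [g gf] := linear_map_exists lf; exists g; split.
  by move=> v t t0; rewrite gf /= /hom halflineE.
apply: (@tame_continuous _ subS g hom) => [v|v w|k|m b].
- by rewrite gf.
- by rewrite linearB.
- exact: hom_tame.
- exact: hom_segment.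
Qed.

Lemma inhomogeneous_solution_map : exists WI : {linear X -> X},
  (forall (h : X) t, 0 <= t -> is_riemann_integral (fun s => W s t (h s)) 0 t (WI h t)) /\ continuous WI.
Proof.
pose f h : X := SolutionSpace (inh_solution h).
have lf : linear f.
  move=> c u v; apply/val_inj/funext => t; rewrite /= /inh /halfline.
  rewrite -[RHS]/(c *: (if t < 0 then 0 else duhamel L u t) + (if t < 0 then 0 else duhamel L v t)).
  case: ltP => [_|t0]; first by rewrite scaler0 addr0.
  rewrite /duhamel -sint_lin //; try by apply: (duhamel_ucont ha hL); exact: solution_ucont.
  by apply: eq_sint => s _; rewrite -linearP.
have [g gf] := linear_map_exists lf; exists g; split.
  move=> h t t0; rewrite gf /= /inh halflineE //; apply: sint_is_riemann => //.
  by apply: (duhamel_ucont ha hL); exact: solution_ucont.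
apply: (@tame_continuous _ subX g inh) => [v|v w|k|m b].
- by rewrite gf.
- by rewrite linearB.
- exact: inh_tame.
- exact: inh_segment.
Qed.

End SolutionMaps.

Theorem proposition7 (R : realType) (n : nat) (a : R -> 'M[R]_n)
    (n_gt0 : (0 < n)%N) (ha : heat_coefficient a) :
  exists W : R -> R -> schwartz R n -> schwartz R n,
    (forall (s t : R) (v : schwartz R n), 0 <= s -> s <= t ->
       W s t v = heat_operator a s t v :> ('rV[R]_n -> R[i])) /\
    (exists W0 : {linear schwartz R n -> solution_space R n},
       (forall (v : schwartz R n) (t : R), 0 <= t -> W0 v t = W 0 t v) /\
       continuous W0) /\
    (exists WI : {linear solution_space R n -> solution_space R n},
       (forall (h : solution_space R n) (t : R), 0 <= t ->
          is_riemann_integral (fun s : R => W s t (h s)) 0 t (WI h t)) /\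
       continuous WI).
Proof.
have [L hL] := heat_semigroup_lists ha.
have hL' s t : 0 <= s -> s <= t ->
    (size (L s t) <= n)%N /\ cov (L s t) = primitive_mx a t - primitive_mx a s.
  by move=> s0 st; have [] := hL s t s0 st.
exists (fun s t => havg (L s t)); split.
  by move=> s t v s0 st; have [_ _] := hL s t s0 st; apply.
split; first exact: homogeneous_solution_map ha L hL'.
exact: inhomogeneous_solution_map ha L hL'.
Qed.
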